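(* Assume $\sigma>0$, $\int_{|x|\le1}|x|\nu(dx)<\infty$ and $d_+>0$. Then there exists a constant $C>0$ such that, for $t$ close enough to $T$, $$0\le b^{BS}(t)-b(t)\le C\sqrt{T-t}.$$
   Context: Let $X$ be a real Lévy process with characteristic triplet $(\sigma^2,\gamma,\nu)$ and Lévy–Itô decomposition $X_t=\gamma t+\sigma B_t+Y_t$, $B$ a standard Brownian motion; $(\mathcal F_t)$ the usual augmentation of its natural filtration. Fix $T>0$, $K>0$, $r>0$, $\delta\ge0$. Assume $\int_{|x|\ge1}e^x\nu(dx)<\infty$ and $\frac{\sigma^2}{2}+\gamma+\int(e^x-1-x\mathbf 1_{|x|\le1})\nu(dx)=0$. For $x\ge0$ let $S^x_t=xe^{(r-\delta)t+X_t}$; $P(t,x)=\sup_{\tau\in\mathcal T_{0,T-t}}\mathbb E[e^{-r\tau}(K-S^x_\tau)_+]$ (American put, $\mathcal T_{0,s}$ = stopping times in $[0,s]$), and $b(t)=\inf\{x\ge0:P(t,x)>(K-x)_+\}$ its critical price. Let $d_+=r-\delta-\int(e^y-1)_+\nu(dy)$. The associated Black–Scholes model is $S^{BS,x}_t=xe^{(r-\delta-\sigma^2/2)t+\sigma B_t}$, with American put price $P^{BS}(t,x)=\sup_{\tau\in\mathcal T_{0,T-t}}\mathbb E[e^{-r\tau}(K-S^{BS,x}_\tau)_+]$ and critical price $b^{BS}(t)=\inf\{x\ge0:P^{BS}(t,x)>(K-x)_+\}$. *)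

(* Defs.v *)
From HB Require Import structures.
From mathcomp Require Import all_boot all_order all_algebra.
From mathcomp Require Import all_classical all_reals all_analysis.
Set Implicit Arguments. Unset Strict Implicit. Unset Printing Implicit Defensive.
Import Order.TTheory GRing.Theory Num.Def Num.Theory.
Import numFieldNormedType.Exports.
Local Open Scope classical_set_scope.
Local Open Scope ring_scope.

Section LevyDefs.
Context {R : realType} {d : measure_display} {Omega : measurableType d}.
Variable (P : probability Omega R).

Definition complete_prob :=
  forall A N : set Omega, measurable A -> P A = 0%E -> N `<=` A -> measurable N.

Definition mutually_indep (n : nat) (Z : 'I_n -> Omega -> R) :=
  forall A : 'I_n -> set R, (forall i, measurable (A i)) ->
    fine (P (\bigcap_(i in [set: 'I_n]) (Z i @^-1` A i)))
    = \prod_(i < n) fine (P (Z i @^-1` A i)).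

Definition indep_of (Z : Omega -> R) (G : set (set Omega)) :=
  forall A C, G A -> measurable C ->
    fine (P (A `&` Z @^-1` C)) = fine (P A) * fine (P (Z @^-1` C)).

Definition cadlag (f : R -> R) :=
  (forall t, 0 <= t -> f x @[x --> t^'+] --> f t) /\
  (forall t, 0 < t -> cvg (f x @[x --> t^'-])).

(** real Lévy process with characteristic triplet (sigma^2, gamma, nu),
    Lévy–Khintchine exponent psi(u) = -sigma^2 u^2/2 + i gamma u
      + int (e^{iux} - 1 - iux 1_{|x|<=1}) nu(dx), written in real/imaginary parts *)
Definition Levy_measure (nu : {measure set R -> \bar R}) :=
  nu [set 0] = 0%E /\ (\int[nu]_x (Num.min 1 (x ^+ 2))%:E < +oo)%E.

Definition psi_re (sigma : R) (nu : {measure set R -> \bar R}) (u : R) : R :=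
  - (sigma ^+ 2 * u ^+ 2) / 2 + Rintegral nu setT (fun x => cos (u * x) - 1).

Definition psi_im (gamma : R) (nu : {measure set R -> \bar R}) (u : R) : R :=
  gamma * u + Rintegral nu setT
    (fun x => sin (u * x) - (if `|x| <= 1 then u * x else 0)).

Definition Levy_process (X : R -> Omega -> R) (sigma gamma : R)
    (nu : {measure set R -> \bar R}) :=
  [/\ (forall t, 0 <= t -> measurable_fun setT (X t)) /\
        (\forall w \ae P, X 0 w = 0),
      (forall (n : nat) (t : nat -> R), 0 <= t 0%N ->
          (forall i, (i < n)%N -> t i < t i.+1) ->
          mutually_indep (fun i : 'I_n => fun w => X (t i.+1) w - X (t i) w)),
      (forall s t, 0 <= s -> 0 <= t -> forall A, measurable A ->
          P ((fun w => X (s + t) w - X s w) @^-1` A) = P (X t @^-1` A)),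
      (\forall w \ae P, cadlag (fun t => X t w)) &
      (Levy_measure nu /\
       forall t u, 0 <= t ->
         (\int[P]_w (cos (u * X t w))%:E
            = (expR (t * psi_re sigma nu u) * cos (t * psi_im gamma nu u))%:E /\
          \int[P]_w (sin (u * X t w))%:E
            = (expR (t * psi_re sigma nu u) * sin (t * psi_im gamma nu u))%:E)%E)].

(** natural filtration of X augmented by the P-null sets, made right-continuous
    (usual augmentation); under [complete_prob], null sets are measurable *)
Definition aug_natural (X : R -> Omega -> R) (s : R) : set (set Omega) :=
  <<s [set: Omega],
      [set A | exists u C, [/\ 0 <= u, u <= s, measurable C & A = X u @^-1` C]]
      `|` [set N | measurable N /\ P N = 0%E] >>.

Definition usual_filtration (X : R -> Omega -> R) (t : R) : set (set Omega) :=
  [set A | forall s, t < s -> aug_natural X s A].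

Definition stopping_time (F : R -> set (set Omega)) (s : R) (tau : Omega -> R) :=
  (forall w, 0 <= tau w /\ tau w <= s) /\
  (forall u, 0 <= u -> F u [set w | tau w <= u]).

Definition Brownian_motion (F : R -> set (set Omega)) (B : R -> Omega -> R) :=
  [/\ (forall t, 0 <= t -> measurable_fun setT (B t)),
      (forall t, 0 <= t -> forall C, measurable C -> F t (B t @^-1` C)),
      (\forall w \ae P, B 0 w = 0),
      (\forall w \ae P, forall t : R, 0 <= t -> (fun s : R => B s w) @ t --> B t w) &
      (forall s t, 0 <= s -> s < t ->
         indep_of (fun w => B t w - B s w) (F s) /\
         forall C, measurable C ->
           P ((fun w => B t w - B s w) @^-1` C) = normal_prob 0 (Num.sqrt (t - s)) C)].

Definition amer_put (F : R -> set (set Omega)) (S : R -> Omega -> R)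
    (r K s : R) : \bar R :=
  ereal_sup [set (\int[P]_w (expR (- (r * tau w)) * Num.max (K - S (tau w) w) 0)%:E)%E
            | tau in [set tau | stopping_time F s tau]].

End LevyDefs.

Definition critical_price {R : realType} (V : R -> \bar R) (K : R) : R :=
  inf [set x : R | 0 <= x /\ ((Num.max (K - x) 0)%:E < V x)%E].

Definition d_plus {R : realType} (nu : {measure set R -> \bar R}) (r delta : R) : R :=
  r - delta - fine (\int[nu]_y (Num.max (expR y - 1) 0)%:E)%E.

(* Main.v *)
(** In both models the American price is a limit of Bermudan prices, computed by
    dynamic programming from the law of the log-price over one step [h] only; so no
    stochastic calculus is needed.  Over one step the Lévy factor is a limit of products
    of a lognormal factor, a constant [exp c] with [c = O(h)], and a jump factor, the
    last two having joint mean one.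

    Lower bound: the Bermudan Black-Scholes prices are convex, so by Jensen's inequality
    an independent factor of mean one can only increase them; hence P >= P^BS and
    b <= b^BS.

    Upper bound: write [theta = T - t], [b = b^BS(t)], [a = b - L sqrt theta] for a large
    constant [L].  By induction on the number of steps, the Bermudan Lévy price after [k]
    steps is at most V^BS_k + C k h q + O(k h^2), where [q] is a quadratic ramp which
    vanishes below [a] and equals one above the midpoint of [a] and [b].  Where [q = 1] the
    extra cost O(h) of one step is absorbed by the increment of [C k h q].  Below the
    midpoint V^BS_k is dominated by K - min(y, b), and the drift -d_+ K h of the payoff beats
    the cost of the ramp, which is O(theta h / L) since [q] varies on the scale
    [L sqrt theta], the diffusion reaching [b] with probability O(h^2) only.  At and below
    [a] this leaves P(t, x) <= K - x, so b(t) >= a. *)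
Require Import Defs.
From HB Require Import structures.
From mathcomp Require Import all_boot all_order all_algebra.
From mathcomp Require Import all_classical all_reals all_analysis.
From mathcomp Require Import measurable_realfun.
From mathcomp Require Import ring lra.
Set Implicit Arguments. Unset Strict Implicit. Unset Printing Implicit Defensive.
Import Order.TTheory GRing.Theory Num.Def Num.Theory.
Import numFieldNormedType.Exports.
Local Open Scope classical_set_scope.
Local Open Scope ring_scope.

(** * Laws and expectations of bounded functions *)

(** The induction runs over theta / h steps, so an error O(h^2) per step vanishes as h tends to 0,
    whereas an error O(h) has to be paid for. This dictates the tools: the excursion of the
    diffusion above b is estimated by a fourth moment, since a second moment would only give O(h).
    The balance K d_+ is what discounting earns, r K, minus what dividends and upward jumps can cost
    when the price is at most K. The ramp has slope O(1/s) and curvature O(1/s^2) on a zone of width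
    s, so its total cost is of order theta / s + theta / s^2; it stays below the balance once s is a
    large multiple of sqrt theta, which is the origin of the rate.

    Two obstacles shape the rest. The law of a Lévy increment is known only through its
    characteristic function, and only bounded Lipschitz tests pass to a weak limit; the exponential
    moments are therefore carried by the approximants, uniformly. And the increments are shown to be
    independent of the augmented natural filtration, while stopping times refer to its
    right-continuous version; rounding exercise dates upward bridges the two. *)

Section BoundedMeasurable.
Context {R : realType} {d : measure_display} {T : measurableType d}.
Implicit Types f g : T -> R.

(** Value functions and trigonometric tests are all bounded. With boundedness bundled to
    measurability, integrability under any probability law, Fubini and dominated convergence need no
    further side condition. *)
Definition bdmeas f := measurable_fun setT f /\ exists M : R, forall x, `|f x| <= M.

Lemma bdmeas_cst c : bdmeas (fun=> c).
Proof. by split=> //; exists `|c|. Qed.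

Lemma bdmeasD f g : bdmeas f -> bdmeas g -> bdmeas (fun x => f x + g x).
Proof.
move=> [mf [M fM]] [mg [N gN]]; split; first exact: measurable_funD.
by exists (M + N) => x; rewrite (le_trans (ler_normD _ _))// lerD.
Qed.

Lemma bdmeasM f g : bdmeas f -> bdmeas g -> bdmeas (fun x => f x * g x).
Proof.
move=> [mf [M fM]] [mg [N gN]]; split; first exact: measurable_funM.
by exists (M * N) => x; rewrite normrM ler_pM.
Qed.

Lemma bdmeasZ c f : bdmeas f -> bdmeas (fun x => c * f x).
Proof. by move=> bf; apply: bdmeasM => //; exact: bdmeas_cst. Qed.

Lemma bdmeasN f : bdmeas f -> bdmeas (fun x => - f x).
Proof.
move=> [mf [M fM]]; split; first exact: measurableT_comp.
by exists M => x; rewrite normrN.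
Qed.

Lemma bdmeasB f g : bdmeas f -> bdmeas g -> bdmeas (fun x => f x - g x).
Proof. by move=> bf bg; apply: bdmeasD => //; exact: bdmeasN. Qed.

Lemma bdmeas_indic A : measurable A -> bdmeas (fun x => \1_A x : R).
Proof.
move=> mA; split; first exact: measurable_indic.
by exists 1 => x; rewrite indicE; case: (_ \in _); rewrite ?normr1 ?normr0.
Qed.

Lemma bdmeas_itv f (a b : R) : measurable_fun setT f ->
  (forall x, a <= f x <= b) -> bdmeas f.
Proof.
move=> mf fab; split=> //; exists (Num.max (- a) b) => x.
have /andP[af fb] := fab x.
by rewrite ler_norml le_max fb orbT andbT lerNl le_max lerN2 af.
Qed.

End BoundedMeasurable.

Lemma bdmeas_comp {R : realType} d d' (T : measurableType d)
    (T' : measurableType d') (f : T -> R) (g : T' -> T) :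
  bdmeas f -> measurable_fun setT g -> bdmeas (fun x => f (g x)).
Proof.
move=> [mf [M fM]] mg; split; first exact: measurableT_comp.
by exists M => x /=.
Qed.

Lemma integrable_dominated {R : realType} d (T : measurableType d)
    (mu : {measure set T -> \bar R}) (f g : T -> R) :
  measurable_fun setT f -> (forall x, `|f x| <= g x) ->
  mu.-integrable setT (EFin \o g) -> mu.-integrable setT (EFin \o f).
Proof.
move=> mf fg; apply: le_integrable => //; first exact/measurable_EFinP.
by move=> x _ /=; rewrite lee_fin (le_trans (fg x))// ler_norm.
Qed.

Lemma integrable_realD {R : realType} d (T : measurableType d)
    (mu : {measure set T -> \bar R}) (f g : T -> R) :
  mu.-integrable setT (EFin \o f) -> mu.-integrable setT (EFin \o g) ->
  mu.-integrable setT (EFin \o (fun x => f x + g x)).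
Proof. by move=> fi gi; rewrite (_ : _ \o _ = (EFin \o f) \+ (EFin \o g))//; exact: integrableD. Qed.

Lemma integrable_realZ {R : realType} d (T : measurableType d)
    (mu : {measure set T -> \bar R}) (c : R) (f : T -> R) :
  mu.-integrable setT (EFin \o f) ->
  mu.-integrable setT (EFin \o (fun x => c * f x)).
Proof. by move=> fi; rewrite (_ : _ \o _ = (fun x => c%:E * (EFin \o f) x)%E)//; exact: integrableZl. Qed.

Section Expectation.
Context {R : realType} {d : measure_display} {T : measurableType d}.
Variable P : probability T R.
Implicit Types f g : T -> R.

Lemma bdmeas_integrable f : bdmeas f -> P.-integrable setT (EFin \o f).
Proof.
move=> [mf [M fM]]; apply: measurable_bounded_integrable => //.
  by rewrite (le_lt_trans (probability_le1 _ _))// ltry.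
by exists M; split; [exact: num_real|move=> x /ltW Mx y _; exact: le_trans Mx].
Qed.

Lemma expectation_cst (c : R) : \int[P]_x c = c.
Proof. by rewrite Rintegral_cst//= (_ : P setT = 1%E) ?mulr1//; exact: probability_setT. Qed.

Lemma expectation_le_cst f c : P.-integrable setT (EFin \o f) ->
  (forall x, f x <= c) -> \int[P]_x f x <= c.
Proof.
move=> fi fc; rewrite -[leRHS]expectation_cst; apply: le_Rintegral => //.
by apply: bdmeas_integrable; exact: bdmeas_cst.
Qed.

Lemma expectation_ge_cst f c : P.-integrable setT (EFin \o f) ->
  (forall x, c <= f x) -> c <= \int[P]_x f x.
Proof.
move=> fi fc; rewrite -[leLHS]expectation_cst; apply: le_Rintegral => //.
by apply: bdmeas_integrable; exact: bdmeas_cst.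
Qed.

Lemma expectation_norm_le f M : measurable_fun setT f ->
  (forall x, `|f x| <= M) -> `|\int[P]_x f x| <= M.
Proof.
move=> mf fM; have bf : bdmeas f by split=> //; exists M.
have fi := bdmeas_integrable bf.
rewrite (le_trans (le_normr_Rintegral _ fi))//.
apply: expectation_le_cst => //.
exact: (integrable_norm fi).
Qed.

Lemma expectationD f g : bdmeas f -> bdmeas g ->
  \int[P]_x (f x + g x) = \int[P]_x f x + \int[P]_x g x.
Proof. by move=> bf bg; rewrite RintegralD//; exact: bdmeas_integrable. Qed.

Lemma expectationB f g : bdmeas f -> bdmeas g ->
  \int[P]_x (f x - g x) = \int[P]_x f x - \int[P]_x g x.
Proof. by move=> bf bg; rewrite RintegralB//; exact: bdmeas_integrable. Qed.

Lemma expectationZ c f : bdmeas f -> \int[P]_x (c * f x) = c * \int[P]_x f x.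
Proof. by move=> bf; rewrite RintegralZl//; exact: bdmeas_integrable. Qed.

Lemma expectation_le f g : bdmeas f -> bdmeas g -> (forall x, f x <= g x) ->
  \int[P]_x f x <= \int[P]_x g x.
Proof. by move=> bf bg fg; apply: le_Rintegral => //; exact: bdmeas_integrable. Qed.

Lemma expectation_EFin f : P.-integrable setT (EFin \o f) ->
  (\int[P]_x (f x)%:E)%E = (\int[P]_x f x)%:E.
Proof. by move=> fi; rewrite /Rintegral fineK//; exact: integrable_fin_num. Qed.

Lemma expectation_cvg (f_ : nat -> T -> R) f M :
  (forall n, measurable_fun setT (f_ n)) -> measurable_fun setT f ->
  {ae P, forall x, f_ ^~ x @ \oo --> f x} ->
  (forall n x, `|f_ n x| <= M) ->
  \int[P]_x f_ n x @[n --> \oo] --> \int[P]_x f x.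
Proof.
move=> mf_ mf cf fM.
have [| | | | |fi _ cv] := @dominated_convergence _ _ _ P setT measurableT
    (fun n => EFin \o f_ n) (EFin \o f) (EFin \o cst M).
- by move=> n; exact/measurable_EFinP.
- exact/measurable_EFinP.
- apply: filterS cf => x cx _; apply: cvg_EFin; last exact: cx.
  exact: nearW.
- by apply: bdmeas_integrable; exact: bdmeas_cst.
- by apply: aeW => x n _; rewrite lee_fin.
by apply: fine_cvg; rewrite fineK//; exact: integrable_fin_num.
Qed.

End Expectation.

Section Fubini.
Context {R : realType} {d1 d2 : measure_display}.
Context {T1 : measurableType d1} {T2 : measurableType d2}.
Variables (P1 : probability T1 R) (P2 : probability T2 R).
Variable f : T1 * T2 -> R.
Hypothesis bf : bdmeas f.

Let bf1 x : bdmeas (fun y => f (x, y)).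
Proof. exact: (bdmeas_comp bf (pair1_measurable x)). Qed.

Let bf2 y : bdmeas (fun x => f (x, y)).
Proof. exact: (bdmeas_comp bf (pair2_measurable y)). Qed.

Let fi : (P1 \x P2)%E.-integrable setT (EFin \o f).
Proof. exact: (bdmeas_integrable [the probability _ _ of (P1 \x P2)%E] bf). Qed.

Lemma bdmeas_expectation : bdmeas (fun x => \int[P2]_y f (x, y)).
Proof.
have [mf [M fM]] := bf; split.
- have := measurable_fubini_F fi.
  rewrite /fubini_F/= => h; exact: (measurableT_comp (fine_measurable measurableT) h).
- by exists M => x; apply: expectation_norm_le => //; have [] := bf1 x.
Qed.

Lemma expectation_Fubini :
  \int[P1]_x \int[P2]_y f (x, y) = \int[P2]_y \int[P1]_x f (x, y).
Proof.
have := Fubini fi; rewrite /=.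
under eq_integral => x _ do rewrite (expectation_EFin (bdmeas_integrable P2 (bf1 x))).
under [in X in _ = X -> _]eq_integral => y _ do
  rewrite (expectation_EFin (bdmeas_integrable P1 (bf2 y))).
by rewrite /Rintegral => ->.
Qed.

End Fubini.

Section Law.
Context {R : realType} {d d' : measure_display}.
Context {T : measurableType d} {T' : measurableType d'}.
Variables (P : probability T R) (Z : T -> T').
Hypothesis mZ : measurable_fun setT Z.

Let Zmfun : {mfun T >-> T'} := HB.pack Z (isMeasurableFun.Build _ _ _ _ Z mZ).

Definition law : probability T' R := distribution P Zmfun.

Lemma ge0_integral_law (f : T' -> \bar R) : measurable_fun setT f ->
  (forall y, 0 <= f y)%E -> (\int[law]_y f y = \int[P]_x f (Z x))%E.
Proof. by move=> mf f0; rewrite ge0_integral_pushforward. Qed.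

Lemma integrable_lawP (f : T' -> R) : measurable_fun setT f ->
  law.-integrable setT (EFin \o f) <-> P.-integrable setT (EFin \o (fun x => f (Z x))).
Proof.
move=> mf; have e : (\int[law]_y `|(f y)%:E| = \int[P]_x `|(f (Z x))%:E|)%E.
  rewrite ge0_integral_law//; apply: measurableT_comp => //.
  exact/measurable_EFinP.
split=> /integrableP[_ fi]; apply/integrableP; split.
- by apply/measurable_EFinP; exact: measurableT_comp.
- by rewrite -e.
- exact/measurable_EFinP.
- by rewrite e.
Qed.

Lemma expectation_law (f : T' -> R) : measurable_fun setT f ->
  P.-integrable setT (EFin \o (fun x => f (Z x))) ->
  \int[law]_y f y = \int[P]_x f (Z x).
Proof.
move=> mf fi; rewrite /Rintegral; congr fine.
by rewrite integral_pushforward//; exact/measurable_EFinP.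
Qed.

End Law.

Section Convolution.
Context {R : realType}.
Implicit Types P Q : probability R R.

Let madd : measurable_fun setT (fun p : R * R => p.1 + p.2).
Proof. by apply: measurable_funD; [exact: measurable_fst|exact: measurable_snd]. Qed.

Definition conv P Q : probability R R :=
  law [the probability _ _ of (P \x Q)%E] madd.

Lemma ge0_integral_conv P Q (f : R -> \bar R) : measurable_fun setT f ->
  (forall y, 0 <= f y)%E ->
  (\int[conv P Q]_y f y = \int[P]_x \int[Q]_y f (x + y)%R)%E.
Proof.
move=> mf f0; rewrite ge0_integral_law//.
by rewrite (@fubini_tonelli1 _ _ _ _ _ P Q)//; exact: measurableT_comp.
Qed.

Lemma expectation_conv P Q (f : R -> R) : bdmeas f ->
  \int[conv P Q]_z f z = \int[P]_x \int[Q]_y f (x + y).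
Proof.
move=> bf; have [mf _] := bf; have bfa := bdmeas_comp bf madd.
have fi := bdmeas_integrable [the probability _ _ of (P \x Q)%E] bfa.
rewrite expectation_law// {1}/Rintegral.
have := integral12_prod_meas1 fi; rewrite /fubini_F/= => <-.
rewrite /Rintegral; congr fine; apply: eq_integral => x _ /=.
by rewrite expectation_EFin//; apply/bdmeas_integrable/(bdmeas_comp bfa (pair1_measurable x)).
Qed.

End Convolution.

(** * Transforms of the normal law, and convergence of expectations from that of cosine transforms *)

Section NormalLaw.
Context {R : realType}.
Variables (m s : R).
Notation mu := (@lebesgue_measure R).
Notation N := (@normal_prob R).

(** Change of variables holds for the Radon-Nikodym derivative of the normal law; that derivative
    agrees almost everywhere with [normal_pdf], because both have the same integral over every
    measurable set. *)
Lemma ge0_integral_normal_prob (f : R -> \bar R) : measurable_fun setT f ->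
  (forall x, 0 <= f x)%E ->
  (\int[N m s]_x f x = \int[mu]_x (f x * (normal_pdf m s x)%:E))%E.
Proof.
move=> mf f0.
rewrite -(Radon_Nikodym_SigmaFinite.change_of_variables (normal_prob_dominates m s))//.
apply: ae_eq_integral => //.
- apply: emeasurable_funM => //; apply: (measurable_int mu).
  exact: Radon_Nikodym_SigmaFinite.f_integrable (normal_prob_dominates m s).
- apply: emeasurable_funM => //; apply/measurable_EFinP.
  exact: measurable_normal_pdf.
- apply: ae_eqe_mul2l => /=.
  apply: integral_ae_eq => //=.
  + exact: Radon_Nikodym_SigmaFinite.f_integrable (normal_prob_dominates m s).
  + by apply/measurable_EFinP; exact: measurable_normal_pdf.
  + move=> E _ mE.
    by rewrite -(Radon_Nikodym_SigmaFinite.f_integral (normal_prob_dominates m s)).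
Qed.

Lemma integrable_normal_probP (f : R -> R) : measurable_fun setT f ->
  (N m s).-integrable setT (EFin \o f) <->
  mu.-integrable setT (fun x => (f x * normal_pdf m s x)%:E).
Proof.
move=> mf; have e : (\int[N m s]_x `|(f x)%:E| =
    \int[mu]_x `|(f x * normal_pdf m s x)%:E|)%E.
  rewrite ge0_integral_normal_prob//; last first.
    by apply: measurableT_comp => //; exact/measurable_EFinP.
  apply: eq_integral => x _; rewrite EFinM abseM; congr (_ * _)%E.
  by rewrite gee0_abs// lee_fin normal_pdf_ge0.
split=> /integrableP[_ fi]; apply/integrableP; split.
- by apply/measurable_EFinP/measurable_funM => //; exact: measurable_normal_pdf.
- by rewrite -e.
- exact/measurable_EFinP.
- by rewrite e.
Qed.

Lemma expectation_normal_prob (f : R -> R) : measurable_fun setT f ->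
  (N m s).-integrable setT (EFin \o f) ->
  \int[N m s]_x f x = \int[mu]_x (f x * normal_pdf m s x).
Proof.
move=> mf fi; rewrite /Rintegral; congr fine.
rewrite integralE [RHS]integralE.
rewrite !ge0_integral_normal_prob//; last 2 first.
- exact/measurable_funeneg/measurable_EFinP.
- exact/measurable_funepos/measurable_EFinP.
congr (_ - _)%E; apply: eq_integral => x _.
- by rewrite !funeposE -!EFin_max -EFinM maxr_pMl ?normal_pdf_ge0// mul0r.
- by rewrite !funenegE -!EFinN -!EFin_max -EFinM maxr_pMl ?normal_pdf_ge0// mul0r mulNr.
Qed.

End NormalLaw.

Section NormalTransforms.
Context {R : realType}.
Variable s : R.
Hypothesis s0 : s != 0.
Notation mu := (@lebesgue_measure R).
Notation N := (@normal_prob R 0 s).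

(* Completing the square turns the exponential tilt of a centered normal density into a shifted normal density. *)
Lemma normal_pdf_tilt (a x : R) : expR (a * x) * normal_pdf 0 s x =
  expR (a ^+ 2 * s ^+ 2 / 2) * normal_pdf (a * s ^+ 2) s x.
Proof.
rewrite !normal_pdfE// mulrCA [RHS]mulrCA; congr (_ * _).
rewrite /normal_fun -!expRD; congr expR.
by field.
Qed.

Lemma normal_mgfe (a : R) :
  (\int[N]_x (expR (a * x))%:E = (expR (a ^+ 2 * s ^+ 2 / 2))%:E)%E.
Proof.
have mf : measurable_fun setT (fun x : R => expR (a * x)).
  by apply: measurableT_comp => //; exact: measurable_funM.
rewrite ge0_integral_normal_prob//; last exact/measurable_EFinP.
under eq_integral do rewrite -EFinM normal_pdf_tilt EFinM.
rewrite ge0_integralZl//=; first by rewrite integral_normal_pdf mule1.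
- by apply/measurable_EFinP; exact: measurable_normal_pdf.
- by move=> x _; rewrite lee_fin normal_pdf_ge0.
Qed.

Lemma normal_mgf_integrable (a : R) :
  N.-integrable setT (EFin \o (fun x => expR (a * x))).
Proof.
apply/integrableP; split.
  by apply/measurable_EFinP/measurableT_comp => //; exact: measurable_funM.
under eq_integral do rewrite /= ger0_norm ?expR_ge0//.
by rewrite normal_mgfe ltry.
Qed.

Lemma normal_mgf (a : R) :
  \int[N]_x expR (a * x) = expR (a ^+ 2 * s ^+ 2 / 2).
Proof. by rewrite /Rintegral normal_mgfe. Qed.

Lemma norm_le_expR (x : R) : `|x| <= expR (1 * x) + expR (- 1 * x).
Proof.
rewrite mul1r mulN1r; have := expR_ge1Dx x; have := expR_ge1Dx (- x).
have := expR_ge0 x; have := expR_ge0 (- x).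
by move=> *; rewrite ler_norml; apply/andP; split; lra.
Qed.

Lemma normal_norm_integrable : N.-integrable setT (EFin \o (fun x : R => `|x|)).
Proof.
refine (@integrable_dominated R _ _ N (fun x : R => `|x|) (fun x => expR (1 * x) + expR (- 1 * x)) _ _ _).
- exact: measurableT_comp.
- by move=> x; rewrite normr_id norm_le_expR.
- by apply: integrable_realD; exact: normal_mgf_integrable.
Qed.

Lemma bdmeas_cos (u theta : R) : bdmeas (fun x => cos (u * x + theta)).
Proof.
split; last by exists 1 => x; rewrite ler_norml cos_geN1 cos_le1.
have mc : measurable_fun setT (@cos R) by apply: continuous_measurable_fun; exact: continuous_cos.
by apply: (measurableT_comp mc); apply: measurable_funD => //; exact: measurable_funM.
Qed.

Lemma bdmeas_sin (u theta : R) : bdmeas (fun x => sin (u * x + theta)).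
Proof.
split; last by exists 1 => x; rewrite ler_norml sin_geN1 sin_le1.
have mc : measurable_fun setT (@sin R) by apply: continuous_measurable_fun; exact: continuous_sin.
by apply: (measurableT_comp mc); apply: measurable_funD => //; exact: measurable_funM.
Qed.

(** [g'] is the derivative of [g], and [g] vanishes at both infinities. Hence [g'] has integral zero
    over the line, which is Stein's identity with a sine as test function. *)
Let g (u theta x : R) := sin (u * x + theta) * normal_pdf 0 s x.
Let g' (u theta x : R) := u * (cos (u * x + theta) * normal_pdf 0 s x) -
  (s ^+ 2)^-1 * (x * sin (u * x + theta) * normal_pdf 0 s x).

Let is_derive_normal_pdf (x : R) :
  is_derive x 1 (normal_pdf 0 s) (- (x / s ^+ 2) * normal_pdf 0 s x).
Proof.
have -> : normal_pdf 0 s = fun x => normal_peak s *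
    expR (- (s ^+ 2 *+ 2)^-1 * (x * x)).
  rewrite normal_pdfE//; apply/funext => y; rewrite /normal_fun; congr (_ * expR _).
  by rewrite subr0 expr2; field.
apply: is_derive_eq; rewrite /GRing.scale/=.
by rewrite -mulr_natr; field.
Qed.

Lemma is_derive_sin_affine (u theta x : R) :
  is_derive x 1 (fun y => sin (u * y + theta)) (u * cos (u * x + theta)).
Proof.
have h : is_derive x (1 : R) (fun y => u * y + theta) u.
  by apply: is_derive_eq; rewrite /GRing.scale/= mulr1 addr0.
have := @is_derive1_comp R (@sin R) (fun y => u * y + theta) x _ _ (is_derive_sin _) h.
by move/is_derive_eq; apply; rewrite mulrC.
Qed.

Lemma is_derive_cos_affine (u theta x : R) :
  is_derive x 1 (fun y => cos (u * y + theta)) (- (u * sin (u * x + theta))).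
Proof.
have h : is_derive x (1 : R) (fun y => u * y + theta) u.
  by apply: is_derive_eq; rewrite /GRing.scale/= mulr1 addr0.
have := @is_derive1_comp R (@cos R) (fun y => u * y + theta) x _ _ (is_derive_cos _) h.
by move/is_derive_eq; apply; rewrite mulNr mulrC.
Qed.

Let is_derive_g u theta (x : R) : is_derive x 1 (g u theta) (g' u theta x).
Proof.
have := is_deriveM (is_derive_sin_affine u theta x) (is_derive_normal_pdf x).
move/is_derive_eq; apply.
by rewrite /g' /GRing.scale/=; field.
Qed.

Let cg' u theta : continuous (g' u theta).
Proof.
have cp := @continuous_normal_pdf R 0 s s0.
have ca (x : R) : {for x, continuous (fun y => u * y + theta)}.
  apply: cvgD; last exact: cvg_cst.
  by apply: cvgM; [exact: cvg_cst|exact: cvg_id].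
have cc (x : R) : cos (u * y + theta) @[y --> x] --> cos (u * x + theta).
  exact: (continuous_comp (ca x) (@continuous_cos R _)).
have cs (x : R) : sin (u * y + theta) @[y --> x] --> sin (u * x + theta).
  exact: (continuous_comp (ca x) (@continuous_sin R _)).
move=> x; apply: cvgB.
  by apply: cvgM; [exact: cvg_cst|apply: cvgM; [exact: cc|exact: cp]].
apply: cvgM; [exact: cvg_cst|apply: cvgM; last exact: cp].
by apply: cvgM; [exact: cvg_id|exact: cs].
Qed.

Let bg u theta x : `|g u theta x| <= normal_pdf 0 s x.
Proof.
rewrite normrM (ger0_norm (normal_pdf_ge0 _ _ _)) ler_piMl ?normal_pdf_ge0//.
by rewrite ler_norml sin_geN1 sin_le1.
Qed.

(** By the tilt, [expR n%:R] times the density is a constant times a shifted density, hence bounded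
    by the peak, and [expR n%:R] is at least [n.+1%:R]. This crude decay is enough for boundary
    terms. *)
Let normal_pdf_le (e : R) n : (e = 1 \/ e = - 1) -> normal_pdf 0 s (e * n%:R) <=
  expR (s ^+ 2 / 2) * normal_peak s * n.+1%:R^-1.
Proof.
move=> e1; have e2 : e ^+ 2 = 1 by case: e1 => ->; rewrite ?sqrrN expr1n.
have := normal_pdf_tilt e (e * n%:R); rewrite mulrA -expr2 e2 !mul1r => h.
rewrite ler_pdivlMr ?ltr0n// (@le_trans _ _ (expR n%:R * normal_pdf 0 s (e * n%:R)))//.
  rewrite mulrC ler_wpM2r ?normal_pdf_ge0//.
  by rewrite (le_trans _ (expR_ge1Dx _))// -natr1 addrC.
by rewrite h ler_wpM2l ?expR_ge0// normal_pdf_ub.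
Qed.

Let g_cvg0 (e u theta : R) : (e = 1 \/ e = - 1) -> g u theta (e * n%:R) @[n --> \oo] --> 0.
Proof.
move=> e1; apply: norm_cvg0.
apply: (@squeeze_cvgr _ _ _ _ (cst 0)
  (fun n => expR (s ^+ 2 / 2) * normal_peak s * n.+1%:R^-1)).
- by apply: nearW => n /=; rewrite normr_ge0 (le_trans (bg _ _ _))// normal_pdf_le.
- exact: cvg_cst.
- rewrite -[X in _ --> X](mulr0 (expR (s ^+ 2 / 2) * normal_peak s)).
  by apply: cvgM; [exact: cvg_cst|exact: cvg_harmonic].
Qed.

Let g'_integrable u theta : mu.-integrable setT (EFin \o g' u theta).
Proof.
have mg' : measurable_fun setT (g' u theta).
  by apply: continuous_measurable_fun; exact: cg'.
apply: (@integrable_dominated R _ _ mu _ (fun x => `|u| * normal_pdf 0 s x +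
   (s ^+ 2)^-1 * (`|x| * normal_pdf 0 s x))).
- exact: mg'.
- move=> x; rewrite /g' (le_trans (ler_normB _ _))// !normrM.
  rewrite !(ger0_norm (normal_pdf_ge0 _ _ _)).
  have p0 := normal_pdf_ge0 0 s x; apply: lerD.
    rewrite ler_wpM2l// ler_piMl// ler_norml cos_geN1 cos_le1//.
  rewrite normfV normrX real_normK ?num_real//.
  rewrite ler_wpM2l ?invr_ge0 ?sqr_ge0// ler_wpM2r// ler_piMr//.
  by rewrite ler_norml sin_geN1 sin_le1.
- apply: integrable_realD; apply: integrable_realZ.
    exact: integrable_normal_pdf.
  have mn : measurable_fun setT (fun x : R => `|x|) by exact: measurableT_comp.
  have h := proj1 (integrable_normal_probP 0 s mn) normal_norm_integrable; exact: h.
Qed.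

Let FTC_g' u theta n : (0 < n)%N ->
  (\int[mu]_(x in `[(-1 * n%:R)%R, (1 * n%:R)%R]) (g' u theta x)%:E =
   (g u theta (1 * n%:R) - g u theta (-1 * n%:R))%:E)%E.
Proof.
move=> n0; have nn : - 1 * n%:R < 1 * n%:R :> R.
  by rewrite mulN1r mul1r gtrN// ltr0n.
have dg x : derivable (g u theta) x 1 by have [] := is_derive_g u theta x.
rewrite (@continuous_FTC2 _ (g' u theta) (g u theta)) ?EFinB//.
- by apply: continuous_subspaceT => x; exact: cg'.
- have cg x : {for x, continuous (g u theta)}.
    by apply: differentiable_continuous; exact/derivable1_diffP.
  split.
  + by move=> x _; exact: dg.
  + by apply: cvg_at_right_filter; exact: cg.
  + by apply: cvg_at_left_filter; exact: cg.
- by move=> x _; rewrite derive1E; have [] := is_derive_g u theta x.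
Qed.

Let integral_g' u theta : \int[mu]_x g' u theta x = 0.
Proof.
pose D n : set R := `[(-1 * n%:R)%R, (1 * n%:R)%R]%classic.
have [| | | | |_ _ cv] := @dominated_convergence _ _ _ mu setT measurableT
    (fun n => (EFin \o g' u theta) \_ (D n)) (EFin \o g' u theta)
    (fun x => `|(EFin \o g' u theta) x|%E).
- move=> n; apply/(measurable_restrictT _ (measurable_itv _)).
  by apply: measurable_funTS; exact: measurable_int (g'_integrable u theta).
- exact: measurable_int (g'_integrable u theta).
- apply: aeW => x _; apply: cvg_near_cst; near=> n.
  rewrite patchE mem_set//= /D/= in_itv/= mulN1r mul1r -ler_norml.
  near: n; exact: nbhs_infty_ger.
- exact: (integrable_abse (g'_integrable u theta)).
- apply: aeW => x n _; rewrite patchE; case: ifP => // _.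
  by rewrite abse0 abse_ge0.
have cv0 : (\int[mu]_x ((EFin \o g' u theta) \_ (D n)) x)%E @[n --> \oo] --> (0 : R)%:E.
  have : (g u theta (1 * n%:R) - g u theta (-1 * n%:R))%:E @[n --> \oo] --> (0 : R)%:E.
    apply: cvg_EFin; first exact: nearW.
    by rewrite -[X in _ --> X](subrr 0); apply: cvgB; apply: g_cvg0; [left|right].
  apply: cvg_trans; apply: near_eq_cvg; near=> n.
  rewrite -FTC_g'; last by near: n; exists 1%N.
  by rewrite [LHS]integral_mkcond.
have -> : \int[mu]_x g' u theta x = fine (0%:E : \bar R); last by [].
rewrite /Rintegral; congr fine.
exact: (cvg_unique _ cv cv0).
Unshelve. all: by end_near. Qed.

Let integrable_xsin u theta :
  N.-integrable setT (EFin \o (fun x => x * sin (u * x + theta))).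
Proof.
apply: (@integrable_dominated R _ _ N _ (fun x : R => `|x|)).
- by apply: measurable_funM => //; have [] := bdmeas_sin u theta.
- by move=> x; rewrite normrM ler_piMr// ler_norml sin_geN1 sin_le1.
- exact: normal_norm_integrable.
Qed.

Let stein u theta : \int[N]_x (x * sin (u * x + theta)) =
  s ^+ 2 * u * \int[N]_x cos (u * x + theta).
Proof.
have ic := bdmeas_integrable N (bdmeas_cos u theta).
have [mc _] := bdmeas_cos u theta.
have ms : measurable_fun setT (fun x : R => x * sin (u * x + theta)).
  by apply: measurable_funM => //; have [] := bdmeas_sin u theta.
rewrite !expectation_normal_prob//.
have i1 := proj1 (integrable_normal_probP 0 s mc) ic.
have i2 := proj1 (integrable_normal_probP 0 s ms) (integrable_xsin u theta).
have := integral_g' u theta; rewrite /g' RintegralB//; last 2 first.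
- exact: integrable_realZ.
- exact: integrable_realZ.
rewrite !RintegralZl// => /eqP; rewrite subr_eq0 => /eqP e.
by rewrite -mulrA e mulrA divff ?mul1r// sqrf_eq0.
Qed.

Let F theta u := \int[N]_x cos (u * x + theta).

Let is_derive_F (theta u : R) : is_derive u 1 (F theta) (- (s ^+ 2 * u) * F theta u).
Proof.
have Iu : `]u - 1, u + 1[%classic u by rewrite /= in_itv/= gtrBl ltr01 ltrDl ltr01.
have dc (v y : R) : is_derive v 1 (fun w => cos (w * y + theta)) (- (y * sin (v * y + theta))).
  have -> : (fun w => cos (w * y + theta)) = (fun w => cos (y * w + theta)).
    by apply/funext => w; rewrite mulrC.
  by rewrite (mulrC v); exact: is_derive_cos_affine.
have intf : forall x : R, `]u - 1, u + 1[%classic x ->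
    N.-integrable setT (EFin \o (fun y => cos (x * y + theta))).
  by move=> x _; exact/bdmeas_integrable/bdmeas_cos.
have derf1 : forall x y : R, `]u - 1, u + 1[%classic x -> setT y ->
    derivable (fun w : R => cos (w * y + theta)) x 1.
  by move=> x y _ _; have [] := dc x y.
have pE x y : partial1of2 (fun w y : R => cos (w * y + theta)) x y = - (y * sin (x * y + theta)).
  by rewrite partial1of2E; have [] := dc x y.
have G_ub : forall x y : R, `]u - 1, u + 1[%classic x -> setT y ->
    `|partial1of2 (fun w y : R => cos (w * y + theta)) x y| <= `|y|.
  move=> x y _ _; rewrite pE normrN normrM ler_piMr//.
  by rewrite ler_norml sin_geN1 sin_le1.
have d1 := derivable_under_integral measurableT Iu intf derf1 (fun y => normr_ge0 y)
  normal_norm_integrable G_ub.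
have d2 := differentiation_under_integral measurableT Iu intf derf1 (fun y => normr_ge0 y)
  normal_norm_integrable G_ub.
apply: DeriveDef; first exact: d1.
rewrite -derive1E d2.
under eq_Rintegral => y _ do rewrite pE -mulN1r.
by rewrite RintegralZl// stein mulN1r mulNr.
Qed.

(** Differentiating under the integral and applying Stein's identity gives F' = - s^2 u F, so F
    times exp(s^2 u^2 / 2) is constant in u. The free phase [theta] makes cosines alone carry the
    whole characteristic function. *)
Lemma normal_cos (u theta : R) :
  \int[N]_x cos (u * x + theta) = expR (- (u ^+ 2 * s ^+ 2 / 2)) * cos theta.
Proof.
pose H v := expR (s ^+ 2 / 2 * (v * v)) * F theta v.
have H0 v w : H v = H w.
  apply: is_derive_0_is_cst => x.
  have h1 : is_derive x (1 : R) (fun v => expR (s ^+ 2 / 2 * (v * v)))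
     (expR (s ^+ 2 / 2 * (x * x)) * (s ^+ 2 * x)).
    by apply: is_derive_eq; rewrite /GRing.scale/=; field.
  have := is_deriveM h1 (is_derive_F theta x).
  by move/is_derive_eq; apply; rewrite /GRing.scale/=; ring.
have := H0 u 0; rewrite /H mulr0 mulr0 expR0 mul1r.
have -> : F theta 0 = cos theta.
  rewrite /F; under eq_Rintegral do rewrite mul0r add0r.
  exact: expectation_cst.
rewrite /F => <-; rewrite mulrA -expRD.
rewrite (_ : - _ + _ = 0) ?expR0 ?mul1r//.
by field.
Qed.

End NormalTransforms.

Section Gaussian.
Context {R : realType}.

Let measurable_idTR : measurable_fun setT (idfun : measurableTypeR R -> R).
Proof. exact: measurable_id. Qed.

(** [normal_prob] lives on [measurableTypeR R]; the pushforward along the identity is the same law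
    on the measurable structure that [R] carries in the rest of the development. *)
Definition gauss (s : R) : probability R R :=
  law [the probability _ _ of @normal_prob R 0 s] measurable_idTR.

Lemma gauss_cos (s u theta : R) : s != 0 ->
  \int[gauss s]_x cos (u * x + theta) = expR (- (u ^+ 2 * s ^+ 2 / 2)) * cos theta.
Proof.
move=> s0; have [mc _] := @bdmeas_cos R u theta.
by rewrite expectation_law ?normal_cos//; exact/bdmeas_integrable/bdmeas_cos.
Qed.

Let mexp (a : R) : measurable_fun setT (fun x : R => expR (a * x)).
Proof. by apply: measurableT_comp => //; exact: measurable_funM. Qed.

Lemma gauss_mgf_integrable (s a : R) : s != 0 ->
  (gauss s).-integrable setT (EFin \o (fun x => expR (a * x))).
Proof. by move=> s0; apply/integrable_lawP => //; exact: normal_mgf_integrable. Qed.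

Lemma gauss_mgf (s a : R) : s != 0 ->
  \int[gauss s]_x expR (a * x) = expR (a ^+ 2 * s ^+ 2 / 2).
Proof.
by move=> s0; rewrite expectation_law ?normal_mgf//; exact: normal_mgf_integrable.
Qed.

(** The Gaussian kernel is its own Fourier transform: it is an average of cosines over a Gaussian
    frequency of deviation 1/s. This is the link from cosine transforms to smoothing kernels. *)
Lemma normal_fun_cos (s x y : R) : s != 0 ->
  normal_fun x s y = \int[gauss s^-1]_g cos (y * g + - (x * g)).
Proof.
move=> s0.
under eq_Rintegral do rewrite -mulrBl -[X in cos X]addr0.
rewrite gauss_cos ?invr_neq0// cos0 mulr1 /normal_fun; congr expR.
by field.
Qed.

End Gaussian.

Lemma integrable_realB {R : realType} d (T : measurableType d)
    (mu : {measure set T -> \bar R}) (f g : T -> R) :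
  mu.-integrable setT (EFin \o f) -> mu.-integrable setT (EFin \o g) ->
  mu.-integrable setT (EFin \o (fun x => f x - g x)).
Proof.
move=> fi gi; have := integrable_realD fi (integrable_realZ (-1) gi).
by congr (integrable _ _ (_ \o _)); apply/funext => x; rewrite mulN1r.
Qed.

Lemma bdmeas_swap {R : realType} d1 d2 (T1 : measurableType d1)
    (T2 : measurableType d2) (f : T1 * T2 -> R) :
  bdmeas f -> bdmeas (fun p => f (p.2, p.1)).
Proof.
move=> bf; apply: (bdmeas_comp bf).
by apply: measurable_fun_pair; [exact: measurable_snd|exact: measurable_fst].
Qed.

Lemma bdmeas_normal_fun {R : realType} (m s : R) : bdmeas (normal_fun m s).
Proof.
split; first exact: measurable_normal_fun.
exists 1 => x; rewrite ger0_norm ?normal_fun_ge0// /normal_fun -expR0 ler_expR.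
by rewrite mulNr oppr_le0 divr_ge0 ?sqr_ge0// mulrn_wge0// sqr_ge0.
Qed.

(** * Continuity theorem: from cosine transforms to bounded Lipschitz test functions *)

Section WeakConvergence.
Context {R : realType}.
Variables (mu_ : nat -> probability R R) (mu : probability R R).
Hypothesis cos_cvg : forall u theta,
  \int[mu_ n]_x cos (u * x + theta) @[n --> \oo] --> \int[mu]_x cos (u * x + theta).

Let bd2 (y : R) : bdmeas (fun p : R * R => cos (p.1 * p.2 + - (y * p.2))).
Proof.
split; last by exists 1 => x; rewrite ler_norml cos_geN1 cos_le1.
have mc : measurable_fun setT (@cos R) by apply: continuous_measurable_fun; exact: continuous_cos.
apply: (measurableT_comp mc); apply: measurable_funD => //.
  by apply: measurable_funM; [exact: measurable_fst|exact: measurable_snd].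
by apply: measurableT_comp => //; apply: measurable_funM => //; exact: measurable_snd.
Qed.

(** By Fubini the kernel expectation is a Gaussian average, over the frequency, of cosine
    transforms. These converge frequency by frequency and are bounded by one, so the averages
    converge. *)
Let normal_fun_cvg (s y : R) : s != 0 ->
  \int[mu_ n]_x normal_fun y s x @[n --> \oo] --> \int[mu]_x normal_fun y s x.
Proof.
move=> s0.
have E (m : probability R R) : \int[m]_x normal_fun y s x =
    \int[gauss s^-1]_g \int[m]_x cos (x * g + - (y * g)).
  rewrite -(expectation_Fubini m (gauss s^-1) (bd2 y))/=.
  by apply: eq_Rintegral => x _; exact: normal_fun_cos.
rewrite E; under eq_fun do rewrite E.
have bd2' : bdmeas (fun p : R * R => cos (p.2 * p.1 + - (y * p.1))).
  exact: (bdmeas_swap (bd2 y)).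
apply: (@expectation_cvg _ _ _ _ _ _ 1).
- by move=> n; have [] := bdmeas_expectation (gauss s^-1) (mu_ n) bd2'.
- by have [] := bdmeas_expectation (gauss s^-1) mu bd2'.
- apply: aeW => g.
  under eq_fun => n do under eq_Rintegral => x _ do rewrite mulrC.
  under eq_Rintegral => x _ do rewrite mulrC.
  exact: cos_cvg.
- move=> n g; apply: expectation_norm_le.
    under eq_fun do rewrite mulrC.
    by have [] := bdmeas_cos g (- (y * g)).
  by move=> x; rewrite ler_norml cos_geN1 cos_le1.
Qed.

Let normal_funC (s x y : R) : normal_fun x s y = normal_fun y s x.
Proof. by rewrite /normal_fun -[y - x]opprB sqrrN. Qed.

Let measurable_idTR : measurable_fun setT (idfun : measurableTypeR R -> R).
Proof. exact: measurable_id. Qed.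

Section CompactSupport.
Variables (f : R -> R) (A M L : R).
Hypothesis A0 : - A < A.
Hypothesis mf : measurable_fun setT f.
Hypothesis f0 : forall x, 0 <= f x <= M.
Hypothesis fL : forall x y, `|f x - f y| <= L * `|x - y|.
Hypothesis fA : forall x, ~ `[- A, A]%classic x -> f x = 0.

Let U : probability R R := law [the probability _ _ of uniform_prob A0] measurable_idTR.

Let bdnf (s : R) : bdmeas (fun p : R * R => f p.2 * normal_fun p.2 s p.1).
Proof.
apply: bdmeasM.
  split; first by apply: measurableT_comp => //; exact: measurable_snd.
  by exists M => x; have /andP[h1 h2] := f0 x.2; rewrite ger0_norm.
split; last first.
  exists 1 => p; rewrite ger0_norm ?normal_fun_ge0// /normal_fun -expR0 ler_expR.
  by rewrite mulNr oppr_le0 divr_ge0 ?sqr_ge0// mulrn_wge0// sqr_ge0.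
apply: measurableT_comp => //; apply: measurable_funM => //.
apply: measurableT_comp => //; apply: measurable_funX.
by apply: measurable_funB; [exact: measurable_fst|exact: measurable_snd].
Qed.

(** Up to the factor [(A - - A) * normal_peak s] this is the convolution of [f] with the centered
    normal density of deviation [s]. Averaging under the uniform law [U] instead of Lebesgue measure
    keeps Fubini among probability measures. *)
Let S (s x : R) := \int[U]_y (f y * normal_fun y s x).

Let S_cvg (s : R) : s != 0 -> \int[mu_ n]_x S s x @[n --> \oo] --> \int[mu]_x S s x.
Proof.
move=> s0.
have E (m : probability R R) : \int[m]_x S s x =
    \int[U]_y (f y * \int[m]_x normal_fun y s x).
  rewrite (expectation_Fubini m U (bdnf s))/=.
  apply: eq_Rintegral => y _; rewrite RintegralZl//.
  exact/bdmeas_integrable/bdmeas_normal_fun.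
rewrite E; under eq_fun do rewrite E.
have b2 (m : probability R R) : bdmeas (fun y => f y * \int[m]_x normal_fun y s x).
  have := bdmeas_expectation U m (bdmeas_swap (bdnf s)) => /=.
  congr bdmeas; apply/funext => y; rewrite RintegralZl//.
  exact/bdmeas_integrable/bdmeas_normal_fun.
apply: (@expectation_cvg _ _ _ _ _ _ M).
- by move=> n; have [] := b2 (mu_ n).
- by have [] := b2 mu.
- apply: aeW => y; apply: cvgM; [exact: cvg_cst|exact: normal_fun_cvg].
- move=> n y; have /andP[h1 h2] := f0 y.
  rewrite normrM ger0_norm// -[leRHS]mulr1 ler_pM//.
  apply: expectation_norm_le; first exact: measurable_normal_fun.
  move=> x; rewrite ger0_norm ?normal_fun_ge0// /normal_fun -expR0 ler_expR.
  by rewrite mulNr oppr_le0 divr_ge0 ?sqr_ge0// mulrn_wge0// sqr_ge0.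
Qed.

Let mu1 := @lebesgue_measure R.

Let fpdf_integrable (s x : R) : s != 0 ->
  mu1.-integrable setT (EFin \o (fun y => f y * normal_pdf x s y)).
Proof.
move=> s0; apply: (@integrable_dominated R _ _ mu1 _ (fun y => M * normal_pdf x s y)).
- by apply: measurable_funM => //; exact: measurable_normal_pdf.
- move=> y; have /andP[h1 h2] := f0 y.
  by rewrite normrM !ger0_norm ?normal_pdf_ge0// ler_wpM2r ?normal_pdf_ge0.
- by apply: integrable_realZ; exact: integrable_normal_pdf.
Qed.

Let SE (s x : R) : s != 0 -> (A - - A) * normal_peak s * S s x =
  \int[mu1]_y (f y * normal_pdf x s y).
Proof.
move=> s0; have [msf _] := bdmeas_comp (bdnf s) (pair1_measurable x).
have msf0 y : (0 <= (f y * normal_fun y s x)%:E)%E.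
  by rewrite lee_fin mulr_ge0 ?normal_fun_ge0//; have /andP[] := f0 y.
have AA : A - - A != 0 by rewrite subr_eq0 gt_eqF.
have pk0 : normal_peak s != 0 by rewrite gt_eqF ?normal_peak_gt0.
have pk y : f y * normal_fun y s x = (normal_peak s)^-1 * (f y * normal_pdf x s y).
  by rewrite normal_pdfE// normal_funC; field.
have mEf : measurable_fun setT (fun y => (f y * normal_fun y s x)%:E).
  exact/measurable_EFinP.
rewrite /S [X in _ * X]/Rintegral ge0_integral_law//=.
rewrite (@integral_uniform _ _ _ A0 (fun y => (f y * normal_fun y s x)%:E))//.
have -> : (\int[mu1]_(y in `[(- A)%R, A]) (f y * normal_fun y s x)%:E =
    \int[mu1]_y (f y * normal_fun y s x)%:E)%E.
  rewrite integral_mkcond; apply: eq_integral => y _.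
  rewrite patchE; case: ifPn => // /negP; rewrite inE => yA.
  by rewrite fA// mul0r.
under eq_integral do rewrite pk EFinM.
rewrite integralZl//; last exact: fpdf_integrable.
rewrite -[(\int[mu1]_x0 _)%E]fineK; last first.
  exact: (integrable_fin_num measurableT (fpdf_integrable x s0)).
rewrite -!EFinM/= mulrACA mulfV// mul1r mulrA mulfV// mul1r//.
Qed.

Let SfB (s x : R) : 0 < s ->
  `|(A - - A) * normal_peak s * S s x - f x| <= 2 * L * s.
Proof.
move=> s0; have s0' : s != 0 by rewrite gt_eqF.
have pdfi := @integrable_normal_pdf R x s.
have fE : f x = \int[mu1]_y (f x * normal_pdf x s y).
  by rewrite RintegralZl//= {1}/Rintegral integral_normal_pdf mulr1.
rewrite SE// [X in _ - X]fE -RintegralB//; last 2 first.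
- exact: fpdf_integrable.
- by apply: integrable_realZ; exact: integrable_normal_pdf.
have L0 : 0 <= L by have := fL 0 1; rewrite sub0r normrN normr1 mulr1; exact: le_trans.
have s20 : 2 * s != 0 by rewrite mulf_neq0.
(* The first absolute moment is bounded by [2 * s] without computing it: the density multiplied by
   the distance lies below [2 * s] times the density of deviation [2 * s], whose integral is one. *)
have key y : `|y - x| * normal_pdf x s y <= 2 * s * normal_pdf x (2 * s) y.
  rewrite !normal_pdfE//.
  have -> : normal_peak s = 2 * normal_peak (2 * s).
    rewrite /normal_peak.
    have -> : (2 * s) ^+ 2 * pi *+ 2 = 2 ^+ 2 * (s ^+ 2 * pi *+ 2) :> R by ring.
    by rewrite (@sqrtrM R) ?sqr_ge0// sqrtr_sqr ger0_norm// invfM mulrA mulfV// mul1r.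
  have -> : `|y - x| * (2 * normal_peak (2 * s) * normal_fun x s y) =
    2 * normal_peak (2 * s) * (`|y - x| * normal_fun x s y) by ring.
  have -> : 2 * s * (normal_peak (2 * s) * normal_fun x (2 * s) y) =
    2 * normal_peak (2 * s) * (s * normal_fun x (2 * s) y) by ring.
  rewrite ler_wpM2l ?mulr_ge0 ?normal_peak_ge0// /normal_fun.
  set z := y - x.
  have -> : - z ^+ 2 / (s ^+ 2 *+ 2) = - z ^+ 2 / ((2 * s) ^+ 2 *+ 2) +
     - (3 * z ^+ 2 / (8 * s ^+ 2)) by field.
  rewrite expRD mulrCA [leRHS]mulrC ler_wpM2l ?expR_ge0// expRN ler_pdivrMr ?expR_gt0//.
  rewrite (@le_trans _ _ (s * (1 + 3 * z ^+ 2 / (8 * s ^+ 2))))//; last first.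
    by rewrite ler_wpM2l ?expR_ge1Dx// ltW.
  have -> : s * (1 + 3 * z ^+ 2 / (8 * s ^+ 2)) = (8 * s ^+ 2 + 3 * z ^+ 2) / (8 * s) by field.
  rewrite ler_pdivlMr ?mulr_gt0// -(real_normK (num_real z)).
  have := sqr_ge0 (2 * s - `|z|); have := sqr_ge0 `|z|.
  by move: `|z| => w h1 h2; rewrite -subr_ge0 (_ : _ - _ = 2 * (2 * s - w) ^+ 2 + w ^+ 2); [lra|ring].
have ii : mu1.-integrable setT (EFin \o (fun y => f y * normal_pdf x s y - f x * normal_pdf x s y)).
  apply: integrable_realB; first exact: fpdf_integrable.
  by apply: integrable_realZ; exact: integrable_normal_pdf.
rewrite (le_trans (le_normr_Rintegral _ ii))//.
have -> : 2 * L * s = \int[mu1]_y (2 * L * s * normal_pdf x (2 * s) y).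
  rewrite RintegralZl//=; last exact: integrable_normal_pdf.
  by rewrite {1}/Rintegral integral_normal_pdf mulr1.
apply: le_Rintegral => //.
- exact: integrable_norm.
- apply: integrable_realZ; exact: integrable_normal_pdf.
move=> y _; rewrite -mulrBl normrM (ger0_norm (normal_pdf_ge0 _ _ _)).
rewrite (le_trans (ler_wpM2r (normal_pdf_ge0 _ _ _) (fL y x)))//.
have := ler_wpM2l L0 (key y).
by congr (_ <= _); ring.
Qed.

Lemma compact_Lipschitz_cvg :
  \int[mu_ n]_x f x @[n --> \oo] --> \int[mu]_x f x.
Proof.
have L0 : 0 <= L by have := fL 0 1; rewrite sub0r normrN normr1 mulr1; exact: le_trans.
have bf : bdmeas f by apply: (bdmeas_itv mf f0).
apply/cvgrPdist_le => e e0.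
pose s := e / (3 * (2 * L + 1)).
have s0 : 0 < s by rewrite divr_gt0// mulr_gt0// addrC ltr_pwDl// mulr_ge0.
have s0' : s != 0 by rewrite gt_eqF.
have se : 2 * L * s <= e / 3.
  have L1 : 0 < 2 * L + 1 by rewrite addrC ltr_pwDl// mulr_ge0.
  rewrite /s -(ler_pM2r (_ : 0 < 3 * (2 * L + 1))) ?mulr_gt0//.
  have -> : 2 * L * (e / (3 * (2 * L + 1))) * (3 * (2 * L + 1)) = e * (2 * L).
    by field; rewrite gt_eqF.
  have -> : e / 3 * (3 * (2 * L + 1)) = e * (2 * L + 1) by field.
  by rewrite ler_wpM2l//; [exact: ltW|rewrite lerDl].
pose c := (A - - A) * normal_peak s.
have bS : bdmeas (fun x => c * S s x) by apply: bdmeasZ; exact: bdmeas_expectation (bdnf s).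
have near_S (m : probability R R) : `|\int[m]_x (c * S s x) - \int[m]_x f x| <= e / 3.
  rewrite -expectationB//; apply: expectation_norm_le.
    by have [] := bdmeasB bS bf.
  by move=> x; rewrite (le_trans (SfB x s0)).
have /cvgrPdist_le /(_ (e / 3)) : \int[mu_ n]_x (c * S s x) @[n --> \oo] --> \int[mu]_x (c * S s x).
  have bS' : bdmeas (S s) by exact: bdmeas_expectation (bdnf s).
  rewrite expectationZ//; under eq_fun do rewrite expectationZ//.
  by apply: cvgM; [exact: cvg_cst|exact: S_cvg].
rewrite divr_gt0// => /(_ isT); apply: filterS => n h.
have := near_S mu; have := near_S (mu_ n); move: h.
set a := \int[mu]_x f x; set b := \int[mu_ n]_x f x.
set a' := \int[mu]_x (c * S s x); set b' := \int[mu_ n]_x (c * S s x).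
rewrite !ler_norml => /andP[? ?] /andP[? ?] /andP[? ?].
by apply/andP; split; lra.
Qed.

End CompactSupport.

Let cutoff (A x : R) := Num.min 1 (Num.max 0 (A + 1 - `|x|)).

Let cutoff01 A x : 0 <= cutoff A x <= 1.
Proof. by rewrite /cutoff ge_min lexx /= le_min ler01 le_max lexx. Qed.

Let cutoffL A x y : `|cutoff A x - cutoff A y| <= `|x - y|.
Proof.
rewrite /cutoff; apply: (le_trans _ (ler_dist_dist x y)).
move: `|x| `|y| => u0 v0; pose u : R := u0; pose v : R := v0; rewrite -/u -/v.
rewrite ler_norml; have : - `|u - v| <= u - v <= `|u - v| by rewrite -ler_norml.
move: `|u - v| => w; move=> /andP[h1 h2]; apply/andP.
case: (leP 0 (A + 1 - u)); case: (leP 0 (A + 1 - v)) => h3 h4;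
  rewrite ?(min_r ler01).
- by case: (leP 1 (A + 1 - u)) => ?; case: (leP 1 (A + 1 - v)) => ?; split; lra.
- by case: (leP 1 (A + 1 - u)) => ?; split; lra.
- by case: (leP 1 (A + 1 - v)) => ?; split; lra.
- by split; lra.
Qed.

Let cutoff_out A x : ~ `[- (A + 1), A + 1]%classic x -> cutoff A x = 0.
Proof.
rewrite /= in_itv/= -ler_norml => /negP; rewrite -ltNge => h.
by rewrite /cutoff max_l ?min_r// subr_le0 ltW.
Qed.

Let cutoff_in A x : `|x| <= A -> cutoff A x = 1.
Proof. by move=> h; rewrite /cutoff min_l// le_max; apply/orP; right; lra. Qed.

Let measurable_cutoff A : measurable_fun setT (cutoff A).
Proof.
apply: measurable_minr => //; apply: measurable_maxr => //.
by apply: measurable_funB => //; exact: measurableT_comp.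
Qed.

(** Tightness comes from the hypothesis itself. The compactly supported cutoffs have convergent
    expectations, so a cutoff that captures almost all the mass of [mu] also captures almost all the
    mass of [mu_ n] for large n; outside it [f] contributes at most [M] times the missing mass. *)
Theorem Lipschitz_cvg (f : R -> R) (M L : R) : measurable_fun setT f ->
  (forall x, 0 <= f x <= M) -> (forall x y, `|f x - f y| <= L * `|x - y|) ->
  \int[mu_ n]_x f x @[n --> \oo] --> \int[mu]_x f x.
Proof.
move=> mf fM fL.
have M0 : 0 <= M by have /andP[] := fM 0; exact: le_trans.
have bf : bdmeas f by apply: (bdmeas_itv mf fM).
have bc A : bdmeas (cutoff A) by apply: (bdmeas_itv (measurable_cutoff A) (cutoff01 A)).
have cc A : 0 < A -> \int[mu_ n]_x cutoff A x @[n --> \oo] --> \int[mu]_x cutoff A x.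
  move=> A0; apply: (@compact_Lipschitz_cvg _ (A + 1) 1 1) => //.
  - by rewrite gtrN// addr_gt0.
  - by move=> x y; rewrite mul1r.
  - exact: cutoff_out.
have cfc A : 0 < A -> \int[mu_ n]_x (f x * cutoff A x) @[n --> \oo] -->
    \int[mu]_x (f x * cutoff A x).
  move=> A0; apply: (@compact_Lipschitz_cvg _ (A + 1) M (L + M)) => //.
  - by rewrite gtrN// addr_gt0.
  - exact: measurable_funM.
  - move=> x; have /andP[h1 h2] := fM x; have /andP[h3 h4] := cutoff01 A x.
    by rewrite mulr_ge0//= -[leRHS]mulr1 ler_pM.
  - move=> x y; have -> : f x * cutoff A x - f y * cutoff A y =
      (f x - f y) * cutoff A x + f y * (cutoff A x - cutoff A y) by ring.
    apply: (le_trans (ler_normD _ _)); rewrite [leRHS]mulrDl !normrM; apply: lerD.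
      have /andP[h3 h4] := cutoff01 A x.
      by rewrite -[leRHS]mulr1 ler_pM// ger0_norm.
    have /andP[h1 h2] := fM y; rewrite ler_pM// ger0_norm//.
  - by move=> x /cutoff_out ->; rewrite mulr0.
have tail (m : probability R R) A : `|\int[m]_x f x - \int[m]_x (f x * cutoff A x)| <=
    M * (1 - \int[m]_x cutoff A x).
  rewrite -[in X in _ <= _ * (X - _)](expectation_cst m 1) -!expectationB//; last 2 first.
    exact: bdmeas_cst.
    exact: bdmeasM.
  rewrite -expectationZ//; last by apply: bdmeasB => //; exact: bdmeas_cst.
  have h x : 0 <= f x - f x * cutoff A x <= M * (1 - cutoff A x).
    have /andP[h1 h2] := fM x; have /andP[h3 h4] := cutoff01 A x.
    by apply/andP; split; nra.
  rewrite ger0_norm; last first.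
    by apply: Rintegral_ge0 => x _; have /andP[] := h x.
  apply: expectation_le; last by move=> x; have /andP[] := h x.
    by apply: bdmeasB => //; exact: bdmeasM.
  by apply/bdmeasZ/bdmeasB => //; exact: bdmeas_cst.
have cA : \int[mu]_x cutoff k%:R x @[k --> \oo] --> (1 : R).
  rewrite -[X in _ --> X](expectation_cst mu 1).
  apply: (@expectation_cvg _ _ _ _ _ _ 1) => //.
  - apply: aeW => x; apply: cvg_near_cst; near=> k.
    by apply: cutoff_in; near: k; exact: nbhs_infty_ger.
  - by move=> k x; have /andP[h3 h4] := cutoff01 k%:R x; rewrite ger0_norm.
apply/cvgrPdist_le => e e0.
pose e' := e / (4 * (M + 1)).
have e'0 : 0 < e' by rewrite divr_gt0// mulr_gt0// ltr_wpDl.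
have Me' : M * e' <= e / 4.
  rewrite /e' -(ler_pM2r (_ : 0 < 4 * (M + 1))) ?mulr_gt0// ?ltr_wpDl//.
  have -> : M * (e / (4 * (M + 1))) * (4 * (M + 1)) = e * M.
    by field; rewrite gt_eqF// ltr_wpDl.
  have -> : e / 4 * (4 * (M + 1)) = e * (M + 1) by field.
  by rewrite ler_wpM2l//; [exact: ltW|rewrite lerDl].
have [k k0 hk] : exists2 k : R, 0 < k & 1 - \int[mu]_x cutoff k x <= e' / 2.
  have /cvgrPdist_le /(_ (e' / 2)) := cA; rewrite divr_gt0// => /(_ isT) [N _ hN].
  exists N.+1%:R => //; have := hN N.+1 (leqnSn _) => /=.
  by apply: le_trans; exact: ler_norm.
have /cvgrPdist_le /(_ (e / 4)) := cfc k k0; rewrite divr_gt0// => /(_ isT).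
have /cvgrPdist_le /(_ (e' / 2)) := cc k k0; rewrite divr_gt0// => /(_ isT).
apply: filterS2 => n h1 h2.
have t1 := tail mu k; have t2 := tail (mu_ n) k.
have hn : 1 - \int[mu_ n]_x cutoff k x <= e'.
  move: h1 hk; rewrite ler_norml => /andP[_]; lra.
have t1' := le_trans t1 (ler_wpM2l M0 (le_trans hk (_ : _ <= e'))).
have t2' := le_trans t2 (ler_wpM2l M0 hn).
have {}t1' : `|\int[mu]_x f x - \int[mu]_x (f x * cutoff k x)| <= M * e'.
  by apply: t1'; lra.
move: t1' t2' h2 Me'; rewrite !ler_norml => /andP[? ?] /andP[? ?] /andP[? ?] ?.
by apply/andP; split; lra.
Unshelve. all: by end_near. Qed.
End WeakConvergence.

(** * Approximation of a finite-variation Lévy marginal by Gaussian plus compound-Poisson-like laws *)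

Section ElementaryBounds.
Context {R : realType}.
Implicit Types x y : R.

Lemma norm_sin_le x : `|sin x| <= `|x|.
Proof.
wlog x0 : x / 0 <= x.
  move=> h; case: (leP 0 x) => [/h//|/ltW x0].
  by have := h (- x); rewrite sinN !normrN; apply; rewrite oppr_ge0.
have := @MVT_segment R sin cos 0 x x0 (fun y _ => is_derive_sin y).
case; first by apply: continuous_subspaceT => y; exact: continuous_sin.
move=> c _; rewrite sin0 !subr0 => ->.
by rewrite normrM ler_piMl// ler_norml cos_geN1 cos_le1.
Qed.

Lemma norm_cosB1_le x : `|cos x - 1| <= `|x|.
Proof.
wlog x0 : x / 0 <= x.
  move=> h; case: (leP 0 x) => [/h//|/ltW x0].
  by have := h (- x); rewrite cosN !normrN; apply; rewrite oppr_ge0.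
have := @MVT_segment R cos (fun y => - sin y) 0 x x0 (fun y _ => is_derive_cos y).
case; first by apply: continuous_subspaceT => y; exact: continuous_cos.
move=> c _; rewrite cos0 !subr0 => ->.
by rewrite normrM ler_piMl// normrN ler_norml sin_geN1 sin_le1.
Qed.

Lemma norm_cosB1_le2 x : `|cos x - 1| <= x ^+ 2.
Proof.
wlog x0 : x / 0 <= x.
  move=> h; case: (leP 0 x) => [/h//|/ltW x0].
  by have := h (- x); rewrite cosN sqrrN; apply; rewrite oppr_ge0.
have := @MVT_segment R cos (fun y => - sin y) 0 x x0 (fun y _ => is_derive_cos y).
case; first by apply: continuous_subspaceT => y; exact: continuous_cos.
move=> c; rewrite in_itv/= => /andP[c0 cx]; rewrite cos0 !subr0 => ->.
rewrite normrM normrN (ger0_norm x0) expr2 ler_wpM2r// (le_trans (norm_sin_le _))//.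
by rewrite ger0_norm.
Qed.

Lemma norm_sinB_le2 x : `|sin x - x| <= x ^+ 2.
Proof.
wlog x0 : x / 0 <= x.
  move=> h; case: (leP 0 x) => [/h//|/ltW x0].
  have := h (- x); rewrite sinN sqrrN opprK -normrN opprD !opprK.
  by apply; rewrite oppr_ge0.
have h (y : R) : is_derive y 1 (fun z => sin z - z) (cos y - 1) by exact: is_derive_eq.
have := @MVT_segment R (fun z => sin z - z) (fun y => cos y - 1) 0 x x0 (fun y _ => h y).
case.
  apply: continuous_subspaceT => y; apply: cvgB; [exact: continuous_sin|exact: cvg_id].
move=> c; rewrite in_itv/= => /andP[c0 cx]; rewrite sin0 !subr0 => ->.
rewrite normrM (ger0_norm x0) expr2 ler_wpM2r// (le_trans (norm_cosB1_le _))//.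
by rewrite ger0_norm.
Qed.

Lemma expR_le_quad x : x <= 0 -> 0 <= expR x - 1 - x <= x ^+ 2.
Proof.
move=> x0; have h := expR_ge1Dx x; have h2 := expR_ge1Dx (- x).
have h3 : expR x * expR (- x) = 1 by rewrite -expRD subrr expR0.
have h4 := expR_gt0 x.
apply/andP; split; first lra.
have h5 : expR x * (1 - x) <= 1 by rewrite -[leRHS]h3 ler_wpM2l// ltW.
nra.
Qed.

Lemma norm_expRB1_le x : x <= 0 -> `|expR x - 1| <= `|x|.
Proof.
move=> x0; have h := expR_ge1Dx x; have h1 : expR x <= 1 by rewrite -expR0 ler_expR.
by rewrite !ler0_norm//; lra.
Qed.

Lemma norm_expRB1_le4 x : `|x| <= 1 -> `|expR x - 1| <= 4 * `|x|.
Proof.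
move=> x1; case: (leP x 0) => x0.
  by rewrite (le_trans (norm_expRB1_le x0))// ler_peMl// ler1n.
move: x1; rewrite (gtr0_norm x0) => x1.
have h1 : 1 <= expR x by rewrite -expR0 ler_expR ltW.
rewrite ger0_norm ?subr_ge0//.
(* Half of the exponent is used because [1 - x] may vanish at the end of the range, whereas
   [1 - x / 2] stays at least 1/2; squaring recovers the full exponential. *)
have h2 := expR_ge1Dx (- (x / 2)).
have h3 : expR x * expR (- (x / 2)) ^+ 2 = 1.
  by rewrite expr2 -!expRD (_ : _ + _ = 0) ?expR0//; field.
have h4 : 1 / 2 <= 1 - x / 2 by lra.
have h5 : (1 - x / 2) ^+ 2 <= expR (- (x / 2)) ^+ 2 by rewrite lerXn2r ?nnegrE//; lra.
have h6 : expR x * (1 - x / 2) ^+ 2 <= 1 by rewrite -[leRHS]h3 ler_wpM2l// expR_ge0.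
have h7 : (1 / 2) ^+ 2 <= (1 - x / 2) ^+ 2 by rewrite lerXn2r ?nnegrE//; lra.
nra.
Qed.

Lemma norm_expRB_le2 x : `|x| <= 1 -> `|expR x - 1 - x| <= 4 * x ^+ 2.
Proof.
move=> x1; case: (leP x 0) => x0.
  have /andP[h1 h2] := expR_le_quad x0; rewrite ger0_norm//.
  by rewrite (le_trans h2)// ler_peMl ?sqr_ge0// ler1n.
have h : 0 <= expR x - 1 - x by have := expR_ge1Dx x; lra.
move: x1; rewrite (gtr0_norm x0) ger0_norm// => x1.
have h2 := expR_ge1Dx (- (x / 2)).
have h3 : expR x * expR (- (x / 2)) ^+ 2 = 1.
  by rewrite expr2 -!expRD (_ : _ + _ = 0) ?expR0//; field.
have h5 : (1 - x / 2) ^+ 2 <= expR (- (x / 2)) ^+ 2 by rewrite lerXn2r ?nnegrE//; lra.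
have h6 : expR x * (1 - x / 2) ^+ 2 <= 1 by rewrite -[leRHS]h3 ler_wpM2l// expR_ge0.
have h7 : 0 < (1 - x / 2) ^+ 2 by rewrite exprn_gt0//; lra.
suff h8 : 1 <= (1 + x + 4 * x ^+ 2) * (1 - x / 2) ^+ 2.
  have : expR x * (1 - x / 2) ^+ 2 <= (1 + x + 4 * x ^+ 2) * (1 - x / 2) ^+ 2.
    exact: le_trans h6 h8.
  by rewrite ler_pM2r//; lra.
rewrite -subr_ge0 (_ : _ - _ = x ^+ 2 * (13 / 4 - 15 / 4 * x + x ^+ 2)); last by field.
by rewrite mulr_ge0 ?sqr_ge0//; have := sqr_ge0 x; nra.
Qed.

End ElementaryBounds.

Lemma integrable_mul_indic {R : realType} d (T : measurableType d)
    (mu : {measure set T -> \bar R}) (D : set T) (f : T -> R) :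
  measurable D -> measurable_fun setT f -> (forall x, 0 <= f x) ->
  (\int[mu]_(x in D) (f x)%:E < +oo)%E ->
  mu.-integrable setT (EFin \o (fun x => f x * \1_D x)).
Proof.
move=> mD mf f0 fi; apply/integrableP; split.
  by apply/measurable_EFinP/measurable_funM => //; exact: measurable_indic.
rewrite integral_mkcond in fi; move: fi; congr (_ < _)%E; apply: eq_integral => x _.
rewrite patchE/= indicE; case: ifP => _; rewrite ?mulr1 ?mulr0 ?normr0//.
by rewrite ger0_norm.
Qed.

Section LevyIntegrals.
Context {R : realType}.
Variable nu : {measure set R -> \bar R}.
Hypothesis nu2 : (\int[nu]_x (Num.min 1 (x ^+ 2))%:E < +oo)%E.
Hypothesis nu_exp : (\int[nu]_(x in [set x : R | 1 <= `|x|]%R) (expR x)%:E < +oo)%E.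
Hypothesis nu_fv : (\int[nu]_(x in [set x : R | `|x| <= 1]%R) (`|x|%R)%:E < +oo)%E.

Let mle1 : measurable [set x : R | `|x| <= 1].
Proof.
rewrite (_ : [set x | _] = `[-1, 1]%classic) //.
by apply/seteqP; split=> x /=; rewrite in_itv/= ler_norml.
Qed.

Let mge1 : measurable [set x : R | 1 <= `|x|].
Proof.
rewrite (_ : [set x | _] = ~` `]-1, 1[%classic); first exact: measurableC.
by apply/seteqP; split=> x /=; rewrite in_itv/= -ltr_norml ltNge; [move=> ->|move/negP; rewrite negbK].
Qed.

(** One integrable majorant for every integrand against [nu]: the first term uses finite variation
    near 0, the second is the defining bound of a Lévy measure, and the third uses the exponential
    moment of large jumps. *)
Definition levy_dom (x : R) : R :=
  `|x| * \1_[set x : R | `|x| <= 1] x + (Num.min 1 (x ^+ 2) + expR x * \1_[set x : R | 1 <= `|x|] x).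

Lemma levy_dom_ge0 x : 0 <= levy_dom x.
Proof.
rewrite /levy_dom !indicE addr_ge0 ?addr_ge0 ?mulr_ge0 ?expR_ge0//.
by rewrite le_min ler01 sqr_ge0.
Qed.

Lemma integrable_levy_dom : nu.-integrable setT (EFin \o levy_dom).
Proof.
apply: integrable_realD.
  by apply: integrable_mul_indic => //; exact: measurableT_comp.
apply: integrable_realD.
  apply/integrableP; split.
    apply/measurable_EFinP; apply: measurable_minr => //.
  move: nu2; congr (_ < _)%E; apply: eq_integral => x _.
  by rewrite /= ger0_norm// le_min ler01 sqr_ge0.
by apply: integrable_mul_indic => // x; exact: expR_ge0.
Qed.

Lemma levy_dom_ge_min x : Num.min 1 `|x| <= levy_dom x.
Proof.
have h := expR_ge0 x.
have h2 : 0 <= Num.min 1 (x ^+ 2) by rewrite le_min ler01 sqr_ge0.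
rewrite /levy_dom !indicE; case: (leP `|x| 1) => x1.
  rewrite mem_set// mulr1 -[leLHS]addr0 lerD// addr_ge0// mulr_ge0//.
have : 1 <= x ^+ 2 by rewrite -(real_normK (num_real x)) exprn_ege1// ltW.
move=> x2; rewrite (min_l x2) [X in _ <= X]addrC -addrA lerDl.
by rewrite addr_ge0// mulr_ge0.
Qed.

Lemma levy_dom_expRB1 x : `|expR x - 1| <= 4 * levy_dom x.
Proof.
have h := expR_ge0 x.
have h2 : 0 <= Num.min 1 (x ^+ 2) by rewrite le_min ler01 sqr_ge0.
rewrite /levy_dom !indicE; case: (leP `|x| 1) => x1.
  rewrite (le_trans (norm_expRB1_le4 x1))// ler_wpM2l// mem_set// mulr1 lerDl.
  by rewrite addr_ge0// mulr_ge0.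
have : 1 <= x ^+ 2 by rewrite -(real_normK (num_real x)) exprn_ege1// ltW.
move=> x2; rewrite (min_l x2) [X in _ * (_ + (_ + _ * X))](_ : _ = 1); last first.
  by rewrite mem_set//= ltW.
have := mulr_ge0 (normr_ge0 x) (ler0n R (x \in [set x : R | `|x| <= 1])).
by rewrite ler_norml => h3; apply/andP; split; lra.
Qed.

Lemma levy_dom_sin u x : `|sin (u * x)| <= (`|u| + 1) * levy_dom x.
Proof.
have h : `|sin (u * x)| <= (`|u| + 1) * Num.min 1 `|x|.
  case: (leP 1 `|x|) => x1.
    by rewrite mulr1 (le_trans (sin_max _))// lerDr.
  rewrite (le_trans (norm_sin_le _))// normrM ler_wpM2r// lerDl//.
by rewrite (le_trans h)// ler_wpM2l ?addr_ge0// levy_dom_ge_min.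
Qed.

Lemma levy_dom_cos u x : `|cos (u * x) - 1| <= (`|u| + 2) * levy_dom x.
Proof.
have h : `|cos (u * x) - 1| <= (`|u| + 2) * Num.min 1 `|x|.
  case: (leP 1 `|x|) => x1.
    have := cos_geN1 (u * x); have := cos_le1 (u * x); have := normr_ge0 u.
    by rewrite mulr1 ler_norml => *; apply/andP; split; lra.
  rewrite (le_trans (norm_cosB1_le _))// normrM ler_wpM2r// lerDl//.
by rewrite (le_trans h)// ler_wpM2l ?addr_ge0// levy_dom_ge_min.
Qed.

End LevyIntegrals.

Section UnitMeasure.
Context {R : realType} d (T : measurableType d).
Variable m : {measure set T -> \bar R}.

(** The proof of unit mass is an argument of this alias, so that an instance of probability measure
    can be attached to a measure whose mass is known only by a computation. *)
Definition unit_measure of m setT = 1%E : set T -> \bar R := m.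

HB.instance Definition _ (m1 : m setT = 1%E) := Measure.on (unit_measure m1).
HB.instance Definition _ (m1 : m setT = 1%E) :=
  Measure_isProbability.Build _ _ _ (unit_measure m1) m1.

End UnitMeasure.

(** * A single short period with at most one jump *)

Section JumpMixture.
Context {R : realType}.
Variables (nu : {measure set R -> \bar R}) (E : set R) (eps : R).
Hypothesis mE : measurable E.
Hypothesis eps0 : 0 <= eps.
Hypothesis nuE : (nu E < +oo)%E.
Hypothesis eps1 : eps * fine (nu E) <= 1.

Let ge0_integral_mrestr (f : R -> \bar R) : measurable_fun setT f ->
  (forall x, 0 <= f x)%E -> (\int[mrestr nu mE]_x f x = \int[nu]_(x in E) f x)%E.
Proof.
move=> mf f0; have mC := measurableC mE.
rewrite -(setUv E) ge0_integral_setU ?setUv//; last by apply/disj_setPCl.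
rewrite [X in (_ + X)%E]null_set_integral ?adde0//; last 2 first.
- exact: measurable_funTS.
- by change (nu (~` E `&` E) = 0%E); rewrite setICl measure0.
by apply: eq_measure_integral => A mA AE; rewrite /= /mrestr setIidl.
Qed.

Let a1 : 0 <= 1 - eps * fine (nu E). Proof. by rewrite subr_ge0. Qed.

(** With probability [eps * fine (nu E)] there is one jump, distributed as [nu] on [E]; otherwise
    the increment is 0. This is one short period of a compound Poisson process, with second and
    later jumps neglected. *)
Let m0 : {measure set R -> \bar R} :=
  measure_add (mscale (NngNum a1) (\d_(0 : R))) (mscale (NngNum eps0) (mrestr nu mE)).

Let ge0_integral_m0 (f : R -> R) : measurable_fun setT f -> (forall x, 0 <= f x) ->
  (\int[m0]_x (f x)%:E = ((1 - eps * fine (nu E)) * f 0)%:E +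
     eps%:E * \int[nu]_(x in E) (f x)%:E)%E.
Proof.
move=> mf f0; have mEf : measurable_fun setT (EFin \o f) by exact/measurable_EFinP.
have f0' x : (0 <= (EFin \o f) x)%E by rewrite lee_fin.
rewrite /m0 ge0_integral_measure_add//; last by move=> x _; exact: f0'.
rewrite (@ge0_integral_mscale _ _ _ (\d_(0 : R)) _ measurableT (NngNum a1) (EFin \o f))//.
rewrite (@ge0_integral_mscale _ _ _ (mrestr nu mE) _ measurableT (NngNum eps0) (EFin \o f))//=.
  by rewrite integral_dirac// diracT mul1e -EFinM ge0_integral_mrestr.
by move=> x _; exact: f0'.
Qed.

Let m01 : m0 setT = 1%E.
Proof.
have m1 : measurable_fun setT (cst 1 : R -> R) by [].
have := @ge0_integral_m0 (cst 1) m1 (fun=> ler01).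
have -> : (\int[m0]_x (cst 1 x)%:E = m0 setT)%E.
  by have := integral_cst m0 measurableT 1%E; rewrite mul1e.
have -> : (\int[nu]_(x in E) (cst 1 x)%:E = nu E)%E.
  by have := integral_cst nu mE 1%E; rewrite mul1e.
move=> ->; rewrite mulr1 -(fineK (_ : nu E \is a fin_num)) ?ge0_fin_numE//.
by rewrite -EFinM -EFinD subrK.
Qed.

Let rho : probability R R := [the probability _ _ of unit_measure m01].

(** The expectation formula is all that is used of the mixture. It is proved for nonnegative
    functions and extended through positive and negative parts; the sigma type allows the law to be
    named afterwards by [sval]. *)
Lemma jump_mixture_exists : {rho : probability R R | forall f : R -> R,
  measurable_fun setT f -> nu.-integrable E (EFin \o f) ->
  rho.-integrable setT (EFin \o f) /\
  \int[rho]_x f x = f 0 + eps * \int[nu]_(x in E) (f x - f 0)}.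
Proof.
exists rho => f mf fi.
have ge0f (g : R -> R) : measurable_fun setT g -> (forall x, 0 <= g x) ->
    nu.-integrable E (EFin \o g) -> rho.-integrable setT (EFin \o g) /\
    \int[rho]_x g x = (1 - eps * fine (nu E)) * g 0 + eps * \int[nu]_(x in E) g x.
  move=> mg g0 gi.
  have e : (\int[rho]_x (g x)%:E = ((1 - eps * fine (nu E)) * g 0 + eps * \int[nu]_(x in E) g x)%:E)%E.
    rewrite (_ : \int[rho]_x _ = \int[m0]_x (g x)%:E)%E//.
    rewrite ge0_integral_m0// EFinD EFinM; congr (_ + _)%E.
    by rewrite /Rintegral EFinM fineK//; exact: integrable_fin_num.
  split; last by rewrite /Rintegral e.
  apply/integrableP; split; first exact/measurable_EFinP.
  under eq_integral do rewrite /= ger0_norm//.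
  by rewrite e ltry.
pose p x := Num.max (f x) 0; pose n x := Num.max (- f x) 0.
have fpn x : f x = p x - n x.
  by rewrite /p /n; case: (leP (f x) 0) => h; [rewrite max_l ?oppr_ge0// sub0r opprK|rewrite max_r ?subr0// oppr_le0 ltW].
have mp : measurable_fun setT p by exact: measurable_maxr.
have mn : measurable_fun setT n by apply: measurable_maxr => //; exact: measurableT_comp.
have p0 x : 0 <= p x by rewrite le_max lexx orbT.
have n0 x : 0 <= n x by rewrite le_max lexx orbT.
have pn x : p x <= `|f x| /\ n x <= `|f x|.
  by rewrite /p /n !ge_max normr_ge0 ler_norm -normrN ler_norm.
have pi : nu.-integrable E (EFin \o p).
  apply: le_integrable fi => //; first exact/measurable_EFinP/measurable_funTS.
  by move=> x _; rewrite /= lee_fin ger0_norm//; have [] := pn x.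
have ni : nu.-integrable E (EFin \o n).
  apply: le_integrable fi => //; first exact/measurable_EFinP/measurable_funTS.
  by move=> x _; rewrite /= lee_fin ger0_norm//; have [] := pn x.
have [rpi rp] := ge0f p mp p0 pi.
have [rni rn] := ge0f n mn n0 ni.
have fE : f = (fun x => p x - n x) by apply/funext.
split; first by rewrite fE; exact: integrable_realB.
have -> : \int[rho]_x f x = \int[rho]_x p x - \int[rho]_x n x.
  by rewrite -RintegralB//; apply: eq_Rintegral => x _.
rewrite rp rn.
have c0 : nu.-integrable E (EFin \o cst (f 0)).
  apply/integrableP; split; first exact/measurable_EFinP.
  by rewrite /= integral_cst// lte_mul_pinfty.
rewrite RintegralB// Rintegral_cst//.
have -> : \int[nu]_(x in E) f x = \int[nu]_(x in E) p x - \int[nu]_(x in E) n x.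
  by rewrite -RintegralB//; apply: eq_Rintegral => x _.
rewrite [in RHS](fpn 0); ring.
Qed.

End JumpMixture.

(** * Sums of independent copies of a jump law *)

Section ConvolutionPowers.
Context {R : realType}.
Variable rho : probability R R.

Fixpoint conv_pow (n : nat) : probability R R :=
  if n is m.+1 then conv rho (conv_pow m)
  else [the probability _ _ of (\d_(0 : R))].

Lemma conv_pow_expe (m : R) : (\int[rho]_x (expR x)%:E = m%:E)%E ->
  forall n, (\int[conv_pow n]_x (expR x)%:E = (m ^+ n)%:E)%E.
Proof.
move=> hm; have me : measurable_fun setT (fun x : R => (expR x)%:E).
  by apply/measurable_EFinP; exact: measurable_expR.
elim=> [|n IH]; first by rewrite /= integral_dirac// diracT mul1e expR0 expr0.
rewrite (_ : conv_pow n.+1 = conv rho (conv_pow n))// ge0_integral_conv//.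
under eq_integral => x _.
  under eq_integral => y _ do rewrite expRD EFinM.
  rewrite ge0_integralZl// IH; over.
rewrite ge0_integralZr//; last first.
  by rewrite -IH; apply: integral_ge0 => y _; rewrite lee_fin expR_ge0.
by rewrite hm -EFinM exprS.
Qed.

(** The function max(e^x, 1) is submultiplicative in e^x, so its moment grows at most geometrically.
    It measures upward moves only, and its rate is the integral of (e^y - 1)_+ that appears in
    [d_plus]. *)
Lemma conv_pow_maxe (p : R) : (\int[rho]_x (Num.max (expR x) 1)%:E <= p%:E)%E ->
  forall n, (\int[conv_pow n]_x (Num.max (expR x) 1)%:E <= (p ^+ n)%:E)%E.
Proof.
move=> hp; have me : measurable_fun setT (fun x : R => (Num.max (expR x) 1)%:E).
  by apply/measurable_EFinP; apply: measurable_maxr => //; exact: measurable_expR.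
have m0 (x : R) : 0 <= Num.max (expR x) 1 by rewrite le_max ler01 orbT.
have m0e (x : R) : (0 <= (Num.max (expR x) 1)%:E)%E by rewrite lee_fin.
elim=> [|n IH].
  by rewrite /= integral_dirac// diracT mul1e expR0 expr0 maxxx.
rewrite (_ : conv_pow n.+1 = conv rho (conv_pow n))// ge0_integral_conv//.
have h x y : Num.max (expR (x + y)) 1 <= Num.max (expR x) 1 * Num.max (expR y) 1 :> R.
  rewrite ge_max; apply/andP; split; last first.
    by rewrite mulr_ege1// le_max lexx orbT.
  by rewrite expRD ler_pM ?expR_ge0// le_max lexx.
have pn0 : (0 <= (p ^+ n)%:E)%E by apply: le_trans IH; exact: integral_ge0.
apply: (@le_trans _ _ (\int[rho]_x ((Num.max (expR x) 1)%:E * (p ^+ n)%:E))%E).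
  apply: ge0_le_integral => //.
  - by move=> x _; exact: integral_ge0.
  - apply: (@measurable_fun_fubini_tonelli_F _ _ _ _ _ (conv_pow n)
      (fun q : R * R => (Num.max (expR (q.1 + q.2)) 1)%:E)) => //.
    apply: (measurableT_comp me).
    by apply: measurable_funD; [exact: measurable_fst|exact: measurable_snd].
  - by apply: emeasurable_funM.
  - move=> x _.
    apply: (@le_trans _ _ (\int[conv_pow n]_y ((Num.max (expR x) 1)%:E * (Num.max (expR y) 1)%:E))%E).
      apply: ge0_le_integral => //.
      + by apply: (measurableT_comp me); exact: measurable_funD.
      + by apply: emeasurable_funM.
      + by move=> y _; rewrite -EFinM lee_fin.
    by rewrite ge0_integralZl// lee_wpmul2l.
rewrite ge0_integralZr//.
by rewrite exprS EFinM lee_wpmul2r.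
Qed.

(** Errors add up linearly: adding one more summand costs [delta] for its own transform, and the
    error already made is only averaged. The assumption [a <= 0] keeps the factor [expR (n%:R * a)]
    at most one. *)
Lemma conv_pow_cos (u a b delta : R) : a <= 0 ->
  (forall theta, `|\int[rho]_x cos (u * x + theta) - expR a * cos (b + theta)| <= delta) ->
  forall n theta, `|\int[conv_pow n]_x cos (u * x + theta) -
     expR (n%:R * a) * cos (n%:R * b + theta)| <= n%:R * delta.
Proof.
move=> a0 h; elim=> [|n IH] theta.
  rewrite !mul0r expR0 mul1r add0r.
  rewrite {1}/Rintegral/= integral_dirac//; last first.
    by apply/measurable_EFinP; have [] := bdmeas_cos u theta.
  by rewrite diracT mul1e/= mulr0 add0r subrr normr0.
rewrite [X in `|X - _|]expectation_conv; last exact: bdmeas_cos.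
pose g x := \int[conv_pow n]_y cos (u * (x + y) + theta).
have gE x : g x = \int[conv_pow n]_y cos (u * y + (u * x + theta)).
  by apply: eq_Rintegral => y _; congr cos; ring.
have bg : bdmeas g.
  have bb : bdmeas (fun p : R * R => cos (u * (p.1 + p.2) + theta)).
    apply: (bdmeas_comp (bdmeas_cos u theta)).
    by apply: measurable_funD; [exact: measurable_fst|exact: measurable_snd].
  exact: (bdmeas_expectation rho (conv_pow n) bb).
pose k x := expR (n%:R * a) * cos (u * x + (n%:R * b + theta)).
have bk : bdmeas k by apply: bdmeasZ; exact: bdmeas_cos.
have d1 : `|\int[rho]_x g x - \int[rho]_x k x| <= n%:R * delta.
  rewrite -expectationB//; apply: expectation_norm_le; first by have [] := bdmeasB bg bk.
  move=> x; rewrite gE /k; have := IH (u * x + theta).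
  by congr (`|_ - _ * cos _| <= _); ring.
have d2 : `|\int[rho]_x k x - expR (n.+1%:R * a) * cos (n.+1%:R * b + theta)| <= delta.
  rewrite expectationZ; last exact: bdmeas_cos.
  have -> : expR (n.+1%:R * a) = expR (n%:R * a) * expR a.
    by rewrite -expRD -natr1; congr expR; ring.
  have -> : n.+1%:R * b + theta = b + (n%:R * b + theta) by rewrite -natr1; ring.
  rewrite -mulrA -mulrBr normrM (ger0_norm (expR_ge0 _)).
  rewrite (le_trans _ (h (n%:R * b + theta)))// ler_piMl//.
  by rewrite -expR0 ler_expR mulr_ge0_le0.
have -> : n.+1%:R * delta = n%:R * delta + delta by rewrite -natr1; ring.
rewrite -(subrKA (\int[rho]_x k x)) (le_trans (ler_normD _ _))//.
exact: lerD.
Qed.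

End ConvolutionPowers.

Lemma ln1D_bounds {R : realType} (y : R) : `|y| <= 1 / 2 ->
  y - 2 * y ^+ 2 <= ln (1 + y) <= y.
Proof.
rewrite ler_norml => /andP[y1 y2]; have p : 0 < 1 + y by lra.
apply/andP; split; last by rewrite -ler_expR lnK ?posrE// expR_ge1Dx.
have h : y / (1 + y) <= ln (1 + y).
  rewrite -ler_expR lnK ?posrE// -[leLHS]invrK -expRN.
  rewrite -[leRHS]invrK lef_pV2 ?posrE ?invr_gt0 ?expR_gt0//.
  have := expR_ge1Dx (- (y / (1 + y))).
  by rewrite (_ : 1 - y / (1 + y) = (1 + y)^-1)//; field; rewrite gt_eqF.
rewrite (le_trans _ h)// ler_pdivlMr//.
have := sqr_ge0 y; nra.
Qed.

(** * Approximation of the law of a Lévy increment *)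

Section LevyApproximation.
Context {R : realType}.
Variable nu : {measure set R -> \bar R}.
Hypothesis nu2 : (\int[nu]_x (Num.min 1 (x ^+ 2))%:E < +oo)%E.
Hypothesis nu_exp : (\int[nu]_(x in [set x : R | 1 <= `|x|]%R) (expR x)%:E < +oo)%E.
Hypothesis nu_fv : (\int[nu]_(x in [set x : R | `|x| <= 1]%R) (`|x|%R)%:E < +oo)%E.

Let D := @levy_dom R.
Let iD : nu.-integrable setT (EFin \o D).
Proof. exact: integrable_levy_dom. Qed.

Lemma levy_integrable (g : R -> R) C : measurable_fun setT g ->
  (forall x, `|g x| <= C * D x) -> nu.-integrable setT (EFin \o g).
Proof.
move=> mg gC; apply: (@integrable_dominated _ _ _ _ _ (fun x => C * D x)) => //.
exact: integrable_realZ.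
Qed.

Let E (n : R) := [set x : R | 1 < n * `|x|].

Let mE n : measurable (E n).
Proof.
have mf : measurable_fun setT (fun x : R => n * `|x|).
  by apply: measurable_funM => //; exact: measurableT_comp.
have := mf measurableT `]1, +oo[%classic (measurable_itv _).
by rewrite setTI (_ : _ @^-1` _ = E n)//; apply/seteqP; split=> x /=; rewrite in_itv/= andbT.
Qed.

Let Lambda := \int[nu]_x D x.

(** On [E n] the quantity n min(1, |x|) is at least one, so Markov's inequality bounds the mass by a
    multiple of n. This linear growth is what the choice of [eps] below relies on. *)
Let nuE (n : R) : 0 < n -> (1 <= n) -> (nu (E n) <= (n * Lambda)%:E)%E.
Proof.
move=> n0 n1; rewrite -[nu (E n)]mul1e -integral_cst//.
rewrite integral_mkcond /Lambda /Rintegral EFinM fineK; last exact: integrable_fin_num.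
rewrite -integralZl//.
apply: ge0_le_integral => //.
- by move=> x _; rewrite patchE; case: ifP.
- by apply/(measurable_restrictT _ (mE _)).
- by apply: measurable_funeM; exact: measurable_int iD.
- move=> x _; rewrite patchE; case: ifPn => [|_].
    rewrite inE /E/= => h; rewrite -EFinM lee_fin.
    rewrite (@le_trans _ _ (n * Num.min 1 `|x|))//; last first.
      by rewrite ler_wpM2l ?(ltW n0)// levy_dom_ge_min.
    by case: (leP 1 `|x|) => _; rewrite ?mulr1// ltW.
  by rewrite -EFinM lee_fin mulr_ge0 ?levy_dom_ge0// ltW.
Qed.

(** Each nonzero x lies eventually in [E (n_ k)], but 0 never does; hence the requirement [g 0 = 0],
    which makes the truncated integrands converge everywhere. *)
Let trunc_cvg (n_ : nat -> R) (g : R -> R) C : measurable_fun setT g ->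
  (forall x, `|g x| <= C * D x) -> g 0 = 0 -> (n_ k @[k --> \oo] --> +oo) ->
  \int[nu]_(x in E (n_ k)) g x @[k --> \oo] --> \int[nu]_x g x.
Proof.
move=> mg gC g0 noo; have gi := levy_integrable mg gC.
have [| | | | |_ _ cv] := @dominated_convergence _ _ _ nu setT measurableT
    (fun k => (EFin \o g) \_ (E (n_ k))) (EFin \o g) (fun x => `|(EFin \o g) x|%E).
- move=> k; apply/(measurable_restrictT _ (mE _)).
  by apply: measurable_funTS; exact/measurable_EFinP.
- exact/measurable_EFinP.
- apply: aeW => x _; have [->|x0] := eqVneq x 0.
    apply: cvg_near_cst; near=> k; rewrite patchE; case: ifP => // _.
    by rewrite /= g0.
  apply: cvg_near_cst; near=> k; rewrite patchE mem_set//= /E/=.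
  rewrite -ltr_pdivrMr ?normr_gt0//; near: k.
  exact: (cvgry_gt noo).
- exact: (integrable_abse gi).
- by apply: aeW => x k _; rewrite patchE; case: ifP => // _; rewrite abse0 abse_ge0.
apply: fine_cvg; rewrite fineK; last exact: integrable_fin_num.
by move: cv; under eq_fun do rewrite -integral_mkcond.
Unshelve. all: by end_near. Qed.

(** [J] is the drift created by the jumps, [M] its absolute version, and [I] the part due to upward
    jumps, which enters [d_plus]. [Cr u] and [Si u] are the real and imaginary parts of the
    uncompensated jump exponent. *)
Let J := \int[nu]_x (expR x - 1).
Let M := \int[nu]_x `|expR x - 1|.
Let I := \int[nu]_x Num.max (expR x - 1) 0.
Let Cr u := \int[nu]_x (cos (u * x) - 1).
Let Si u := \int[nu]_x sin (u * x).

Let mexpB1 : measurable_fun setT (fun x : R => expR x - 1).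
Proof. by apply: measurable_funB => //; exact: measurable_expR. Qed.

Let mcosB1 u : measurable_fun setT (fun x : R => cos (u * x) - 1).
Proof.
apply: measurable_funB => //; have [h _] := bdmeas_cos u 0.
by move: h; under eq_fun do rewrite addr0.
Qed.

Let msin u : measurable_fun setT (fun x : R => sin (u * x)).
Proof. by have [h _] := bdmeas_sin u 0; move: h; under eq_fun do rewrite addr0. Qed.

Let iexpB1 : nu.-integrable setT (EFin \o (fun x => expR x - 1)).
Proof. exact: (levy_integrable mexpB1 (fun x => levy_dom_expRB1 x)). Qed.

Let iexpB1N : nu.-integrable setT (EFin \o (fun x => `|expR x - 1|)).
Proof. exact: (integrable_norm iexpB1). Qed.

Let iexpB1P : nu.-integrable setT (EFin \o (fun x => Num.max (expR x - 1) 0)).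
Proof.
apply: (integrable_dominated _ _ iexpB1N); first exact: measurable_maxr.
by move=> x; rewrite ger0_norm ?le_max ?lexx ?orbT// ge_max normr_ge0 ler_norm.
Qed.

Section Step.
Variables (h n : R).
Hypothesis h0 : 0 < h.
Hypothesis n0 : 1 <= n.
Hypothesis nL : h * Lambda <= n.
Hypothesis nM : 2 * (h * M) <= n.

Let n0' : 0 < n. Proof. exact: lt_le_trans n0. Qed.

(** The step [h] is cut into n^2 periods, while jumps of size at most 1/n are dropped. Since
    [nu (E n)] is at most n times [Lambda], the probability of a jump per period is at most h
    [Lambda] / n^2 times n; and the quadratic errors eps^2, summed over n^2 periods, are
    O(1/n^2). *)
Let eps := h / n ^+ 2.

Let eps0 : 0 <= eps. Proof. by rewrite divr_ge0 ?sqr_ge0 ?ltW. Qed.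

Let nuE_lty : (nu (E n) < +oo)%E.
Proof. by rewrite (le_lt_trans (nuE n0' n0))// ltry. Qed.

Let epsE : eps * fine (nu (E n)) <= 1.
Proof.
have f : fine (nu (E n)) <= n * Lambda.
  by rewrite -lee_fin fineK ?ge0_fin_numE// nuE.
rewrite (le_trans (ler_wpM2l eps0 f))// /eps.
have -> : h / n ^+ 2 * (n * Lambda) = h * Lambda / n by field; rewrite gt_eqF.
by rewrite ler_pdivrMr// mul1r.
Qed.

Let rho := sval (jump_mixture_exists (mE n) eps0 nuE_lty epsE).

Let rhoE (f : R -> R) : measurable_fun setT f ->
  nu.-integrable setT (EFin \o (fun x => f x - f 0)) ->
  rho.-integrable setT (EFin \o f) /\
  \int[rho]_x f x = f 0 + eps * \int[nu]_(x in E n) (f x - f 0).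
Proof.
move=> mf fi; apply: (svalP (jump_mixture_exists (mE n) eps0 nuE_lty epsE)) => //.
have : nu.-integrable (E n) (EFin \o (fun x => f x - f 0)).
  by apply: integrableS fi.
have c0 : nu.-integrable (E n) (EFin \o cst (f 0)).
  apply/integrableP; split; first exact/measurable_EFinP.
  by rewrite /= integral_cst// lte_mul_pinfty.
move=> h1; have := integrableD (mE n) h1 c0.
by apply: eq_integrable => // x _ /=; rewrite -EFinD subrK.
Qed.

Let restr_le (g : R -> R) : nu.-integrable setT (EFin \o g) ->
  `|\int[nu]_(x in E n) g x| <= \int[nu]_x `|g x|.
Proof.
move=> gi; have gE : nu.-integrable (E n) (EFin \o g) by apply: integrableS gi.
rewrite (le_trans (le_normr_Rintegral (mE n) gE))//.
rewrite -lee_fin /Rintegral !fineK; last 2 first.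
- exact: integrable_fin_num (integrable_norm gi).
- exact: integrable_fin_num (integrable_norm gE).
apply: ge0_subset_integral => //.
have /integrableP[/measurable_EFinP mg _] := gi.
by apply/measurable_EFinP; exact: measurableT_comp.
Qed.

Let Jn := \int[nu]_(x in E n) (expR x - 1).

Let JnM : `|Jn| <= M. Proof. exact: restr_le. Qed.

Let epsJ : `|eps * Jn| <= 1 / 2.
Proof.
rewrite normrM (ger0_norm eps0) (le_trans (ler_wpM2l eps0 JnM))// /eps.
rewrite mulrAC ler_pdivrMr ?exprn_gt0//.
have : n <= n ^+ 2 by rewrite expr2 ler_peMl// ltW.
by move: nM; lra.
Qed.

Variable N : nat.
Hypothesis NE : N%:R = n ^+ 2.

Let pi := conv_pow rho N.
(** The mean of [expR z] under [pi] is (1 + eps Jn)^N, and [c] is minus its logarithm, so that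
    [expR (c + z)] has mean exactly one for each approximant and not merely in the limit. *)
Let c := - (N%:R * ln (1 + eps * Jn)).

Let p1 : 0 < 1 + eps * Jn.
Proof. by move: epsJ; rewrite ler_norml => /andP[]; lra. Qed.

Let Neps : N%:R * eps = h.
Proof. by rewrite NE /eps; field; rewrite gt_eqF. Qed.

Let step_exp : (\int[pi]_z (expR z)%:E = (expR (- c))%:E)%E.
Proof.
have iB : nu.-integrable setT (EFin \o (fun x : R => expR x - expR 0)) by rewrite expR0.
have [ri rE] := rhoE (@measurable_expR R) iB.
rewrite /pi (conv_pow_expe (m := 1 + eps * Jn)).
  by rewrite /c opprK expRM_natl lnK.
by rewrite (expectation_EFin ri) rE expR0.
Qed.

Let step_max : (\int[pi]_z (Num.max (expR z) 1)%:E <= (expR (h * I))%:E)%E.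
Proof.
have mm : measurable_fun setT (fun z : R => Num.max (expR z) 1).
  by apply: measurable_maxr => //; exact: measurable_expR.
have mE1 x : Num.max (expR x) 1 - Num.max (expR 0) 1 = Num.max (expR x - 1) 0 :> R.
  by rewrite expR0 maxxx -[in RHS](subrr 1) -addr_maxl.
have iB : nu.-integrable setT
    (EFin \o (fun x : R => Num.max (expR x) 1 - Num.max (expR 0) 1)).
  by under eq_fun do rewrite mE1.
have [ri rE] := rhoE mm iB.
have hp : (\int[rho]_z (Num.max (expR z) 1)%:E <= (expR (eps * I))%:E)%E.
  rewrite (expectation_EFin ri) rE expR0 maxxx lee_fin.
  rewrite (le_trans _ (expR_ge1Dx _))// lerD2l ler_wpM2l//.
  have -> : \int[nu]_(x in E n) (Num.max (expR x) 1 - 1) = \int[nu]_(x in E n) Num.max (expR x - 1) 0.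
    by apply: eq_Rintegral => x _; have := mE1 x; rewrite expR0 maxxx.
  rewrite (le_trans (ler_norm _))// (le_trans (restr_le iexpB1P))//.
  rewrite le_eqVlt; apply/orP; left; apply/eqP; apply: eq_Rintegral => x _.
  by rewrite ger0_norm// le_max lexx orbT.
rewrite (le_trans (conv_pow_maxe hp N))// lee_fin -expRM_natl.
by rewrite mulrA Neps.
Qed.

Let step_c : `|c| <= 2 * (h * M).
Proof.
have /andP[l1 l2] := ln1D_bounds epsJ.
have l3 : `|ln (1 + eps * Jn)| <= 2 * `|eps * Jn|.
  have : (eps * Jn) ^+ 2 <= 1 / 2 * `|eps * Jn|.
    by rewrite -(real_normK (num_real _)) expr2 ler_wpM2r.
  move: l1 l2; have := ler_norm (eps * Jn); have := ler_norm (- (eps * Jn)).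
  by rewrite normrN ler_norml => *; apply/andP; split; lra.
rewrite normrN normrM ger0_norm// (le_trans (ler_wpM2l _ l3))//.
rewrite normrM (ger0_norm eps0).
have -> : N%:R * (2 * (eps * `|Jn|)) = 2 * (N%:R * eps * `|Jn|) by ring.
by rewrite Neps ler_wpM2l// ler_wpM2l// ltW.
Qed.

Let step_c_cvg : `|c + h * J| <= h * `|Jn - J| + 2 * (h * M) ^+ 2 / n ^+ 2.
Proof.
have /andP[l1 l2] := ln1D_bounds epsJ.
have l3 : `|ln (1 + eps * Jn) - eps * Jn| <= 2 * (eps * Jn) ^+ 2.
  by have := sqr_ge0 (eps * Jn); rewrite ler_norml => *; apply/andP; split; lra.
have -> : c + h * J = - (N%:R * (ln (1 + eps * Jn) - eps * Jn)) - h * (Jn - J).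
  by rewrite /c mulrBr mulrA Neps; ring.
rewrite (le_trans (ler_normB _ _))// addrC lerD//.
  by rewrite normrM gtr0_norm.
rewrite normrN normrM ger0_norm// (le_trans (ler_wpM2l _ l3))//.
have -> : N%:R * (2 * (eps * Jn) ^+ 2) = 2 * (N%:R * eps) * eps * Jn ^+ 2 by ring.
rewrite Neps /eps.
have -> : 2 * h * (h / n ^+ 2) * Jn ^+ 2 = 2 * (h ^+ 2 * Jn ^+ 2) / n ^+ 2.
  by field; rewrite gt_eqF.
rewrite ler_wpM2r ?invr_ge0 ?sqr_ge0// ler_wpM2l// exprMn ler_wpM2l ?sqr_ge0//.
by rewrite -(real_normK (num_real Jn)) lerXn2r ?nnegrE// (le_trans _ JnM).
Qed.

(** One period is compared with the exponential of [eps] times the exact jump exponent. The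
    discrepancy has a first-order part from the truncation of small jumps and a second-order part
    from linearising the exponential; [conv_pow_cos] multiplies both by [N]. *)
Let step_cos u theta :
  `|\int[pi]_z cos (u * z + theta) - expR (h * Cr u) * cos (h * Si u + theta)| <=
  h * (`|\int[nu]_(x in E n) (cos (u * x) - 1) - Cr u| +
       `|\int[nu]_(x in E n) sin (u * x) - Si u|) +
  (h ^+ 2 * (Cr u ^+ 2 + 2 * Si u ^+ 2 + `|Cr u * Si u|)) / n ^+ 2.
Proof.
set Cn := \int[nu]_(x in E n) (cos (u * x) - 1).
set Sn := \int[nu]_(x in E n) sin (u * x).
have icos := levy_integrable (mcosB1 u) (fun x => levy_dom_cos u x).
have isin := levy_integrable (msin u) (fun x => levy_dom_sin u x).
have Cr0 : Cr u <= 0.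
  rewrite -oppr_ge0 -mulN1r -RintegralZl//; apply: Rintegral_ge0 => x _.
  by rewrite mulN1r opprB subr_ge0 cos_le1.
pose a := eps * Cr u; pose b := eps * Si u.
have a0 : a <= 0 by rewrite mulr_ge0_le0.
pose delta := eps * (`|Cn - Cr u| + `|Sn - Si u|) +
  eps ^+ 2 * (Cr u ^+ 2 + 2 * Si u ^+ 2 + `|Cr u * Si u|).
have hyp t : `|\int[rho]_x cos (u * x + t) - expR a * cos (b + t)| <= delta.
  have iB : nu.-integrable setT (EFin \o (fun x => cos (u * x + t) - cos (u * 0 + t))).
    have := integrable_realB (integrable_realZ (cos t) icos) (integrable_realZ (sin t) isin).
    by apply: eq_integrable => // x _; rewrite /= mulr0 add0r cosD; congr _%:E; ring.
  have [_ ->] := rhoE (bdmeas_cos u t).1 iB.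
  rewrite mulr0 add0r.
  have -> : \int[nu]_(x in E n) (cos (u * x + t) - cos t) = cos t * Cn - sin t * Sn.
    rewrite /Cn /Sn -!RintegralZl//; last 2 first.
    - by apply: integrableS isin.
    - by apply: integrableS icos.
    rewrite -RintegralB//; last 2 first.
    - by apply: (integrableS measurableT) => //; exact: integrable_realZ.
    - by apply: (integrableS measurableT) => //; exact: integrable_realZ.
    by apply: eq_Rintegral => x _; rewrite cosD; ring.
  rewrite cosD.
  have -> : cos t + eps * (cos t * Cn - sin t * Sn) - expR a * (cos b * cos t - sin b * sin t) =
    cos t * (1 + eps * Cn - expR a * cos b) - sin t * (eps * Sn - expR a * sin b) by ring.
  have h1 : `|1 + eps * Cn - expR a * cos b| <= eps * `|Cn - Cr u| + (a ^+ 2 + b ^+ 2).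
    have -> : 1 + eps * Cn - expR a * cos b = eps * (Cn - Cr u) +
       (- (expR a - 1 - a) - expR a * (cos b - 1)) by rewrite /a; ring.
    rewrite (le_trans (ler_normD _ _))// normrM (ger0_norm eps0) lerD2l.
    rewrite (le_trans (ler_normB _ _))// normrN; apply: lerD.
      by have /andP[q1 q2] := expR_le_quad a0; rewrite ger0_norm.
    rewrite normrM (ger0_norm (expR_ge0 _)) (le_trans _ (norm_cosB1_le2 b))// ler_piMl//.
    by rewrite -expR0 ler_expR.
  have h2 : `|eps * Sn - expR a * sin b| <= eps * `|Sn - Si u| + (b ^+ 2 + `|a| * `|b|).
    have -> : eps * Sn - expR a * sin b = eps * (Sn - Si u) +
       (- (sin b - b) - (expR a - 1) * sin b) by rewrite /b; ring.
    rewrite (le_trans (ler_normD _ _))// normrM (ger0_norm eps0) lerD2l.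
    rewrite (le_trans (ler_normB _ _))// normrN; apply: lerD; first exact: norm_sinB_le2.
    by rewrite normrM ler_pM// ?norm_expRB1_le// norm_sin_le.
  rewrite (le_trans (ler_normB _ _))// !normrM.
  have ct : `|cos t| <= 1 by rewrite ler_norml cos_geN1 cos_le1.
  have st : `|sin t| <= 1 by rewrite ler_norml sin_geN1 sin_le1.
  rewrite (le_trans (lerD (ler_piMl (normr_ge0 _) ct) (ler_piMl (normr_ge0 _) st)))//.
  rewrite (le_trans (lerD h1 h2))// /delta -normrM le_eqVlt; apply/orP; left; apply/eqP.
  rewrite /a /b (_ : eps * Cr u * (eps * Si u) = eps ^+ 2 * (Cr u * Si u)); last by ring.
  by rewrite normrM (ger0_norm (sqr_ge0 eps)); ring.
have := conv_pow_cos a0 hyp N theta; rewrite -/pi.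
have -> : N%:R * a = h * Cr u by rewrite /a mulrA Neps.
have -> : N%:R * b = h * Si u by rewrite /b mulrA Neps.
move=> /le_trans; apply; rewrite /delta mulrDr mulrA Neps lerD2l.
have -> : N%:R * (eps ^+ 2 * (Cr u ^+ 2 + 2 * Si u ^+ 2 + `|Cr u * Si u|)) =
  (N%:R * eps) * eps * (Cr u ^+ 2 + 2 * Si u ^+ 2 + `|Cr u * Si u|) by ring.
by rewrite Neps /eps le_eqVlt; apply/orP; left; apply/eqP; field; rewrite gt_eqF.
Qed.

Lemma levy_approx_step : exists (pi : probability R R) (c : R),
  [/\ (\int[pi]_z (expR z)%:E = (expR (- c))%:E)%E,
      (\int[pi]_z (Num.max (expR z) 1)%:E <= (expR (h * I))%:E)%E,
      `|c| <= 2 * (h * M),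
      `|c + h * J| <= h * `|\int[nu]_(x in E n) (expR x - 1) - J| + 2 * (h * M) ^+ 2 / n ^+ 2 &
      forall u theta,
        `|\int[pi]_z cos (u * z + theta) - expR (h * Cr u) * cos (h * Si u + theta)| <=
          h * (`|\int[nu]_(x in E n) (cos (u * x) - 1) - Cr u| +
               `|\int[nu]_(x in E n) sin (u * x) - Si u|) +
          (h ^+ 2 * (Cr u ^+ 2 + 2 * Si u ^+ 2 + `|Cr u * Si u|)) / n ^+ 2].
Proof. by exists pi, c; split. Qed.

End Step.

Variables (sigma gamma h : R) (Q : probability R R).
Hypothesis sigma0 : 0 < sigma.
Hypothesis h0 : 0 < h.
Hypothesis martingale : ((sigma ^+ 2 / 2 + gamma)%:E
  + \int[nu]_x (expR x - 1 - (if `|x| <= 1 then x else 0)%R)%:E = 0)%E.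
Hypothesis Qcos : forall u, \int[Q]_x cos (u * x) =
  expR (h * psi_re sigma nu u) * cos (h * psi_im gamma nu u).
Hypothesis Qsin : forall u, \int[Q]_x sin (u * x) =
  expR (h * psi_re sigma nu u) * sin (h * psi_im gamma nu u).

Let small (x : R) := if `|x| <= 1 then x else 0.

Let msmall : measurable_fun setT small.
Proof.
apply: measurable_fun_ifT => //.
by apply: measurable_fun_ler => //; exact: measurableT_comp.
Qed.

Let ismall : nu.-integrable setT (EFin \o small).
Proof.
apply: (levy_integrable (C := 1)) => // x; rewrite mul1r.
rewrite (le_trans _ (levy_dom_ge_min x))// /small; case: ifPn => [x1|_].
  by rewrite le_min lexx x1.
by rewrite normr0 le_min ler01 normr_ge0.
Qed.

Let m1 := \int[nu]_x small x.

(** The martingale condition solved for the drift. Finite variation makes the compensator [small]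
    integrable by itself, so the integral splits into [J] and [m1]; in [psi_imE] the term [m1] then
    cancels against the compensator of the exponent. *)
Let gammaE : gamma = - (sigma ^+ 2 / 2) - J + m1.
Proof.
have iB := integrable_realB iexpB1 ismall.
have := martingale.
rewrite -[X in (_ + X)%E]fineK; last by apply: (integrable_fin_num measurableT iB).
rewrite -EFinD => -[]; rewrite -/(Rintegral _ _ _) RintegralB// -/J -/m1; lra.
Qed.

Let psi_reE u : psi_re sigma nu u = - (sigma ^+ 2 * u ^+ 2) / 2 + Cr u.
Proof. by []. Qed.

Let psi_imE u : psi_im gamma nu u = u * (- (sigma ^+ 2 / 2) - J) + Si u.
Proof.
have isin := levy_integrable (msin u) (fun x => levy_dom_sin u x).
rewrite /psi_im gammaE.
have -> : \int[nu]_x (sin (u * x) - (if `|x| <= 1 then u * x else 0)) = Si u - u * m1.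
  rewrite -RintegralZl// -RintegralB//; last exact: integrable_realZ.
  by apply: eq_Rintegral => x _; rewrite /small; case: ifP; rewrite ?mulr0.
by ring.
Qed.

(** This shift makes the two lower bounds required of [n] in one step hold for every index, not only
    for large ones. *)
Let k0 := maxn (Num.bound (h * Lambda)) (Num.bound (2 * (h * M))).
Let n_ k : R := (k + k0).+1%:R.

Let n_ge1 k : 1 <= n_ k. Proof. by rewrite ler1n. Qed.

Let Lambda0 : 0 <= Lambda.
Proof. by apply: Rintegral_ge0 => x _; exact: levy_dom_ge0. Qed.

Let M0 : 0 <= M. Proof. exact: Rintegral_ge0. Qed.

Let nL k : h * Lambda <= n_ k.
Proof.
rewrite ltW// (lt_le_trans (archi_boundP (mulr_ge0 (ltW h0) Lambda0)))// ler_nat.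
by rewrite (leq_trans (leq_maxl _ (Num.bound (2 * (h * M)))))// -/k0 (leq_trans (leq_addl k _)).
Qed.

Let nM k : 2 * (h * M) <= n_ k.
Proof.
have hM0 : 0 <= 2 * (h * M) by rewrite mulr_ge0// mulr_ge0// ltW.
rewrite ltW// (lt_le_trans (archi_boundP hM0))// ler_nat.
by rewrite (leq_trans (leq_maxr (Num.bound (h * Lambda)) _))// -/k0 (leq_trans (leq_addl k _)).
Qed.

Let NE k : (((k + k0).+1 ^ 2)%N)%:R = n_ k ^+ 2 :> R.
Proof. by rewrite natrX. Qed.

Let n_oo : n_ k @[k --> \oo] --> +oo.
Proof.
apply/cvgryPge => A; near=> k; rewrite (@le_trans _ _ k%:R)//.
  by near: k; exact: nbhs_infty_ger.
by rewrite ler_nat -addSn (leq_trans (leqnSn k))// leq_addr.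
Unshelve. all: by end_near. Qed.

Let n_inv : (n_ k ^+ 2)^-1 @[k --> \oo] --> 0.
Proof.
apply: (@squeeze_cvgr _ _ _ _ (cst 0) (fun k => k.+1%:R^-1)); last 2 first.
- exact: cvg_cst.
- exact: cvg_harmonic.
apply: nearW => k; rewrite invr_ge0 sqr_ge0/= lef_pV2 ?posrE ?exprn_gt0 ?ltr0n//.
rewrite (@le_trans _ _ (n_ k))//; last by rewrite expr2 ler_peMl// ler0n.
by rewrite ler_nat ltnS leq_addr.
Qed.

(** The Gaussian factor, the shift [c_ k] tending to - h J, and the jump transform multiply to the
    transform of [Q], and the continuity theorem concludes. The exponential is not a bounded test,
    so its moments are recorded for each [k] with bounds independent of [k]. *)
Theorem levy_approx : exists (pi_ : nat -> probability R R) (c_ : nat -> R),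
  [/\ forall k, (\int[pi_ k]_z (expR z)%:E = (expR (- c_ k))%:E)%E,
      forall k, (\int[pi_ k]_z (Num.max (expR z) 1)%:E <=
        (expR (h * \int[nu]_x Num.max (expR x - 1) 0))%:E)%E,
      forall k, `|c_ k| <= 2 * (h * \int[nu]_x `|expR x - 1|) &
      forall (f : R -> R) (B L : R), measurable_fun setT f ->
        (forall x, 0 <= f x <= B) -> (forall x y, `|f x - f y| <= L * `|x - y|) ->
        \int[gauss (Num.sqrt h)]_g \int[pi_ k]_z
          f (sigma * g + (c_ k - sigma ^+ 2 / 2 * h) + z) @[k --> \oo] -->
        \int[Q]_x f x].
Proof.
have /choice[pi_ /choice[c_ H]] := fun k =>
  levy_approx_step h0 (n_ge1 k) (nL k) (nM k) (NE k).
have Hc k : `|c_ k + h * J| <= h * `|\int[nu]_(x in E (n_ k)) (expR x - 1) - J| + 2 * (h * M) ^+ 2 / n_ k ^+ 2.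
  by have [] := H k.
have Hcos k u theta := let: And5 _ _ _ _ h5 := H k in h5 u theta.
exists pi_, c_; split=> [k|k|k|]; [by have [] := H k|by have [] := H k|by have [] := H k|].
have sh0 : Num.sqrt h != 0 by rewrite gt_eqF// sqrtr_gt0.
have cc : c_ k @[k --> \oo] --> - (h * J).
  apply/subr_cvg0; under eq_fun do rewrite opprK.
  apply: norm_cvg0.
  apply: (@squeeze_cvgr _ _ _ _ (cst 0) (fun k => h * `|\int[nu]_(x in E (n_ k)) (expR x - 1) - J| + 2 * (h * M) ^+ 2 / n_ k ^+ 2)).
  - by apply: nearW => k; rewrite normr_ge0/=.
  - exact: cvg_cst.
  - rewrite -[X in _ --> X]addr0 -[X in _ --> X + _](mulr0 h) -[X in _ --> _ + X](mulr0 (2 * (h * M) ^+ 2)).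
    apply: cvgD; apply: cvgM; [exact: cvg_cst| |exact: cvg_cst|exact: n_inv].
    rewrite -(normr0 R); apply: cvg_norm; apply/subr_cvg0.
    by apply: trunc_cvg n_oo => //; [exact: levy_dom_expRB1|rewrite expR0 subrr].
pose d_ k := c_ k - sigma ^+ 2 / 2 * h.
have mlin k : measurable_fun setT (fun g : R => sigma * g + d_ k).
  by apply: measurable_funD => //; exact: measurable_funM.
pose kap k := conv (law (gauss (Num.sqrt h)) (mlin k)) (pi_ k).
have kapE k (f : R -> R) : bdmeas f -> \int[kap k]_x f x =
    \int[gauss (Num.sqrt h)]_g \int[pi_ k]_z f (sigma * g + d_ k + z).
  move=> bf; rewrite expectation_conv//.
  have bff : bdmeas (fun p : R * R => f (p.1 + p.2)).
    apply: (bdmeas_comp bf).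
    by apply: measurable_funD; [exact: measurable_fst|exact: measurable_snd].
  (* The first law is a placeholder: the conclusion involves only the inner integral, against
     [pi_ k]. *)
  have bi := bdmeas_expectation (gauss 1) (pi_ k) bff.
  rewrite expectation_law//; first by case: bi.
  by apply: bdmeas_integrable; exact: (bdmeas_comp bi (mlin k)).
move=> f B L mf f0 fL.
have bf : bdmeas f by exact: (bdmeas_itv mf f0).
rewrite [X in X @ _ --> _](_ : _ = (fun k => \int[kap k]_x f x)); last first.
  by apply/funext => k; rewrite kapE.
apply: (Lipschitz_cvg _ mf f0 fL) => u theta.
pose psi := Cr u; pose si := Si u.
(* The target transform is split into a jump factor, a Gaussian factor and a deterministic shift,
   the shape which the transform of [kap k] has up to the error [r k] and the replacement of the
   shift by its approximation [d_ k]. *)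
have QE : \int[Q]_x cos (u * x + theta) =
    expR (h * Cr u) * (expR (- ((u * sigma) ^+ 2 * Num.sqrt h ^+ 2 / 2)) *
      cos (u * (- (h * J) - sigma ^+ 2 / 2 * h) + (h * Si u + theta))).
  have -> : \int[Q]_x cos (u * x + theta) =
      cos theta * \int[Q]_x cos (u * x) - sin theta * \int[Q]_x sin (u * x).
    have b1 : bdmeas (fun x : R => cos (u * x)).
      by have := bdmeas_cos u 0; under eq_fun do rewrite addr0.
    have b2 : bdmeas (fun x : R => sin (u * x)).
      by have := bdmeas_sin u 0; under eq_fun do rewrite addr0.
    rewrite -!expectationZ// -expectationB; [|exact: bdmeasZ..].
    by apply: eq_Rintegral => x _; rewrite cosD; ring.
  rewrite Qcos Qsin [RHS]mulrA -[X in _ = X * _]expRD.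
  have -> : h * Cr u + - ((u * sigma) ^+ 2 * Num.sqrt h ^+ 2 / 2) = h * psi_re sigma nu u.
    by rewrite psi_reE sqr_sqrtr ?ltW//; field.
  have -> : u * (- (h * J) - sigma ^+ 2 / 2 * h) + (h * Si u + theta) = h * psi_im gamma nu u + theta.
    by rewrite psi_imE; ring.
  by rewrite cosD; ring.
pose S k := expR (h * Cr u) * (expR (- ((u * sigma) ^+ 2 * Num.sqrt h ^+ 2 / 2)) *
      cos (u * d_ k + (h * Si u + theta))).
have Scvg : S k @[k --> \oo] --> \int[Q]_x cos (u * x + theta).
  rewrite QE; apply: cvgM; first exact: cvg_cst.
  apply: cvgM; first exact: cvg_cst.
  have hc : u * d_ k + (h * Si u + theta) @[k --> \oo] -->
      u * (- (h * J) - sigma ^+ 2 / 2 * h) + (h * Si u + theta).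
    apply: cvgD; last exact: cvg_cst.
    apply: cvgM; first exact: cvg_cst.
    by apply: cvgB; [exact: cc|exact: cvg_cst].
  exact: (cvg_comp _ _ hc (@continuous_cos R _)).
pose r k := h * (`|\int[nu]_(x in E (n_ k)) (cos (u * x) - 1) - Cr u| +
               `|\int[nu]_(x in E (n_ k)) sin (u * x) - Si u|) +
          (h ^+ 2 * (Cr u ^+ 2 + 2 * Si u ^+ 2 + `|Cr u * Si u|)) / n_ k ^+ 2.
have rcvg : r k @[k --> \oo] --> 0.
  rewrite -[X in _ --> X]addr0 -[X in _ --> X + _](mulr0 h).
  rewrite -[X in _ --> _ + X](mulr0 (h ^+ 2 * (Cr u ^+ 2 + 2 * Si u ^+ 2 + `|Cr u * Si u|))).
  apply: cvgD; apply: cvgM; [exact: cvg_cst| |exact: cvg_cst|exact: n_inv].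
  rewrite -[X in _ --> X]addr0; apply: cvgD.
    rewrite -(normr0 R); apply: cvg_norm; apply/subr_cvg0.
    by apply: trunc_cvg n_oo; [exact: mcosB1|exact: levy_dom_cos|rewrite mulr0 cos0 subrr].
  rewrite -(normr0 R); apply: cvg_norm; apply/subr_cvg0.
  by apply: trunc_cvg n_oo; [exact: msin|exact: levy_dom_sin|rewrite mulr0 sin0].
have dist k : `|\int[kap k]_x cos (u * x + theta) - S k| <= r k.
  rewrite kapE; last exact: bdmeas_cos.
  have -> : S k = \int[gauss (Num.sqrt h)]_g
      (expR (h * Cr u) * cos (u * sigma * g + (u * d_ k + (h * Si u + theta)))).
    by rewrite expectationZ; [rewrite gauss_cos|exact: bdmeas_cos].
  have b1 : bdmeas (fun g => \int[pi_ k]_z cos (u * (sigma * g + d_ k + z) + theta)).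
    have bff : bdmeas (fun p : R * R => cos (u * (sigma * p.1 + d_ k + p.2) + theta)).
      apply: (bdmeas_comp (bdmeas_cos u theta)).
      apply: measurable_funD; last exact: measurable_snd.
      by apply: measurable_funD => //; apply: measurable_funM => //; exact: measurable_fst.
    exact: (bdmeas_expectation (gauss 1) (pi_ k) bff).
  have b2 : bdmeas (fun g => expR (h * Cr u) *
      cos (u * sigma * g + (u * d_ k + (h * Si u + theta)))).
    by apply: bdmeasZ; exact: bdmeas_cos.
  rewrite -expectationB//; apply: expectation_norm_le; first by have [] := bdmeasB b1 b2.
  move=> g; have := Hcos k u (u * (sigma * g + d_ k) + theta).
  rewrite -/(r k); congr (`|_ - _ * cos _| <= _).
    by apply: eq_Rintegral => z _; congr cos; ring.
  by ring.
have : \int[kap k]_x cos (u * x + theta) - S k @[k --> \oo] --> 0.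
  apply: norm_cvg0; apply: (@squeeze_cvgr _ _ _ _ (cst 0) r) => //; last exact: cvg_cst.
  by apply: nearW => k; rewrite normr_ge0 dist.
move=> h1; have := cvgD h1 Scvg; rewrite add0r => h2.
have -> : (fun k => \int[kap k]_x cos (u * x + theta)) =
    (fun k => (\int[kap k]_x cos (u * x + theta) - S k) + S k).
  by apply/funext => k; rewrite subrK.
exact: h2.
Qed.

End LevyApproximation.

(** * Independence of the increments from the augmented natural filtration *)

Section IndependenceFromSigmaAlgebra.
Context {R : realType} {d : measure_display} {Omega : measurableType d}.
Variable P : probability Omega R.

(** Dynkin's argument: the measurable events independent of [B] form a lambda-system, which contains
    the sigma-algebra generated by any pi-system inside it. *)
Lemma indep_event_sigma (B : set Omega) (Pi : set (set Omega)) :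
  measurable B -> setI_closed Pi ->
  (forall A, Pi A -> measurable A /\ P (A `&` B) = (P A * P B)%E) ->
  forall A, <<s Pi >> A -> measurable A /\ P (A `&` B) = (P A * P B)%E.
Proof.
move=> mB PiI PiB; apply: lambda_system_subset => //.
apply/dynkin_lambda_system; split.
- by split=> //; rewrite setTI probability_setT mul1e.
- move=> A [mA AB]; split; first exact: measurableC.
  have fB : P B \is a fin_num by exact: fin_num_measure.
  have fA : P A \is a fin_num by exact: fin_num_measure.
  have -> : ~` A `&` B = B `\` A by rewrite setDE setIC.
  have BA : P (B `&` A) = (P A * P B)%E by rewrite setIC.
  have -> : P (B `\` A) = (fine (P B) - fine (P A) * fine (P B))%:E.
    rewrite measureD//; last by rewrite (le_lt_trans (probability_le1 P mB))// ltry.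
    by rewrite [X in (_ - X)%E]BA EFinB EFinM !fineK.
  have -> : P (~` A) = (1 - fine (P A))%:E by rewrite probability_setC// EFinB fineK.
  by rewrite -[X in _ = (_ * X)%E]fineK// -EFinM; congr _%:E; ring.
- move=> F tF FB; have mF k : measurable (F k) by have [] := FB k.
  split; first exact: bigcup_measurable.
  (* Both sides of the product rule are measures of the event: the restriction of [P] to [B], and
     [P] scaled by the mass of [B]. Countable additivity then reduces a disjoint union to its
     members. *)
  pose m1 : {measure set Omega -> \bar R} := mrestr P mB.
  have p0 : 0 <= fine (P B) by exact: fine_ge0.
  pose m2 : {measure set Omega -> \bar R} := mscale (NngNum p0) P.
  have m2E A : m2 A = (P A * P B)%E.
    by rewrite /m2/= /mscale/= fineK ?fin_num_measure// muleC.
  rewrite -m2E; change (m1 (\bigcup_k F k) = m2 (\bigcup_k F k)).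
  rewrite !measure_bigcup//; apply: eq_eseriesr => k _.
  by rewrite m2E; have [] := FB k.
Qed.

Lemma indep_ofP (Z : Omega -> R) (G : set (set Omega)) :
  (forall A, G A -> measurable A) -> measurable_fun setT Z ->
  indep_of P Z G <-> (forall A C, G A -> measurable C ->
    P (A `&` Z @^-1` C) = (P A * P (Z @^-1` C))%E).
Proof.
move=> mG mZ; split=> h A C GA mC.
  have mZC : measurable (Z @^-1` C) by rewrite -[_ @^-1` _]setTI; exact: mZ.
  have mA := mG _ GA.
  rewrite -[LHS]fineK ?h ?EFinM ?fineK// ?fin_num_measure//.
  exact: measurableI.
by rewrite h// fineM// fin_num_measure//; [exact: mG|rewrite -[_ @^-1` _]setTI; exact: mZ].
Qed.

End IndependenceFromSigmaAlgebra.

Section LevyIndependence.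
Context {R : realType} {d : measure_display} {Omega : measurableType d}.
Variables (P : probability Omega R) (X : R -> Omega -> R).
Hypothesis mX : forall t, 0 <= t -> measurable_fun setT (X t).
Hypothesis X0 : \forall w \ae P, X 0 w = 0.
Hypothesis iX : forall (n : nat) (t : nat -> R), 0 <= t 0%N ->
  (forall i, (i < n)%N -> t i < t i.+1) ->
  mutually_indep P (fun i : 'I_n => fun w => X (t i.+1) w - X (t i) w).

Section Grid.
Variables (n : nat) (t : nat -> R).
Hypothesis t0 : t 0%N = 0.
Hypothesis tS : forall i, (i < n.+1)%N -> t i < t i.+1.

Let tge0 i : (i <= n.+1)%N -> 0 <= t i.
Proof.
elim: i => [|i IH] h; first by rewrite t0.
by rewrite (le_trans (IH (ltnW h)))// ltW// tS.
Qed.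

Let D (i : nat) w := X (t i.+1) w - X (t i) w.

Let mD i : (i < n.+1)%N -> measurable_fun setT (D i).
Proof. by move=> h; apply: measurable_funB; apply: mX; apply: tge0 => //; exact: ltnW. Qed.

Let Pi : set (set Omega) :=
  [set A | exists B : 'I_n -> set R, (forall i, measurable (B i)) /\
     A = \bigcap_(i in [set: 'I_n]) (D i @^-1` B i)].

Let mPi A : Pi A -> measurable A.
Proof.
move=> [B [mB ->]]; rewrite bigcap_mkcond.
apply: fin_bigcap_measurable => // i _; rewrite in_setT -[_ @^-1` _]setTI.
by apply: mD => //; rewrite ltnS ltnW.
Qed.

Let PiI : setI_closed Pi.
Proof.
move=> _ _ [B [mB ->]] [B' [mB' ->]]; exists (fun i => B i `&` B' i); split.
  by move=> i; exact: measurableI.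
by rewrite -bigcapI.
Qed.

(** The sets prescribed for the earlier increments are extended by a last set for [D n]. The product
    formula is used twice, with [C] and with [setT] as the last set; the second use identifies the
    product over the earlier increments as the probability of [A]. *)
Let Pi_indep C A : measurable C -> Pi A -> measurable A /\
  P (A `&` D n @^-1` C) = (P A * P (D n @^-1` C))%E.
Proof.
move=> mC PA; split; first exact: mPi.
have mDn : measurable (D n @^-1` C) by rewrite -[_ @^-1` _]setTI; exact: mD.
have := PA => -[B [mB AE]].
pose B' (C' : set R) (i : 'I_n.+1) := if unlift ord_max i is Some j then B j else C'.
have mB' C' : measurable C' -> forall i, measurable (B' C' i).
  by move=> mC' i; rewrite /B'; case: (unlift _ _).
have BE C' : \bigcap_(i in [set: 'I_n.+1]) (D i @^-1` B' C' i) = A `&` D n @^-1` C'.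
  rewrite AE; apply/seteqP; split=> w /=.
    move=> h; split.
      move=> j _; have := h (lift ord_max j) Logic.I.
      by rewrite /B' liftK /= /bump leqNgt ltn_ord add0n.
    by have := h ord_max Logic.I; rewrite /B' unlift_none.
  move=> [h1 h2] i _; rewrite /B'; case: unliftP => [j ->|->] //=.
  by rewrite /bump leqNgt ltn_ord add0n; exact: h1.
have prodE C' : measurable C' -> fine (P (A `&` D n @^-1` C')) =
    (\prod_(i < n) fine (P (D i @^-1` B i))) * fine (P (D n @^-1` C')).
  move=> mC'; rewrite -BE (iX (t := t) _ tS (mB' C' mC')) ?t0//.
  rewrite big_ord_recr/=; congr (_ * _); last first.
    by rewrite /B' unlift_none.
  apply: eq_bigr => i _; rewrite /B'.
  have -> : widen_ord (leqnSn n) i = lift ord_max i.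
    by apply: val_inj; rewrite /= /bump leqNgt ltn_ord.
  by rewrite liftK.
have PAE : fine (P A) = \prod_(i < n) fine (P (D i @^-1` B i)).
  have := prodE setT measurableT.
  by rewrite preimage_setT setIT probability_setT mulr1.
have mA := mPi PA.
rewrite -[LHS]fineK ?fin_num_measure//; last exact: measurableI.
by rewrite prodE// -PAE EFinM !fineK ?fin_num_measure.
Qed.

Let GPi := g_sigma_algebraType Pi.

Let mD_Pi i : (i < n)%N -> measurable_fun setT (D i : GPi -> R).
Proof.
move=> h _ B mB; rewrite setTI; apply: sub_sigma_algebra.
exists (fun j => if j == i :> nat then B else setT); split.
  by move=> j; case: ifP.
apply/seteqP; split=> w /=.
  by move=> Bw j _; case: ifPn => // /eqP ->.
by move=> /(_ (Ordinal h) Logic.I) /=; rewrite eqxx.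
Qed.

Let mX_Pi j : (j <= n)%N -> measurable_fun setT ((fun w => X (t j) w - X 0 w) : GPi -> R).
Proof.
elim: j => [|j IH] h.
  by rewrite t0 (_ : (fun w => _) = cst 0)//; apply/funext => w; rewrite subrr.
have -> : (fun w => X (t j.+1) w - X 0 w) =
    (fun w => (X (t j) w - X 0 w) + D j w).
  by apply/funext => w; rewrite /D; ring.
by apply: measurable_funD; [exact: IH (ltnW h)|exact: mD_Pi].
Qed.

Fixpoint cylinder (l : seq (R * set R)) : set Omega :=
  if l is (u, C) :: l' then X u @^-1` C `&` cylinder l' else setT.

(** Past values are sums of increments only after [X 0] is subtracted, so each cylinder is replaced
    by the one for X u - X 0, which lies in the sigma-algebra of the increments and differs from it
    only inside a null set. *)
Lemma grid_indep (l : seq (R * set R)) (C : set R) :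
  (forall p, List.In p l -> measurable p.2 /\ exists2 j, (j <= n)%N & p.1 = t j) ->
  measurable C ->
  P (cylinder l `&` D n @^-1` C) = (P (cylinder l) * P (D n @^-1` C))%E.
Proof.
move=> hl mC.
have mDn : measurable (D n @^-1` C) by rewrite -[_ @^-1` _]setTI; exact: mD.
have [N [mN PN hN]] := X0.
pose cyl0 := fix cyl0 (l : seq (R * set R)) : set Omega :=
  if l is (u, C) :: l' then (fun w => X u w - X 0 w) @^-1` C `&` cyl0 l' else setT.
have gl : <<s Pi >> (cyl0 l).
  elim: l hl => [|[u B] l IH] hl /=; first exact: (@measurableT _ GPi).
  have [/= mB [j jn uj]] := hl (u, B) (or_introl erefl).
  apply: (@measurableI _ GPi); last by apply: IH => p pl; apply: hl; right.
  by rewrite uj -[_ @^-1` _]setTI; exact: mX_Pi.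
have [m0 i0] := indep_event_sigma mDn PiI (fun A PA => Pi_indep mC PA) gl.
have ml : measurable (cylinder l).
  elim: l hl {gl m0 i0} => [|[u B] l IH] hl //=.
  have [/= mB [j jn uj]] := hl (u, B) (or_introl erefl).
  apply: measurableI; last by apply: IH => p pl; apply: hl; right.
  by rewrite uj -[_ @^-1` _]setTI; apply: mX => //; apply: tge0; exact: leqW.
have eqN w : ~ N w -> cylinder l w <-> cyl0 l w.
  move=> nNw; have x0 : X 0 w = 0 by apply: contrapT => h; exact/nNw/hN.
  elim: (l) => [|[u B] l' IH] //=; rewrite /preimage/= x0 subr0.
  by split=> -[h1 h2]; split=> //; exact/IH.
have eqP A : measurable A -> P (cylinder l `&` A) = P (cyl0 l `&` A).
  move=> mA; have diff B : measurable B -> P B = P (B `\` N).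
    move=> mB; have BN : P (B `&` N) = 0%E.
      apply/eqP; rewrite eq_le measure_ge0 andbT -[leRHS]PN.
      by apply: le_measure; rewrite ?inE//; exact: measurableI.
    rewrite measureD//; last by rewrite (le_lt_trans (probability_le1 P mB))// ltry.
    by rewrite [X in (_ - X)%E]BN sube0.
  rewrite diff; last exact: measurableI.
  rewrite [RHS]diff; last exact: measurableI.
  congr (P _); apply/seteqP; split=> w /= [[h1 h2] h3]; split=> //; split=> //.
    exact/eqN.
  exact/eqN.
rewrite eqP// i0; congr (_ * _)%E.
by have := eqP setT measurableT; rewrite !setIT.
Qed.

End Grid.

Let cylinder_cat l l' : cylinder (l ++ l') = cylinder l `&` cylinder l'.
Proof. by elim: l => [|[u C] l IH] /=; rewrite ?setTI// IH setIA. Qed.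

(** Null sets together with finite cylinders of times up to [s] form a pi-system whose sigma-algebra
    contains the augmented past. For one cylinder, its times are sorted into a grid through 0 and
    [s], and mutual independence of the grid increments applies. *)
Theorem levy_indep (s h : R) : 0 <= s -> 0 < h ->
  indep_of P (fun w => X (s + h) w - X s w) (aug_natural P X s).
Proof.
move=> s0 h0; set Z := fun w => _.
have mZ : measurable_fun setT Z by apply: measurable_funB; apply: mX => //; rewrite addr_ge0// ltW.
have mXC u C : 0 <= u -> measurable C -> measurable (X u @^-1` C).
  by move=> u0 mC; rewrite -[_ @^-1` _]setTI; exact: mX.
pose good (l : seq (R * set R)) := forall p, List.In p l ->
  [/\ 0 <= p.1, p.1 <= s & measurable p.2].
have mcyl l : good l -> measurable (cylinder l).
  elim: l => [|[u C] l IH] gl //=; apply: measurableI.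
    by have [/= ? ? ?] := gl (u, C) (or_introl erefl); exact: mXC.
  by apply: IH => p pl; apply: gl; right.
pose Pi : set (set Omega) := [set A | (measurable A /\ P A = 0%E) \/
  exists2 l, good l & A = cylinder l].
have null A B : measurable A -> P A = 0%E -> measurable B -> P (A `&` B) = 0%E.
  move=> mA PA mB; apply/eqP; rewrite eq_le measure_ge0 andbT -[leRHS]PA.
  by apply: le_measure; rewrite ?inE//; exact: measurableI.
have mPi A : Pi A -> measurable A by move=> [[]|[l gl ->]] //; exact: mcyl.
have PiI : setI_closed Pi.
  move=> A B PA PB; have mA := mPi _ PA; have mB := mPi _ PB.
  case: PA => [[_ A0]|[l gl AE]]; first by left; split; [exact: measurableI|exact: null].
  case: PB => [[_ B0]|[l' gl' BE]].
    by left; split; [exact: measurableI|rewrite setIC; exact: null].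
  right; exists (l ++ l'); last by rewrite cylinder_cat AE BE.
  by move=> p /List.in_app_iff[/gl|/gl'].
have genE A : aug_natural P X s A -> <<s Pi >> A.
  apply: smallest_sub; first exact: smallest_sigma_algebra.
  move=> B /= [[u [C [u0 us mC ->]]]|[mB B0]]; apply: sub_sigma_algebra; last by left.
  right; exists [:: (u, C)]; last by rewrite /= setIT.
  by move=> p [<-|[]].
have key A C : Pi A -> measurable C -> P (A `&` Z @^-1` C) = (P A * P (Z @^-1` C))%E.
  have mZC (C' : set R) : measurable C' -> measurable (Z @^-1` C').
    by move=> mC; rewrite -[_ @^-1` _]setTI; exact: mZ.
  case=> [[mA A0] mC|[l gl ->] mC]; first by rewrite A0 mul0e; apply: null => //; exact: mZC.
  pose ts := sort <=%R (undup (0 :: s :: map fst l)).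
  have ts_mem x : (x \in ts) = (x \in 0 :: s :: map fst l) by rewrite mem_sort mem_undup.
  have ts_range x : x \in ts -> 0 <= x <= s.
    rewrite ts_mem !inE => /or3P[/eqP->|/eqP->|]; rewrite ?lexx ?s0//.
    elim: (l) gl => [|[u B] l' IH] gl' //=; rewrite inE => /orP[/eqP->|].
      by have [/= -> -> _] := gl' (u, B) (or_introl erefl).
    by apply: IH => p pl; apply: gl'; right.
  have ts_sorted : sorted <%R ts by rewrite lt_sorted_uniq_le sort_uniq undup_uniq sort_le_sorted.
  have ts0 : (0 < size ts)%N by rewrite lt0n size_eq0; apply: contraTneq (mem_head 0 (s :: map fst l)); rewrite -ts_mem => ->.
  (* The default value of [nth] matters: it continues the grid beyond its last point [s] with
     [s + h], so the increment after the last grid point is [Z]. *)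
  pose n := (size ts).-1; pose t := nth (s + h) ts.
  have szE : size ts = n.+1 by rewrite /n prednK.
  have t_in i : (i <= n)%N -> t i \in ts by move=> h'; rewrite mem_nth// szE.
  have tn1 : t n.+1 = s + h by rewrite /t nth_default// szE.
  have t_lt i j : (i < j)%N -> (j <= n)%N -> t i < t j.
    move=> ij jn; rewrite /t (lt_sorted_ltn_nth _ ts_sorted) ?inE ?szE//.
    by rewrite ltnS (leq_trans (ltnW ij)).
  have t_ex x : x \in ts -> exists2 j, (j <= n)%N & x = t j.
    move=> xts; exists (index x ts); last by rewrite /t nth_index.
    by rewrite -ltnS -szE index_mem.
  have tS i : (i < n.+1)%N -> t i < t i.+1.
    rewrite ltnS leq_eqVlt => /predU1P[->|h']; last exact: t_lt.
    by rewrite tn1; have /andP[_ /le_lt_trans] := ts_range _ (t_in n (leqnn n)); apply; rewrite ltrDl.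
  have t0 : t 0%N = 0.
    have ts_0 : 0 \in ts by rewrite ts_mem mem_head.
    have [j jn jE] := t_ex 0 ts_0.
    case: j jn jE => [//|j] jn jE.
    have := t_lt 0%N j.+1 isT jn; rewrite -jE ltNge.
    by have /andP[-> _] := ts_range _ (t_in 0%N isT).
  have tn : t n = s.
    have ts_s : s \in ts by rewrite ts_mem !inE eqxx orbT.
    have [j jn jE] := t_ex s ts_s.
    move: jn; rewrite leq_eqVlt => /predU1P[<-//|jn].
    have := t_lt j n jn (leqnn n); rewrite -jE ltNge.
    by have /andP[_ ->] := ts_range _ (t_in n (leqnn n)).
  have := @grid_indep n t t0 tS l C; rewrite tn tn1; apply=> //.
  move=> p pl; have [p0 ps mp] := gl p pl; split=> //; apply: t_ex.
  rewrite ts_mem !inE; apply/or3P/Or33.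
  by elim: (l) pl => [|q l' IH] //= [->|/IH]; rewrite inE ?eqxx// => ->; rewrite orbT.
have all_meas A : aug_natural P X s A -> measurable A.
  move=> /genE; apply: smallest_sub => //; exact: sigma_algebra_measurable.
apply/(indep_ofP _ all_meas mZ) => A C /genE gA mC.
have mZC : measurable (Z @^-1` C) by rewrite -[_ @^-1` _]setTI; exact: mZ.
by have [] := indep_event_sigma mZC PiI (fun B PB => conj (mPi B PB) (key B C PB mC)) gA.
Qed.

End LevyIndependence.

(** * Bermudan puts and dynamic programming *)

Section Freezing.
Context {R : realType} {d : measure_display} {Omega : measurableType d}.
Variables (P : probability Omega R) (G : set (set Omega)).
Hypothesis sG : sigma_algebra setT G.
Hypothesis mG : forall A, G A -> measurable A.

Let OG := g_sigma_algebraType G.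

Lemma measurable_funG d' (T : measurableType d') (f : Omega -> T) :
  (forall C, measurable C -> G (f @^-1` C)) -> measurable_fun setT (f : OG -> T).
Proof. by move=> fG _ C mC; rewrite setTI; apply: sub_sigma_algebra; exact: fG. Qed.

Let measurable_OG (A : set Omega) : @measurable _ OG A -> G A.
Proof. by rewrite /measurable/= sigma_algebra_id. Qed.

Variables (W : Omega -> R) (mu : probability R R).
Hypothesis mW : measurable_fun setT W.
Hypothesis WG : indep_of P W G.
Hypothesis Wmu : forall C, measurable C -> P (W @^-1` C) = mu C.

Let mid : measurable_fun setT (id : Omega -> OG).
Proof. by move=> _ A mA; rewrite setTI; exact/mG/measurable_OG. Qed.

Let mpair : measurable_fun setT ((fun w => (w, W w)) : Omega -> OG * R).
Proof. exact: measurable_fun_pair. Qed.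

(** When the sample point is observed only through [G], the pair formed by it and the independent
    variable [W] has a product law. So [W] can be integrated out with everything known at that date
    kept fixed. *)
Lemma freezing (f : OG * R -> R) : bdmeas f ->
  \int[P]_w f (w, W w) = \int[P]_w \int[mu]_z f (w, z).
Proof.
move=> bf; have [mf _] := bf.
have lawP (A : set (OG * R)) : measurable A -> (law P mid \x mu)%E A = law P mpair A.
  apply: product_measure_unique => A1 A2 mA1 mA2.
  have G1 := measurable_OG mA1.
  change (P (A1 `&` W @^-1` A2) = (P A1 * mu A2)%E); rewrite -(Wmu mA2).
  by have [+ _] := indep_ofP P mG mW; apply.
have e1 : \int[P]_w f (w, W w) = \int[law P mpair]_p f p.
  by rewrite expectation_law//; apply: bdmeas_integrable; exact: bdmeas_comp bf mpair.
have e2 : \int[law P mpair]_p f p = \int[(law P mid \x mu)%E]_p f p.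
  rewrite /Rintegral; congr fine; apply: eq_measure_integral => A mA _.
  exact: esym (lawP A mA).
rewrite e1 e2 /Rintegral.
have fi := bdmeas_integrable [the probability _ _ of (law P mid \x mu)%E] bf.
have := integral12_prod_meas1 fi; rewrite /fubini_F/= => <-.
have bf1 x : bdmeas (fun y => f (x, y)) := bdmeas_comp bf (pair1_measurable x).
under eq_integral => x _ do rewrite (expectation_EFin (bdmeas_integrable mu (bf1 x))).
have bI := bdmeas_expectation (law P mid) mu bf.
have := @expectation_law _ _ _ _ _ P _ mid _ bI.1 (bdmeas_integrable _ (bdmeas_comp bI mid)).
by rewrite /Rintegral.
Qed.

End Freezing.

Section BermudanPut.
Context {R : realType}.
Implicit Types v : R -> R.

(** Truncating the price at 0 leaves the payoff unchanged on prices and makes it bounded and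
    nonincreasing on the whole line, so value functions remain bounded and measurable without
    restricting their domain. *)
Definition put (K y : R) : R := Num.max (K - Num.max y 0) 0.

Definition transition (mu : probability R R) v (y : R) : R :=
  \int[mu]_z v (y * expR z).

Fixpoint bermudan (mu : probability R R) (rho K : R) (n : nat) : R -> R :=
  if n is n'.+1
  then fun y => Num.max (put K y) (rho * transition mu (bermudan mu rho K n') y)
  else put K.

Lemma put_range K y : 0 <= K -> 0 <= put K y <= K.
Proof.
move=> K0; rewrite /put le_max lexx orbT/= ge_max K0 andbT.
by rewrite lerBlDr lerDl le_max lexx orbT.
Qed.

Lemma put_nonincreasing K : nonincreasing_fun (put K).
Proof.
move=> x y xy; rewrite /put ge_max le_max [X in _ && X]le_max lexx orbT andbT.
apply/orP; left; rewrite lerD2l lerN2 ge_max le_max xy/=.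
by rewrite le_max lexx orbT.
Qed.

Variable mu : probability R R.

Lemma bdmeas_nonincreasing v K : nonincreasing_fun v -> (forall y, 0 <= v y <= K) ->
  bdmeas v.
Proof. by move=> vn vK; apply: bdmeas_itv vK; exact: nonincreasing_measurable. Qed.

Lemma bdmeas_dilation v y : bdmeas v -> bdmeas (fun z => v (y * expR z)).
Proof.
move=> bv; apply: (bdmeas_comp (g := fun z => y * expR z) bv).
by apply: measurable_funM => //; exact: measurable_expR.
Qed.

Lemma transition_le v v' : bdmeas v -> bdmeas v' -> (forall y, v y <= v' y) ->
  forall y, transition mu v y <= transition mu v' y.
Proof. by move=> bv bv' vv' y; apply: expectation_le => //; exact: bdmeas_dilation. Qed.

Lemma transition_range v K : bdmeas v -> (forall y, 0 <= v y <= K) ->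
  forall y, 0 <= transition mu v y <= K.
Proof.
move=> bv vK y; have bI := bdmeas_integrable mu (bdmeas_dilation y bv).
apply/andP; split.
  by apply: expectation_ge_cst => // x; have /andP[] := vK (y * expR x).
by apply: expectation_le_cst => // x; have /andP[] := vK (y * expR x).
Qed.

Lemma transition_nonincreasing v : bdmeas v -> nonincreasing_fun v ->
  nonincreasing_fun (transition mu v).
Proof.
move=> bv vn x y xy; apply: expectation_le; [exact: bdmeas_dilation..|].
by move=> z; apply: vn; rewrite ler_wpM2r// expR_ge0.
Qed.

Variables rho K : R.
Hypotheses (rho01 : 0 <= rho <= 1) (K0 : 0 <= K).
Local Notation V := (bermudan mu rho K).

Lemma bermudan_prop n : nonincreasing_fun (V n) /\ (forall y, 0 <= V n y <= K).
Proof.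
have /andP[r0 r1] := rho01; elim: n => [|n [IH1 IH2]] /=.
  by split; [exact: put_nonincreasing|move=> y; exact: put_range].
have bv := bdmeas_nonincreasing IH1 IH2.
split=> [x y xy|y].
  have h1 := put_nonincreasing K xy.
  have h2 : rho * transition mu (V n) y <= rho * transition mu (V n) x.
    by rewrite ler_wpM2l//; exact: transition_nonincreasing.
  by rewrite ge_max; apply/andP; split; rewrite le_max ?h1 ?h2 ?orbT.
have /andP[p0 pK] := put_range y K0; have /andP[t0 tK] := transition_range bv IH2 y.
by rewrite le_max p0/= ge_max pK/= (le_trans _ tK)// ler_piMl.
Qed.

Lemma bermudan_nonincreasing n : nonincreasing_fun (V n).
Proof. by have [] := bermudan_prop n. Qed.

Lemma bermudan_range n y : 0 <= V n y <= K.
Proof. by have [_] := bermudan_prop n; apply. Qed.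

Lemma bdmeas_bermudan n : bdmeas (V n).
Proof. by have [h1 h2] := bermudan_prop n; exact: bdmeas_nonincreasing h2. Qed.

End BermudanPut.

(** * Exercise rules on a time grid *)

Section StoppingIndices.
Context {R : realType} {d : measure_display} {Omega : measurableType d}.
Variables (P : probability Omega R) (G : R -> set (set Omega)) (Z : R -> Omega -> R).
Variables (mu : probability R R) (h x rho K : R) (N : nat).
Hypothesis sG : forall t, 0 <= t -> sigma_algebra setT (G t).
Hypothesis mG : forall t, 0 <= t -> forall A, G t A -> measurable A.
Hypothesis ZG : forall t, 0 <= t -> forall C, measurable C -> G t (Z t @^-1` C).
Hypothesis ZI : forall s, 0 <= s -> indep_of P (fun w => Z (s + h) w - Z s w) (G s).
Hypothesis Zmu : forall s, 0 <= s -> forall C, measurable C ->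
  P ((fun w => Z (s + h) w - Z s w) @^-1` C) = mu C.
Hypotheses (h0 : 0 < h) (rho01 : 0 <= rho <= 1) (K0 : 0 <= K).

Let t (k : nat) := k%:R * h.
Let t0 k : 0 <= t k. Proof. by rewrite mulr_ge0// ltW. Qed.
Let S (k : nat) w := x * expR (Z (t k) w).
Local Notation V := (bermudan mu rho K).

Variable ind : Omega -> nat.
Hypothesis ind_le : forall w, (ind w <= N)%N.
Hypothesis ind_G : forall k, G (t k) [set w | (ind w <= k)%N].

Let mZ s : 0 <= s -> measurable_fun setT (Z s).
Proof. by move=> s0 _ C mC; rewrite setTI; apply: (mG s0); exact: ZG. Qed.

Let mS k : measurable_fun setT (S k).
Proof.
by apply: measurable_funM => //; apply: measurableT_comp => //; exact: mZ.
Qed.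

Lemma bdmeas_bool d' (T : measurableType d') (b : T -> bool) :
  measurable [set w | b w] -> bdmeas (fun w => (b w)%:R : R).
Proof.
move=> mb; have := bdmeas_indic (R := R) mb; congr bdmeas.
apply/funext => w; rewrite indicE; congr (nat_of_bool _)%:R.
by apply/idP/idP; rewrite inE.
Qed.

Let G_gt k : G (t k) [set w | (k < ind w)%N].
Proof.
have [_ GC _] := sG (t0 k).
have -> : [set w | (k < ind w)%N] = setT `\` [set w | (ind w <= k)%N].
  by apply/seteqP; split=> w /=; rewrite ltnNge; [move=> /negP|move=> [_ /negP]].
exact: GC.
Qed.

Let m_ge k : measurable [set w | (k <= ind w)%N].
Proof.
case: k => [|k]; last exact: mG (G_gt k).
by rewrite (_ : [set w | _] = setT)//; apply/seteqP; split.
Qed.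

Let m_eq k : measurable [set w | ind w == k].
Proof.
have -> : [set w | ind w == k] = [set w | (ind w <= k)%N] `&` [set w | (k <= ind w)%N].
  by apply/seteqP; split=> w /=; rewrite eqn_leq => /andP.
by apply: measurableI => //; exact: mG (ind_G k).
Qed.

(** The event that exercise comes after date k is known at date k, so freezing replaces the next
    value by its one-step transition there. *)
Let markov k (v : R -> R) : bdmeas v ->
  \int[P]_w ((k < ind w)%N%:R * v (S k.+1 w)) =
  \int[P]_w ((k < ind w)%N%:R * transition mu v (S k w)).
Proof.
move=> bv; pose OG := g_sigma_algebraType (G (t k)).
pose W w := Z (t k + h) w - Z (t k) w.
pose f (p : OG * R) : R := (k < ind p.1)%N%:R * v (S k p.1 * expR p.2).
have mW : measurable_fun setT W by apply: measurable_funB; apply: mZ => //; rewrite addr_ge0// ltW.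
have mSG : measurable_fun setT (S k : OG -> R).
  apply: measurable_funG => C mC.
  have -> : S k @^-1` C = Z (t k) @^-1` [set z | C (x * expR z)] by [].
  apply: ZG => //; rewrite -[X in measurable X]setTI.
  by apply: (measurable_funM (f := cst x) (g := expR)) => //; exact: measurable_expR.
have bf : bdmeas f.
  apply: bdmeasM.
    apply: (bdmeas_comp (f := fun w : OG => (k < ind w)%N%:R : R) (g := fst)) => //.
    by apply: bdmeas_bool; apply: sub_sigma_algebra; exact: G_gt.
  apply: (bdmeas_comp (g := fun p : OG * R => S k p.1 * expR p.2) bv).
  apply: measurable_funM.
    by apply: measurableT_comp => //; exact: measurable_fst.
  by apply: measurableT_comp; [exact: measurable_expR|exact: measurable_snd].
have := freezing (sG (t0 k)) (mG (t0 k)) mW (ZI (t0 k)) (Zmu (t0 k)) bf.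
have -> : (fun w => f (w, W w)) = (fun w => (k < ind w)%N%:R * v (S k.+1 w)).
  apply/funext => w; rewrite /f/= /S /W -mulrA -expRD; congr (_ * v (_ * expR _)).
  by rewrite /t -[in RHS]natr1 mulrDl mul1r; ring.
move=> ->; congr Rintegral; apply/funext => w; rewrite /f/=.
by rewrite expectationZ//; exact: bdmeas_dilation.
Qed.

Definition stopped_payoff w : R := rho ^+ ind w * put K (S (ind w) w).

Let bput : bdmeas (put K).
Proof. exact: (bdmeas_bermudan mu rho01 K0 0). Qed.

Let bS (v : R -> R) k : bdmeas v -> bdmeas (fun w => v (S k w)).
Proof. by move=> bv; exact: bdmeas_comp bv (mS k). Qed.

Lemma bdmeas_stopped_payoff : bdmeas stopped_payoff.
Proof.
have -> : stopped_payoff =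
    (fun w => \sum_(j < N.+1) ((ind w == j)%:R * (rho ^+ j * put K (S j w)))).
  apply/funext => w; have iN : (ind w < N.+1)%N by exact: ind_le.
  rewrite (bigD1 (Ordinal iN))//= eqxx mul1r big1 ?addr0// => j jn.
  rewrite (_ : (ind w == j) = false) ?mul0r//; apply/negbTE; apply: contra jn => /eqP e.
  by apply/eqP/val_inj.
elim: N.+1 => [|n IH].
  by rewrite (_ : (fun w => _) = cst 0); [exact: bdmeas_cst|apply/funext => w; rewrite big_ord0].
under eq_fun do rewrite big_ord_recr/=.
apply: bdmeasD => //; apply: bdmeasM; first by apply: bdmeas_bool; exact: m_eq.
by apply: bdmeasZ; exact: bS.
Qed.

(** The discounted loss at date k caused by following [ind]: the optimal value minus that of the
    action taken, namely exercise or continuation. It is never negative, and is zero for an optimal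
    rule. *)
Let gap k n w : R := (k <= ind w)%N%:R * (rho ^+ k * (V n.+1 (S k w) -
  (if ind w == k then put K (S k w) else rho * transition mu (V n) (S k w)))).

(** The expected loss of the rule from date k on, over the paths not yet exercised before k. It
    decreases from date k to k+1 by the expected [gap], and it vanishes at the final date; summing
    yields both the upper bound and the optimality criterion. *)
Let D k n : R := \int[P]_w ((k <= ind w)%N%:R * (rho ^+ k * V n (S k w))) -
  \int[P]_w ((k <= ind w)%N%:R * stopped_payoff w).

Let bV n : bdmeas (V n). Proof. exact: bdmeas_bermudan. Qed.

Let bQ n : bdmeas (transition mu (V n)).
Proof.
have bv := bV n.
apply: (@bdmeas_nonincreasing _ _ K); first exact/transition_nonincreasing/bermudan_nonincreasing.
by apply: transition_range => // y; exact: bermudan_range.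
Qed.

Let D_step k n : D k n.+1 = D k.+1 n + \int[P]_w gap k n w.
Proof.
have rQ := bdmeasZ rho (bQ n).
have bge j : bdmeas (fun w => (j <= ind w)%N%:R : R) by apply: bdmeas_bool; exact: m_ge.
have bp := bdmeas_stopped_payoff.
rewrite /D.
have -> : \int[P]_w ((k < ind w)%N%:R * (rho ^+ k.+1 * V n (S k.+1 w))) =
    \int[P]_w ((k < ind w)%N%:R * (rho ^+ k.+1 * transition mu (V n) (S k w))).
  have e f : (fun w => (k < ind w)%N%:R * (rho ^+ k.+1 * f w)) =
      (fun w => rho ^+ k.+1 * ((k < ind w)%N%:R * f w)) by apply/funext => w; ring.
  rewrite !e expectationZ; last by apply: bdmeasM => //; exact: bS.
  rewrite [RHS]expectationZ; last by apply: bdmeasM => //; apply: (bS (v := transition _ _)).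
  by rewrite markov.
rewrite -expectationB; [|apply: bdmeasM => //; apply: bdmeasZ; exact: bS (bV n.+1)|exact: bdmeasM].
rewrite -expectationB; [|apply: bdmeasM => //; apply: bdmeasZ; exact: bS (bQ n)|exact: bdmeasM].
have bgap : bdmeas (gap k n).
  apply: bdmeasM => //; apply: bdmeasZ; apply: bdmeasB; first exact: bS (bV n.+1).
  have -> : (fun w => if ind w == k then put K (S k w) else rho * transition mu (V n) (S k w)) =
     (fun w => (ind w == k)%:R * (put K (S k w) - rho * transition mu (V n) (S k w)) +
        rho * transition mu (V n) (S k w)).
    by apply/funext => w; case: eqP => _; rewrite ?mul1r ?mul0r ?add0r// subrK.
  apply: bdmeasD; last exact: bdmeasZ (bS k (bQ n)).
  apply: bdmeasM; first by apply: bdmeas_bool; exact: m_eq.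
  by apply: bdmeasB; [exact: bS|exact: bdmeasZ (bS k (bQ n))].
rewrite -expectationD//; last first.
  apply: bdmeasB; last exact: bdmeasM.
  by apply: bdmeasM => //; apply: bdmeasZ; exact: bS (bQ n).
congr Rintegral; apply/funext => w; rewrite /gap /stopped_payoff.
case: (ltngtP k (ind w)) => [kl|kl|<-]; rewrite /= ?mul0r ?mul1r ?exprS; ring.
Qed.

Let D_last n : (N <= n)%N -> D n 0 = 0.
Proof.
move=> Nn; rewrite /D; apply/eqP; rewrite subr_eq0; apply/eqP; congr Rintegral.
apply/funext => w; rewrite /stopped_payoff; case: leqP => [nw|_]; rewrite ?mul0r ?mul1r//.
suff -> : ind w = n by [].
by apply/eqP; rewrite eqn_leq nw (leq_trans (ind_le w)).
Qed.

Hypothesis Z0 : \forall w \ae P, Z 0 w = 0.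

Let D0 : D 0 N = V N x - \int[P]_w stopped_payoff w.
Proof.
rewrite /D (_ : (fun w => _ * stopped_payoff w) = stopped_payoff); last first.
  by apply/funext => w; rewrite leq0n mul1r.
congr (_ - _); rewrite (_ : (fun w => _) = (fun w => V N (S 0 w))); last first.
  by apply/funext => w; rewrite leq0n expr0 !mul1r.
rewrite -[RHS](expectation_cst P) /Rintegral; congr fine.
apply: ae_eq_integral => //; first by apply/measurable_EFinP; have [] := bS 0 (bV N).
by apply: filterS Z0 => w Zw _ /=; rewrite /S /t mul0r Zw expR0 mulr1.
Qed.

Lemma stopped_payoff_le : \int[P]_w stopped_payoff w <= V N x.
Proof.
suff D_ge0 k n : (k + n = N)%N -> 0 <= D k n by rewrite -subr_ge0 -D0; exact: D_ge0.
elim: n k => [|n IH] k kn; first by rewrite D_last// -kn addn0.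
rewrite D_step addr_ge0//; first by apply: IH; rewrite addSnnS.
apply: Rintegral_ge0 => w _; rewrite /gap mulr_ge0// mulr_ge0//.
  by apply: exprn_ge0; case/andP: rho01.
by rewrite subr_ge0 /= le_max; case: ifP => _; rewrite lexx ?orbT.
Qed.

Lemma stopped_payoff_eq :
  (forall k n w, (k + n.+1 = N)%N -> (k <= ind w)%N -> V n.+1 (S k w) =
    if ind w == k then put K (S k w) else rho * transition mu (V n) (S k w)) ->
  \int[P]_w stopped_payoff w = V N x.
Proof.
move=> opt; suff D_eq0 k n : (k + n = N)%N -> D k n = 0.
  by apply/eqP; rewrite eq_sym -subr_eq0 -D0 D_eq0.
elim: n k => [|n IH] k kn; first by rewrite D_last// -kn addn0.
rewrite D_step IH ?addSnnS// add0r.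
rewrite (_ : (fun w => gap k n w) = cst 0) ?expectation_cst//.
apply/funext => w; rewrite /gap; case: leqP => kw; rewrite ?mul0r//.
by rewrite (opt k n w kn kw) subrr !mulr0.
Qed.

End StoppingIndices.

Lemma cvg_at_right_seq {R : realType} (f : R -> R) (u : nat -> R) (t : R) :
  f y @[y --> t^'+] --> f t -> (forall n, t <= u n) -> u n @[n --> \oo] --> t ->
  f (u n) @[n --> \oo] --> f t.
Proof.
move=> ft tu ut; apply/cvgrPdist_lt => e e0.
have /cvgrPdist_lt/(_ e e0) h := ft.
have {}h : \forall y \near nbhs t, t < y -> `|f t - f y| < e by [].
have : \forall n \near \oo, t < u n -> `|f t - f (u n)| < e := ut _ h.
apply: filterS => n hn.
have := tu n; rewrite le_eqVlt => /predU1P[<-|]; last exact: hn.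
by rewrite subrr normr0.
Qed.

Lemma put_continuous {R : realType} (K : R) : continuous (put K).
Proof.
move=> y; apply: (@continuous_max R R^o (fun y => K - Num.max y 0) (fun=> 0)); last exact: cst_continuous.
apply: continuousB; first exact: cst_continuous.
by apply: (@continuous_max R R^o id (fun=> 0)); [exact: cvg_id|exact: cst_continuous].
Qed.

(** Off a null set the limit is measurable; completeness of the probability handles the preimages
    inside that null set. It is applied to payoffs at arbitrary stopping times, whose paths behave
    well only almost surely. *)
Lemma complete_measurable_cvg {R : realType} {d} {Omega : measurableType d}
    (P : probability Omega R) (f_ : nat -> Omega -> R) (f : Omega -> R) :
  complete_prob P -> (forall n, measurable_fun setT (f_ n)) ->
  {ae P, forall w, f_ ^~ w @ \oo --> f w} -> measurable_fun setT f.
Proof.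
move=> cP mf_ [N [mN PN hN]].
have m0 : measurable_fun (~` N) f.
  apply: (measurable_fun_cvg (h := f_)) => [n|w Nw].
    exact: measurable_funS (mf_ n).
  by apply: contrapT => h; apply: Nw; exact: hN.
move=> _ C mC; rewrite setTI.
have -> : f @^-1` C = (~` N `&` f @^-1` C) `|` (N `&` f @^-1` C).
  by rewrite -setIUl setUC setUCr setTI.
apply: measurableU; first by apply: m0 => //; exact: measurableC.
by apply: (cP N) => //; exact: subIsetl.
Qed.

(** * American prices bounded by, and bounding, Bermudan prices *)

Section AmericanPut.
Context {R : realType} {d : measure_display} {Omega : measurableType d}.
Variables (P : probability Omega R) (G : R -> set (set Omega)) (Z : R -> Omega -> R).
Variables (mu : R -> probability R R) (x r K : R).
Hypothesis sG : forall t, 0 <= t -> sigma_algebra setT (G t).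
Hypothesis mG : forall t, 0 <= t -> forall A, G t A -> measurable A.
Hypothesis leG : forall s t, 0 <= s -> s <= t -> G s `<=` G t.
Hypothesis ZG : forall t, 0 <= t -> forall C, measurable C -> G t (Z t @^-1` C).
Hypothesis ZI : forall h s, 0 < h -> 0 <= s -> indep_of P (fun w => Z (s + h) w - Z s w) (G s).
Hypothesis Zmu : forall h s, 0 < h -> 0 <= s -> forall C, measurable C ->
  P ((fun w => Z (s + h) w - Z s w) @^-1` C) = mu h C.
Hypothesis Z0 : \forall w \ae P, Z 0 w = 0.
Hypotheses (x0 : 0 <= x) (r0 : 0 < r) (K0 : 0 <= K).

Let disc h := expR (- (r * h)).
Let disc01 h : 0 < h -> 0 <= disc h <= 1.
Proof. by move=> h0; rewrite /disc expR_ge0 -expR0 ler_expR oppr_le0 mulr_ge0// ltW. Qed.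

Let payoff s w := disc s * put K (x * expR (Z s w)).

Let payoffE s w : disc s * Num.max (K - x * expR (Z s w)) 0 = payoff s w.
Proof.
by rewrite /payoff /put [Num.max (x * _) 0]max_l// mulr_ge0// expR_ge0.
Qed.

Let disc_pow h n : disc h ^+ n = disc (n%:R * h).
Proof. by rewrite /disc -expRM_natl -mulr_natr; congr expR; ring. Qed.

(** Exercise dates are rounded up to finer and finer grids. The rounded dates approach [tau] from
    above, so right continuity of the paths gives convergence of the payoffs, and the term D / (n +
    1) leaves no trace in the limit. *)
Theorem amer_payoff_le (theta c D : R) (tau : Omega -> R) :
  complete_prob P -> 0 < theta ->
  (\forall w \ae P, forall t, 0 <= t -> Z s w @[s --> t^'+] --> Z t w) ->
  (forall w, 0 <= tau w <= theta) -> (forall u, 0 < u -> G u [set w | tau w < u]) ->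
  (forall n, bermudan (mu (theta / n.+1%:R)) (disc (theta / n.+1%:R)) K n.+1 x <= c + D / n.+1%:R) ->
  (\int[P]_w (expR (- (r * tau w)) * Num.max (K - x * expR (Z (tau w) w)) 0)%:E <= c%:E)%E.
Proof.
move=> cP theta0 Zrc tau_itv tauG Vc.
pose h n := theta / n.+1%:R.
have h0 n : 0 < h n by rewrite divr_gt0.
(* The first grid date strictly after [tau], capped at the horizon. Strictness turns the event of
   exercise by date k into one of the form tau < k h, which is known at time k h even when tau <= k
   h is not; it also forces the index to be at least one, so nothing is exercised at date 0. *)
pose ind n w := minn (Num.trunc (tau w / h n)).+1 n.+1.
have tauh0 n w : 0 <= tau w / h n by rewrite divr_ge0 ?(ltW (h0 n))//; have /andP[] := tau_itv w.
have ind_le n w : (ind n w <= n.+1)%N by exact: geq_minr.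
have ind_G n k : G (k%:R * h n) [set w | (ind n w <= k)%N].
  have kh0 : 0 <= k%:R * h n by rewrite mulr_ge0// ltW.
  have [G0 GC _] := sG kh0.
  have GT : G (k%:R * h n) setT by rewrite -(setD0 setT); exact: GC.
  have [nk|kn] := leqP n.+1 k.
    rewrite (_ : [set w | _] = setT)//; apply/seteqP; split=> // w _ /=.
    exact: leq_trans nk.
  case: k kn kh0 GT G0 GC => [|k] kn kh0 GT G0 GC.
    rewrite (_ : [set w | _] = set0)//; apply/seteqP; split=> // w /=.
    by rewrite /ind geq_min.
  rewrite (_ : [set w | _] = [set w | tau w < k.+1%:R * h n]).
    by apply: tauG; rewrite mulr_gt0.
  apply/seteqP; split=> w /=; rewrite /ind geq_min (leqNgt n.+1) kn orbF -ltr_pdivrMr//.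
    by rewrite (truncn_lt_nat _ (tauh0 n w)).
  by rewrite (truncn_lt_nat _ (tauh0 n w)).
pose tn n w := (ind n w)%:R * h n.
have tau_tn n w : tau w <= tn n w.
  rewrite /tn -ler_pdivrMr// /ind /minn; case: ifP => _; first exact/ltW/truncnS_gt.
  rewrite ler_pdivrMr// /h mulrC divfK ?pnatr_eq0//.
  by have /andP[] := tau_itv w.
have tn_tau n w : tn n w - tau w <= h n.
  rewrite /tn lerBlDr -ler_pdivlMr// mulrDl divff ?gt_eqF// addrC.
  rewrite (le_trans (y := (Num.trunc (tau w / h n)).+1%:R))// ?ler_nat ?geq_minl//.
  by rewrite -natr1 lerD2r; have /andP[] := truncn_itv (tauh0 n w).
have tn_cvg w : tn n w @[n --> \oo] --> tau w.
  apply: (@squeeze_cvgr _ _ _ _ (fun=> tau w) (fun n => tau w + h n)).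
  - by apply: nearW => n; rewrite tau_tn/= -lerBlDl tn_tau.
  - exact: cvg_cst.
  - rewrite -[X in _ --> X]addr0; apply: cvgD; first exact: cvg_cst.
    rewrite -[X in _ --> X](mulr0 theta); apply: cvgM; first exact: cvg_cst.
    exact: cvg_harmonic.
have spE n w : stopped_payoff Z (h n) x (disc (h n)) K (ind n) w = payoff (tn n w) w.
  by rewrite /stopped_payoff disc_pow.
have ms n : bdmeas (fun w => payoff (tn n w) w).
  have -> : (fun w => payoff (tn n w) w) = stopped_payoff Z (h n) x (disc (h n)) K (ind n).
    by apply/funext => w; rewrite spE.
  apply: (@bdmeas_stopped_payoff _ _ _ G Z (mu (h n)) (h n) x (disc (h n)) K n.+1) => //.
  exact: disc01.
have cv : {ae P, forall w, (fun n => payoff (tn n w) w) @ \oo --> payoff (tau w) w}.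
  apply: filterS Zrc => w Zw.
  apply: (cvg_at_right_seq (f := fun s => payoff s w)) => //.
  have t0 : 0 <= tau w by have /andP[] := tau_itv w.
  apply: cvgM.
    apply: cvg_at_right_filter; apply: continuous_cvg; first exact: continuous_expR.
    by apply: cvgN; apply: cvgM; [exact: cvg_cst|exact: cvg_id].
  apply: continuous_cvg; first exact: put_continuous.
  apply: cvgM; first exact: cvg_cst.
  by apply: continuous_cvg; [exact: continuous_expR|exact: Zw].
have payoff_itv s w : 0 <= s -> 0 <= payoff s w <= K.
  move=> s0; have /andP[p0 pK] := put_range (x * expR (Z s w)) K0.
  rewrite /payoff mulr_ge0 ?expR_ge0//= (le_trans _ pK)// ler_piMl//.
  by rewrite -expR0 ler_expR oppr_le0 mulr_ge0// ltW.
have t0 w : 0 <= tau w by have /andP[] := tau_itv w.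
have mp := complete_measurable_cvg cP (fun n => (ms n).1) cv.
have bp : bdmeas (fun w => payoff (tau w) w).
  by apply: (@bdmeas_itv _ _ _ _ 0 K) => // w; exact: payoff_itv.
rewrite (_ : (fun w => _) = (fun w => (payoff (tau w) w)%:E)); last first.
  by apply/funext => w; rewrite payoffE.
rewrite expectation_EFin; last exact: bdmeas_integrable.
rewrite lee_fin.
have cvE := expectation_cvg (M := K) (fun n => (ms n).1) mp cv.
have cvc : c + D / n.+1%:R @[n --> \oo] --> c.
  rewrite -[X in _ --> X]addr0; apply: cvgD; first exact: cvg_cst.
  by rewrite -[X in _ --> X](mulr0 D); apply: cvgM; [exact: cvg_cst|exact: cvg_harmonic].
apply: ler_cvg_to (cvE _) cvc _.
  move=> n w; have /andP[p0 pK] : 0 <= payoff (tn n w) w <= K.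
    by apply: payoff_itv; rewrite mulr_ge0// ltW.
  by rewrite ger0_norm.
apply: nearW => n; rewrite (le_trans _ (Vc n))//.
have -> : (fun w => payoff (tn n w) w) = stopped_payoff Z (h n) x (disc (h n)) K (ind n).
  by apply/funext => w; rewrite spE.
apply: (@stopped_payoff_le _ _ _ P G Z (mu (h n))) => //.
- by move=> s s0; exact: ZI.
- by move=> s s0 C mC; exact: Zmu.
- exact: disc01.
Qed.

(** The Bermudan price is attained by exercising as soon as the value equals the payoff. This rule
    depends only on prices already observed at grid dates, hence is a stopping time for [G] and for
    the larger [F]. *)
Theorem bermudan_le_amer_put (F : R -> set (set Omega)) (h : R) (N : nat) :
  0 < h -> (forall t, 0 <= t -> G t `<=` F t) ->
  ((bermudan (mu h) (disc h) K N x)%:E <=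
    amer_put P F (fun t w => x * expR (Z t w))%R r K (N%:R * h)%R)%E.
Proof.
move=> h0 GF.
pose V := bermudan (mu h) (disc h) K.
pose S k w := x * expR (Z (k%:R * h) w).
pose stop w k := V (N - k)%N (S k w) == put K (S k w).
(* When no date below [N] qualifies, [find] returns the length [N] of the list, which is exactly the
   final exercise date. *)
pose ind w := find (stop w) (iota 0 N).
have ind_le w : (ind w <= N)%N by rewrite -[leqRHS](size_iota 0); exact: find_size.
have bV k : bdmeas (V k) by apply: bdmeas_bermudan => //; exact: disc01.
have bput : bdmeas (put K) := bV 0%N.
have kh0 k : 0 <= k%:R * h by rewrite mulr_ge0// ltW.
have stopG k : G (k%:R * h) [set w | stop w k].
  have -> : [set w | stop w k] = Z (k%:R * h) @^-1`
      ((fun z => V (N - k)%N (x * expR z) - put K (x * expR z)) @^-1` [set 0]).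
    apply/seteqP; split=> w; rewrite /stop /S /=.
      by move/eqP => ->; rewrite subrr.
    by move/eqP; rewrite subr_eq0.
  apply: ZG => //; rewrite -[X in measurable X]setTI.
  apply: (bdmeasB (bdmeas_dilation x (bV (N - k)%N)) (bdmeas_dilation x bput)).1 => //.
have ind_G k : G (k%:R * h) [set w | (ind w <= k)%N].
  have [G0 GC GU] := sG (kh0 k).
  have [Nk|kN] := leqP N k.
    rewrite (_ : [set w | _] = setT); first by rewrite -(setD0 setT); exact: GC.
    by apply/seteqP; split=> // w _ /=; exact: leq_trans Nk.
  rewrite (_ : [set w | _] =
    \bigcup_j (if (j <= k)%N then [set w | stop w j] else set0)).
    apply: GU => j; case: ifP => // jk; apply: (leG (s := j%:R * h)) => //.
    by rewrite ler_wpM2r ?ler_nat// ltW.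
  apply/seteqP; split=> w /=.
    move=> ik; have iN : (ind w < N)%N by exact: leq_ltn_trans kN.
    exists (ind w) => //; rewrite ik /=.
    have := @nth_find _ 0%N (stop w) (iota 0 N); rewrite has_find size_iota => /(_ iN).
    by rewrite nth_iota.
  move=> [j _]; case: ifP => // jk sj; rewrite leqNgt; apply/negP => kind.
  have jN : (j < N)%N by exact: leq_ltn_trans kN.
  have := @before_find _ 0%N (stop w) (iota 0 N) j (leq_ltn_trans jk kind).
  by rewrite nth_iota// add0n => e; move: sj => /=; rewrite e.
have -> : bermudan (mu h) (disc h) K N x =
    \int[P]_w stopped_payoff Z h x (disc h) K ind w.
  apply/esym; apply: (@stopped_payoff_eq _ _ _ P G Z (mu h) h x (disc h) K N) => //.
  - by move=> s s0; exact: ZI.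
  - by move=> s s0 C mC; exact: Zmu.
  - exact: disc01.
  - move=> k n w kn kind; have kN : (k < N)%N by rewrite -kn addnS ltnS leq_addr.
    have nE : (N - k)%N = n.+1 by rewrite -kn addKn.
    case: ifPn => [/eqP ik|ik].
      have := @nth_find _ 0%N (stop w) (iota 0 N); rewrite has_find size_iota -/(ind w) ik.
      by move=> /(_ kN); rewrite nth_iota// add0n /stop nE => /eqP.
    have kind' : (k < ind w)%N by rewrite ltn_neqAle eq_sym ik.
    have := @before_find _ 0%N (stop w) (iota 0 N) k kind'.
    rewrite nth_iota// add0n /stop nE /V /= -/V -/(S k w) => /negbT.
    by case: (leP (put K (S k w)) _) => // _; rewrite eqxx.
rewrite -expectation_EFin; last first.
  apply: bdmeas_integrable.
  apply: (@bdmeas_stopped_payoff _ _ _ G Z (mu h) h x (disc h) K N) => //.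
  exact: disc01.
apply: ereal_sup_ubound; exists (fun w => (ind w)%:R * h).
  split=> [w|u u0].
    by rewrite kh0 ler_wpM2r ?ler_nat// ltW.
  have uh0 : 0 <= u / h by rewrite divr_ge0// ltW.
  apply: (GF u u0).
  apply: (leG (s := (Num.trunc (u / h))%:R * h)) => //.
    by rewrite -ler_pdivlMr//; have /andP[] := truncn_itv uh0.
  rewrite (_ : [set w | _] = [set w | (ind w <= Num.trunc (u / h))%N]) //.
  by apply/seteqP; split=> w /=; rewrite -ler_pdivlMr// truncn_ge_nat.
apply: eq_integral => w _; congr _%:E.
by rewrite payoffE /stopped_payoff disc_pow.
Qed.

End AmericanPut.

(** * Convexity, and one-step comparison *)

Lemma norm_maxB_le {R : realType} (a b c d e : R) : `|a - c| <= e -> `|b - d| <= e ->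
  `|Num.max a b - Num.max c d| <= e.
Proof.
rewrite !ler_norml => /andP[h1 h2] /andP[h3 h4].
by have [?|?] := leP a b; have [?|?] := leP c d; apply/andP; split; lra.
Qed.

Section ConvexValue.
Context {R : realType}.
Implicit Types v : R -> R.

(** Convexity is restricted to nonnegative prices because [put] is constant on the negative axis,
    which makes a concave kink at 0 when K is positive. *)
Definition convex_on_nonneg v := forall x y t, 0 <= x -> 0 <= y -> 0 <= t <= 1 ->
  v (t * x + (1 - t) * y) <= t * v x + (1 - t) * v y.

(** Lipschitz regularity along rays, in the logarithm of the price: this is what the weak
    approximation of the log-price increment requires of its test functions. *)
Definition log_lipschitz (L : R) v := forall y a b,
  `|v (y * expR a) - v (y * expR b)| <= L * `|a - b|.

(** The slope is the supremum of the slopes to the left of [y]; the three-chord inequality puts it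
    below every slope to the right. *)
Lemma supporting_line v y : convex_on_nonneg v -> 0 < y ->
  exists s, forall x, 0 <= x -> v y + s * (x - y) <= v x.
Proof.
move=> cv y0.
have slope x z : 0 <= x -> x < y -> y < z -> (v y - v x) / (y - x) <= (v z - v y) / (z - y).
  move=> x0 xy yz; have zx : 0 < z - x by lra.
  rewrite ler_pdivrMr ?subr_gt0// mulrAC ler_pdivlMr ?subr_gt0//.
  have := cv x z ((z - y) / (z - x)) x0 (ltW (lt_trans y0 yz)).
  have -> : (z - y) / (z - x) * x + (1 - (z - y) / (z - x)) * z = y.
    by field; rewrite gt_eqF.
  have t01 : 0 <= (z - y) / (z - x) <= 1.
    by apply/andP; split; [rewrite divr_ge0//; lra|rewrite ler_pdivrMr//; lra].
  move=> /(_ t01) h.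
  have {}h : v y * (z - x) <= (z - y) * v x + (y - x) * v z.
    have -> : (z - y) * v x + (y - x) * v z =
        ((z - y) / (z - x) * v x + (1 - (z - y) / (z - x)) * v z) * (z - x).
      by field; rewrite gt_eqF.
    by rewrite ler_pM2r.
  nra.
pose A := [set (v y - v x) / (y - x) | x in [set x | 0 <= x < y]].
have ubA z : y < z -> ubound A ((v z - v y) / (z - y)).
  by move=> yz _ [x /= /andP[x0 xy] <-]; exact: slope.
have A0 : A !=set0 by exists ((v y - v 0) / (y - 0)); exists 0 => //=; rewrite lexx.
have supA : has_sup A.
  by split=> //; exists ((v (y + 1) - v y) / (y + 1 - y)); apply: ubA; rewrite ltrDl.
exists (sup A) => x x0; have [xy|yx|->] := ltgtP x y.
- have : (v y - v x) / (y - x) <= sup A.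
    by apply: ub_le_sup; [case: supA|exists x => //=; rewrite x0].
  by rewrite ler_pdivrMr ?subr_gt0//; nra.
- have : sup A <= (v x - v y) / (x - y) by apply: ge_sup => //; exact: ubA.
  by rewrite ler_pdivlMr ?subr_gt0//; nra.
- by rewrite subrr mulr0 addr0.
Qed.

Variable K : R.
Hypothesis K0 : 0 <= K.

Lemma putE y : 0 <= y -> put K y = Num.max (K - y) 0.
Proof. by move=> y0; rewrite /put (max_l y0). Qed.

Lemma put_convex : convex_on_nonneg (put K).
Proof.
move=> x y t x0 y0 /andP[t0 t1]; have t1' : 0 <= 1 - t by rewrite subr_ge0.
rewrite !putE ?addr_ge0 ?mulr_ge0//.
have hx : K - x <= Num.max (K - x) 0 by rewrite le_max lexx.
have hy : K - y <= Num.max (K - y) 0 by rewrite le_max lexx.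
have hx0 : 0 <= Num.max (K - x) 0 by rewrite le_max lexx orbT.
have hy0 : 0 <= Num.max (K - y) 0 by rewrite le_max lexx orbT.
rewrite ge_max; apply/andP; split; last by rewrite addr_ge0// mulr_ge0.
nra.
Qed.

(** In the logarithm of the price the put has slope -y where y < K and 0 beyond, hence the constant
    [K]. *)
Lemma put_log_lipschitz : log_lipschitz K (put K).
Proof.
suff h y a b : a <= b -> `|put K (y * expR a) - put K (y * expR b)| <= K * (b - a).
  move=> y a b; have [ab|/ltW ba] := leP a b.
    by rewrite distrC [`|a - b|]distrC (ger0_norm (_ : 0 <= b - a)) ?subr_ge0// distrC h.
  by rewrite (ger0_norm (_ : 0 <= a - b)) ?subr_ge0// distrC h.
move=> ab; have ba0 : 0 <= b - a by rewrite subr_ge0.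
have [y0|y0] := leP y 0.
  have e c : put K (y * expR c) = put K 0.
    have yc : y * expR c <= 0 by rewrite mulr_le0_ge0// expR_ge0.
    by rewrite /put (max_r yc) (max_r (lexx 0)).
  by rewrite !e subrr normr0 mulr_ge0.
have ea := expR_gt0 a; have eb := expR_gt0 b.
have eab : expR a <= expR b by rewrite ler_expR.
rewrite ger0_norm ?subr_ge0; last by apply: put_nonincreasing; rewrite ler_pM2l.
rewrite !putE ?mulr_ge0 ?expR_ge0 ?(ltW y0)//.
have h1 : expR b * (1 - (b - a)) <= expR a.
  have -> : expR a = expR b * expR (- (b - a)) by rewrite -expRD; congr expR; ring.
  by rewrite ler_pM2l//; exact: expR_ge1Dx.
set u := y * expR a; set w := y * expR b.
have uw : w * (1 - (b - a)) <= u by rewrite /u /w -mulrA ler_pM2l.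
have u0 : 0 < u by rewrite mulr_gt0.
have w0 : 0 < w by rewrite mulr_gt0.
have lt : u <= w by rewrite /u /w ler_pM2l.
have h2 : 0 <= K * (b - a) by rewrite mulr_ge0.
have [uK|uK] := leP (K - u) 0; have [wK|wK] := leP (K - w) 0; [lra|lra| |nra].
have [d1|/ltW d1] := leP (b - a) 1; last by have := ler_wpM2l K0 d1; lra.
have : K * (1 - (b - a)) <= w * (1 - (b - a)) by apply: ler_wpM2r; lra.
lra.
Qed.

Variable mu : probability R R.

Lemma transition_convex v : bdmeas v -> convex_on_nonneg v ->
  convex_on_nonneg (transition mu v).
Proof.
move=> bv cv x y t x0 y0 t01; rewrite /transition.
have b1 := bdmeas_dilation x bv; have b2 := bdmeas_dilation y bv.
rewrite -!expectationZ// -expectationD ?bdmeasZ//; try exact: bdmeasZ.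
apply: expectation_le; first exact: bdmeas_dilation.
  by apply: bdmeasD; exact: bdmeasZ.
move=> z; have z0 := expR_ge0 z.
have -> : (t * x + (1 - t) * y) * expR z = t * (x * expR z) + (1 - t) * (y * expR z) by ring.
by apply: cv => //; exact: mulr_ge0.
Qed.

Lemma transition_log_lipschitz L v : bdmeas v -> log_lipschitz L v ->
  log_lipschitz L (transition mu v).
Proof.
move=> bv lv y a b; have bd c := bdmeas_dilation (y * expR c) bv.
rewrite /transition -expectationB//; apply: expectation_norm_le.
  by case: (bdmeasB (bd a) (bd b)).
move=> z; have e c : y * expR c * expR z = (y * expR z) * expR c by ring.
by rewrite !e.
Qed.

Variable rho : R.
Hypothesis rho01 : 0 <= rho <= 1.
Local Notation V := (bermudan mu rho K).

Lemma bermudan_convex n : convex_on_nonneg (V n).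
Proof.
have /andP[r0 r1] := rho01.
elim: n => [|n IH]; first exact: put_convex.
move=> x y t x0 y0 /andP[t0 t1] /=; have t01 : 0 <= t <= 1 by rewrite t0.
have t1' : 0 <= 1 - t by rewrite subr_ge0.
have h1 := put_convex x0 y0 t01.
have h2 := transition_convex (bdmeas_bermudan mu rho01 K0 n) IH x0 y0 t01.
have le1 z : put K z <= Num.max (put K z) (rho * transition mu (V n) z) by rewrite le_max lexx.
have le2 z : rho * transition mu (V n) z <= Num.max (put K z) (rho * transition mu (V n) z).
  by rewrite le_max lexx orbT.
rewrite ge_max; apply/andP; split.
  by rewrite (le_trans h1)// lerD// ler_wpM2l.
rewrite (le_trans (ler_wpM2l r0 h2))// mulrDr !(mulrCA rho) lerD// ler_wpM2l//.
Qed.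

Lemma bermudan_log_lipschitz n : log_lipschitz K (V n).
Proof.
have /andP[r0 r1] := rho01.
elim: n => [|n IH]; first exact: put_log_lipschitz.
move=> y a b /=; have h1 := put_log_lipschitz y a b.
have h2 := transition_log_lipschitz (bdmeas_bermudan mu rho01 K0 n) IH y a b.
have {}h2 : `|rho * transition mu (V n) (y * expR a) - rho * transition mu (V n) (y * expR b)|
    <= K * `|a - b|.
  by rewrite -mulrBr normrM (ger0_norm r0) (le_trans _ h2)// ler_piMl.
exact: norm_maxB_le.
Qed.

Lemma bermudan_nondecreasing n m y : (n <= m)%N -> V n y <= V m y.
Proof.
have /andP[r0 r1] := rho01.
suff step k z : V k z <= V k.+1 z.
  elim: m => [|m IH]; first by rewrite leqn0 => /eqP ->.
  by rewrite leq_eqVlt ltnS => /predU1P[->//|/IH h]; exact: le_trans h (step _ _).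
elim: k z => [|k IH] z; first by rewrite /= le_max lexx.
rewrite /= ge_max; apply/andP; split; first by rewrite le_max lexx.
rewrite le_max; apply/orP; right; rewrite ler_wpM2l//.
have bV j := bdmeas_bermudan mu rho01 K0 j.
exact: (transition_le mu (bV k) (bV k.+1)).
Qed.

Lemma put_le_bermudan n y : put K y <= V n y.
Proof. exact: (bermudan_nondecreasing y (leq0n n)). Qed.

End ConvexValue.

Lemma transition_le_nonneg {R : realType} (mu : probability R R) (v v' : R -> R) :
  bdmeas v -> bdmeas v' -> (forall y, 0 <= y -> v y <= v' y) ->
  forall y, 0 <= y -> transition mu v y <= transition mu v' y.
Proof.
move=> bv bv' vv' y y0; apply: expectation_le; [exact: bdmeas_dilation..|].
by move=> z; apply: vv'; rewrite mulr_ge0// expR_ge0.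
Qed.

(** * Averaging over the jump factor *)

Section JumpFactor.
Context {R : realType}.
Variables (pi : probability R R) (c a : R).
Hypothesis pi_exp : (\int[pi]_z (expR z)%:E = (expR (- c))%:E)%E.
Hypothesis pi_max : (\int[pi]_z (Num.max (expR z) 1)%:E <= (expR a)%:E)%E.

Let iexp : pi.-integrable setT (EFin \o expR).
Proof.
apply/integrableP; split; first by apply/measurable_EFinP; exact: measurable_expR.
rewrite (eq_integral (fun z => (expR z)%:E)) ?pi_exp ?ltry// => z _ /=.
by rewrite ger0_norm// expR_ge0.
Qed.

Let max_ge0 (z : R) : 0 <= Num.max (expR z) 1.
Proof. by rewrite le_max ler01 orbT. Qed.

Let imax : pi.-integrable setT (EFin \o (fun z => Num.max (expR z) 1)).
Proof.
apply/integrableP; split.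
  by apply/measurable_EFinP; apply: measurable_maxr => //; exact: measurable_expR.
rewrite (eq_integral (fun z => (Num.max (expR z) 1)%:E)) ?(le_lt_trans pi_max) ?ltry// => z _ /=.
by rewrite ger0_norm.
Qed.

Let Eexp : \int[pi]_z expR z = expR (- c).
Proof. by rewrite /Rintegral pi_exp. Qed.

Let Emax : \int[pi]_z Num.max (expR z) 1 <= expR a.
Proof. by rewrite -lee_fin -expectation_EFin. Qed.

(** Only the moments of [expR z] and of max(e^z, 1) are controlled, so an integrand is first
    majorised by a combination of them. The second moment is known only from above, hence the sign
    condition on [C]. *)
Lemma jump_le (w : R -> R) (A B C : R) : bdmeas w -> 0 <= C ->
  (forall z, w z <= A + B * expR z + C * Num.max (expR z) 1) ->
  \int[pi]_z w z <= A + B * expR (- c) + C * expR a.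
Proof.
move=> bw C0 wle; have iA := bdmeas_integrable pi (bdmeas_cst A).
have iB := integrable_realZ B iexp; have iC := integrable_realZ C imax.
have iAB := integrable_realD iA iB.
apply: (@le_trans _ _ (\int[pi]_z (A + B * expR z + C * Num.max (expR z) 1))).
  apply: le_Rintegral => //; first exact: bdmeas_integrable.
  exact: integrable_realD.
rewrite RintegralD// RintegralD// expectation_cst !RintegralZl// Eexp.
by rewrite lerD2l ler_wpM2l.
Qed.

Lemma jump_ge (w : R -> R) (A B : R) : bdmeas w ->
  (forall z, A + B * expR z <= w z) -> A + B * expR (- c) <= \int[pi]_z w z.
Proof.
move=> bw wge; have iA := bdmeas_integrable pi (bdmeas_cst A).
have iB := integrable_realZ B iexp; have iAB := integrable_realD iA iB.
have -> : A + B * expR (- c) = \int[pi]_z (A + B * expR z).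
  by rewrite RintegralD// expectation_cst RintegralZl// Eexp.
by apply: le_Rintegral => //; exact: bdmeas_integrable.
Qed.

Lemma jump_convex_ge (v : R -> R) u : bdmeas v -> convex_on_nonneg v -> 0 <= u ->
  v u <= \int[pi]_z v (u * expR (c + z)).
Proof.
move=> bv cv; rewrite le_eqVlt => /predU1P[<-|u0].
  rewrite (_ : (fun z => _) = cst (v 0)) ?expectation_cst//.
  by apply/funext => z; rewrite mul0r.
have [s hs] := supporting_line cv u0.
have bw : bdmeas (fun z => v (u * expR (c + z))).
  rewrite (_ : (fun z => _) = (fun z => v (u * expR c * expR z))); last first.
    by apply/funext => z; rewrite expRD mulrA.
  exact: bdmeas_dilation.
have h := jump_ge (A := v u - s * u) (B := s * u * expR c) bw.
have -> : v u = v u - s * u + s * u * expR c * expR (- c).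
  by rewrite -mulrA -expRD subrr expR0 mulr1 subrK.
apply: h => z; rewrite (le_trans _ (hs _ _)) ?mulr_ge0 ?(ltW u0) ?expR_ge0//.
by rewrite expRD le_eqVlt; apply/orP; left; apply/eqP; ring.
Qed.

(** An upward factor can only lower [v]. A downward factor t raises it by at most K (1 - t), by
    convexity between 0 and [u]. Both cases are covered by adding to v u the quantity K (e^|c|
    max(e^z, 1) - e^(c+z)), whose mean is bounded by the two known moments. *)
Lemma jump_convex_le (v : R -> R) (K u : R) : bdmeas v -> convex_on_nonneg v ->
  nonincreasing_fun v -> (forall y, 0 <= v y <= K) -> 0 <= u ->
  \int[pi]_z v (u * expR (c + z)) <= v u + K * (expR (`|c| + a) - 1).
Proof.
move=> bv cv nv vK u0; have K0 : 0 <= K by have /andP[/le_trans h /h] := vK 0.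
have bw : bdmeas (fun z => v (u * expR (c + z))).
  rewrite (_ : (fun z => _) = (fun z => v (u * expR c * expR z))); last first.
    by apply/funext => z; rewrite expRD mulrA.
  exact: bdmeas_dilation.
have h := jump_le (A := v u) (B := - (K * expR c)) (C := K * expR `|c|) bw.
have -> : v u + K * (expR (`|c| + a) - 1) =
    v u + - (K * expR c) * expR (- c) + K * expR `|c| * expR a.
  by rewrite mulNr -!mulrA -!expRD subrr expR0; ring.
apply: h => [|z]; first by rewrite mulr_ge0// expR_ge0.
have cc : expR c <= expR `|c| by rewrite ler_expR ler_norm.
have c1 : 1 <= expR `|c| by rewrite -expR0 ler_expR.
have m1 : expR z <= Num.max (expR z) 1 by rewrite le_max lexx.
have m2 : 1 <= Num.max (expR z) 1 by rewrite le_max lexx orbT.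
have p1 := expR_gt0 z; have p2 := expR_gt0 c.
set M := Num.max _ _ in m1 m2 *; rewrite expRD.
have [e1|/ltW e1] := leP 1 (expR c * expR z).
  have : v (u * (expR c * expR z)) <= v u by apply: nv; rewrite ler_peMr.
  have : expR c * expR z <= expR `|c| * M by rewrite ler_pM// ltW.
  nra.
have e0 : 0 <= expR c * expR z by rewrite mulr_ge0// ltW.
have := cv u 0 (expR c * expR z) u0 (lexx 0); rewrite e0 e1 mulr0 addr0 => /(_ isT).
rewrite (mulrC _ u); have /andP[v1 v2] := vK 0; have /andP[v3 v4] := vK u.
have : 1 <= expR `|c| * M by rewrite -[leLHS]mulr1 ler_pM.
nra.
Qed.

End JumpFactor.

Section LognormalMoments.
Context {R : realType}.
Variables (m sigma h : R).
Hypothesis h0 : 0 < h.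

Let zeta g := expR (m + sigma * g).
Let s0 : Num.sqrt h != 0. Proof. by rewrite gt_eqF// sqrtr_gt0. Qed.
Let G := gauss (Num.sqrt h).

Definition lognormal_moment (j : nat) : R :=
  expR (j%:R * m + j%:R ^+ 2 * (sigma ^+ 2 * h / 2)).

Let zetaE j g : zeta g ^+ j = expR (j%:R * m) * expR (j%:R * sigma * g).
Proof. by rewrite /zeta -expRM_natl -expRD -mulr_natl; congr expR; ring. Qed.

Let izeta j : G.-integrable setT (EFin \o (fun g => zeta g ^+ j)).
Proof.
have -> : (fun g => zeta g ^+ j) = (fun g => expR (j%:R * m) * expR (j%:R * sigma * g)).
  by apply/funext => g; exact: zetaE.
by apply: integrable_realZ; exact: gauss_mgf_integrable.
Qed.

Let Ezeta j : \int[G]_g zeta g ^+ j = lognormal_moment j.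
Proof.
have -> : (fun g => zeta g ^+ j) = (fun g => expR (j%:R * m) * expR (j%:R * sigma * g)).
  by apply/funext => g; exact: zetaE.
rewrite RintegralZl//; last exact: gauss_mgf_integrable.
rewrite gauss_mgf// -expRD sqr_sqrtr ?ltW//; congr expR.
by rewrite exprMn; ring.
Qed.

Lemma lognormal_poly_le (w : R -> R) (n : nat) (A : nat -> R) : bdmeas w ->
  (forall g, w g <= \sum_(j < n) A j * zeta g ^+ j) ->
  \int[G]_g w g <= \sum_(j < n) A j * lognormal_moment j.
Proof.
move=> bw wle.
have [ip ->] : G.-integrable setT (EFin \o (fun g => \sum_(j < n) A j * zeta g ^+ j)) /\
    \sum_(j < n) A j * lognormal_moment j = \int[G]_g \sum_(j < n) A j * zeta g ^+ j.
  elim: n {wle} => [|n [IH1 IH2]].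
    split; last by rewrite big_ord0; under eq_Rintegral do rewrite big_ord0; rewrite expectation_cst.
    under eq_fun do rewrite big_ord0; exact: (bdmeas_integrable _ (bdmeas_cst 0)).
  have iz := integrable_realZ (A n) (izeta n).
  under eq_fun do rewrite big_ord_recr/=.
  split; first exact: integrable_realD.
  have e : A n * \int[G]_g zeta g ^+ n = \int[G]_g (A n * zeta g ^+ n).
    by rewrite RintegralZl//; exact: izeta.
  by rewrite big_ord_recr/= IH2 -Ezeta e RintegralD.
by apply: le_Rintegral => //; exact: bdmeas_integrable.
Qed.

End LognormalMoments.

(** * One step of the Gaussian kernel with jumps *)

Section OneStep.
Context {R : realType}.
Variables (q sigma h c a e : R) (pi : probability R R).
Hypotheses (h0 : 0 < h) (qe : `|q * h| <= e) (sige : sigma ^+ 2 * h <= e) (ce : `|c| <= e).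
Hypotheses (a0 : 0 <= a) (ae : a <= e) (e1 : 20 * e <= 1).
Hypothesis pi_exp : (\int[pi]_z (expR z)%:E = (expR (- c))%:E)%E.
Hypothesis pi_max : (\int[pi]_z (Num.max (expR z) 1)%:E <= (expR a)%:E)%E.

Let G := gauss (Num.sqrt h).
Let m := (q - sigma ^+ 2 / 2) * h + c.
Let zeta g := expR (m + sigma * g).
Let z0 g : 0 < zeta g. Proof. exact: expR_gt0. Qed.
Let E := lognormal_moment m sigma h.

(** The one-step expectation for an approximant of the Lévy factor. The exponent is grouped as in
    [levy_approx], so that the limit of these kernels is the true one-step expectation. *)
Definition mixed (w : R -> R) y :=
  \int[G]_g \int[pi]_z w (y * expR (q * h + (sigma * g + (c - sigma ^+ 2 / 2 * h) + z))).

Definition diffusion_step (w : R -> R) y :=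
  \int[G]_g w (y * expR ((q - sigma ^+ 2 / 2) * h + sigma * g)).

Let E1 : E 1 = expR (q * h + c).
Proof. by congr expR; rewrite /m; field. Qed.

Let E0 : E 0 = 1.
Proof. by rewrite /E /lognormal_moment mul0r expr0n/= mul0r addr0 expR0. Qed.

Let E_approx (j : nat) (k : R) : 0 <= k -> k <= 20 ->
  `|j%:R * m + j%:R ^+ 2 * (sigma ^+ 2 * h / 2)| <= k * e ->
  `|E j - 1 - (j%:R * m + j%:R ^+ 2 * (sigma ^+ 2 * h / 2))| <= 4 * k ^+ 2 * e ^+ 2.
Proof.
move=> k0 k20; set x := (_ + _) => xk.
have e0 : 0 <= e by rewrite (le_trans _ qe).
have ke : k * e <= 1 by rewrite (le_trans (ler_wpM2r e0 k20)).
rewrite (le_trans (norm_expRB_le2 (le_trans xk ke)))// -mulrA -exprMn ler_pM2l//.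
by rewrite -[x ^+ 2]ger0_norm ?sqr_ge0// normrX lerXn2r// nnegrE mulr_ge0.
Qed.

(** The constants are 2 j + j (j - 1) / 2. The terms q h and c contribute at most 2 j e, and the
    correction - sigma^2 h / 2 inside [m] leaves j (j - 1) / 2 times sigma^2 h. *)
Let xbounds : [/\ `|1%:R * m + 1%:R ^+ 2 * (sigma ^+ 2 * h / 2)| <= 2 * e,
  `|2%:R * m + 2%:R ^+ 2 * (sigma ^+ 2 * h / 2)| <= 5 * e,
  `|3%:R * m + 3%:R ^+ 2 * (sigma ^+ 2 * h / 2)| <= 9 * e &
  `|4%:R * m + 4%:R ^+ 2 * (sigma ^+ 2 * h / 2)| <= 14 * e].
Proof.
have se := sige; move: qe ce; rewrite !ler_norml => /andP[q1 q2] /andP[c1 c2].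
have s0 : 0 <= sigma ^+ 2 * h by rewrite mulr_ge0 ?sqr_ge0// ltW.
by rewrite /m; split; apply/andP; split; lra.
Qed.

Let E1_le : `|E 1 - 1| <= 4 * e.
Proof.
have e1' := e1; have [b1 _ _ _] := xbounds; have := @E_approx 1 2 (ler0n _ _) (_ : 2 <= 20) b1.
move=> /(_ _)/ler_normlP[|h1 h2]; first lra.
move: b1 => /ler_normlP[h3 h4]; apply/ler_normlP.
have e0 : 0 <= e by rewrite (le_trans _ qe).
have e2 : 20 * e ^+ 2 <= e by nra.
by split; lra.
Qed.

Let E2_le : E 2 - 2 * E 1 + 1 <= 10 * e.
Proof.
have e1' := e1; have se := sige; have [b1 b2 _ _] := xbounds.
have := @E_approx 1 2 (ler0n _ _) (_ : 2 <= 20) b1.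
have := @E_approx 2 5 (ler0n _ _) (_ : 5 <= 20) b2.
rewrite !ler_norml => /(_ _)/andP[|h1 h2]; first lra.
move=> /(_ _)/andP[|h3 h4]; first lra.
have e0 : 0 <= e by rewrite (le_trans _ qe).
have e2 : 20 * e ^+ 2 <= e by nra.
lra.
Qed.

(** The logarithm of [E j] is quadratic in j, and a fourth difference annihilates polynomials of
    degree at most three. Only the remainders of [E_approx] survive, with total 784 + 1296 + 600 +
    64 = 2744 times e^2. *)
Let E4_le : E 4 - 4 * E 3 + 6 * E 2 - 4 * E 1 + 1 <= 2800 * e ^+ 2.
Proof.
have e1' := e1; have [b1 b2 b3 b4] := xbounds.
have := @E_approx 1 2 (ler0n _ _) (_ : 2 <= 20) b1.
have := @E_approx 2 5 (ler0n _ _) (_ : 5 <= 20) b2.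
have := @E_approx 3 9 (ler0n _ _) (_ : 9 <= 20) b3.
have := @E_approx 4 14 (ler0n _ _) (_ : 14 <= 20) b4.
rewrite !ler_norml => /(_ _)/andP[|h1 h2]; first lra.
move=> /(_ _)/andP[|h3 h4]; first lra.
move=> /(_ _)/andP[|h5 h6]; first lra.
move=> /(_ _)/andP[|h7 h8]; first lra.
have e0 : 0 <= e ^+ 2 by exact: sqr_ge0.
lra.
Qed.

Let argE y g z : y * expR (q * h + (sigma * g + (c - sigma ^+ 2 / 2 * h) + z)) =
  y * zeta g * expR z.
Proof. by rewrite /zeta /m -[RHS]mulrA -expRD; congr (_ * expR _); ring. Qed.

Let argE' y g z : y * expR (q * h + (sigma * g + (c - sigma ^+ 2 / 2 * h) + z)) =
  y * expR ((q - sigma ^+ 2 / 2) * h + sigma * g) * expR (c + z).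
Proof. by rewrite -[RHS]mulrA -expRD; congr (_ * expR _); ring. Qed.

Let binner (w : R -> R) y : bdmeas w -> bdmeas (fun g =>
  \int[pi]_z w (y * expR (q * h + (sigma * g + (c - sigma ^+ 2 / 2 * h) + z)))).
Proof.
move=> bw.
apply: (bdmeas_expectation G pi (f := fun p : R * R =>
  w (y * expR (q * h + (sigma * p.1 + (c - sigma ^+ 2 / 2 * h) + p.2))))).
apply: (bdmeas_comp (g := fun p : R * R =>
  y * expR (q * h + (sigma * p.1 + (c - sigma ^+ 2 / 2 * h) + p.2))) bw).
apply: measurable_funM => //; apply: measurableT_comp => //.
apply: measurable_funD => //; apply: measurable_funD; last exact: measurable_snd.
apply: measurable_funD => //; apply: measurable_funM => //; exact: measurable_fst.
Qed.

Let bouter (w : R -> R) y : bdmeas w ->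
  bdmeas (fun g => w (y * expR ((q - sigma ^+ 2 / 2) * h + sigma * g))).
Proof.
move=> bw; apply: (bdmeas_comp (g := fun g => y * expR ((q - sigma ^+ 2 / 2) * h + sigma * g)) bw).
apply: measurable_funM => //; apply: measurableT_comp => //.
by apply: measurable_funD => //; exact: measurable_funM.
Qed.

Lemma mixed_convex_ge (v : R -> R) y : bdmeas v -> convex_on_nonneg v -> 0 <= y ->
  diffusion_step v y <= mixed v y.
Proof.
move=> bv cv y0; apply: expectation_le; [exact: bouter|exact: binner|move=> g].
under eq_Rintegral do rewrite argE'.
by apply: jump_convex_ge => //; rewrite mulr_ge0// expR_ge0.
Qed.

Lemma mixed_convex_le (v : R -> R) K y : bdmeas v -> convex_on_nonneg v ->
  nonincreasing_fun v -> (forall y, 0 <= v y <= K) -> 0 <= y ->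
  mixed v y <= diffusion_step v y + 8 * K * e.
Proof.
move=> bv cv nv vK y0; have e1' := e1; have ae' := ae; have ce' := ce.
have K0 : 0 <= K by have /andP[/le_trans hK /hK] := vK 0.
rewrite -[X in _ + X](expectation_cst G) -expectationD; [|exact: bouter|exact: bdmeas_cst].
apply: expectation_le; [exact: binner|apply: bdmeasD; [exact: bouter|exact: bdmeas_cst]|move=> g].
under eq_Rintegral do rewrite argE'.
apply: le_trans (jump_convex_le pi_exp pi_max bv cv nv vK _) _.
  by rewrite mulr_ge0// expR_ge0.
have ac : `| `|c| + a| <= 2 * e by rewrite ger0_norm ?addr_ge0//; lra.
have := norm_expRB1_le4 (le_trans ac _); move=> /(_ _)/ler_normlP[|_ h1]; first lra.
have h2 : expR (`|c| + a) - 1 <= 8 * e by lra.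
by have := ler_wpM2l K0 h2; rewrite lerD2l; lra.
Qed.

(** The majorant is the linear function K - x plus a call struck at [b]. From a price at least s/2
    below [b] the call costs only a fourth moment through diffusion, hence O(e^2); upward jumps
    account for the term with [expR a - 1]. *)
Lemma mixed_cap_le (w : R -> R) K b s y : bdmeas w -> 0 < K -> 0 < s -> 0 <= y -> y <= K ->
  y <= b - s / 2 -> (forall x, 0 <= x -> w x <= K - x + Num.max (x - b) 0) ->
  mixed w y <= K - y * expR (q * h) + y * expR (q * h + c) * (expR a - 1)
    + K * (2800 * e ^+ 2) / (s / (2 * K)) ^+ 3.
Proof.
move=> bw K0 s0 y0 yK yb wle; set kap := s / (2 * K); pose k3 := K / kap ^+ 3.
have kap0 : 0 < kap by rewrite divr_gt0// mulr_gt0.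
have k30 : 0 <= k3 by rewrite divr_ge0 ?exprn_ge0// ltW.
have a1 : 0 <= expR a - 1 by rewrite subr_ge0 -expR0 ler_expR.
(* Coefficients, in powers of [zeta], of K + k3 (zeta - 1)^4 - y e^(-c) zeta + y (e^a - 1) zeta. *)
pose A (j : nat) : R := [:: K + k3; - (y * expR (- c)) + y * (expR a - 1) - 4 * k3;
  6 * k3; - (4 * k3); k3]`_j.
have cap u : 0 <= u -> \int[pi]_z w (u * expR z) <=
    K - u * expR (- c) + Num.max (u - b) 0 + u * (expR a - 1).
  move=> u0; have hj := jump_le (A := K + Num.max (u - b) 0 - u) (B := - u) (C := u)
    pi_exp pi_max (bdmeas_dilation u bw) u0.
  apply: le_trans (hj _) _ => [z|]; last by rewrite le_eqVlt; apply/orP; left; apply/eqP; ring.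
  have p0 := expR_ge0 z; have := wle (u * expR z) (mulr_ge0 u0 p0).
  set M := Num.max (expR z) 1; have M1 : 1 <= M by rewrite /M le_max lexx orbT.
  have Mz : expR z <= M by rewrite /M le_max lexx.
  have : Num.max (u * expR z - b) 0 <= Num.max (u - b) 0 + u * (M - 1).
    have h1 : u - b <= Num.max (u - b) 0 by rewrite le_max lexx.
    have h2 : 0 <= Num.max (u - b) 0 by rewrite le_max lexx orbT.
    by rewrite ge_max; apply/andP; split; nra.
  lra.
(* Exceeding [b] from [y] requires y (zeta - 1) >= s/2, hence zeta - 1 >= kap; above that threshold
   a linear function is dominated by the fourth power divided by kap^3. *)
have tail g : Num.max (y * zeta g - b) 0 <= k3 * (zeta g - 1) ^+ 4.
  have p4 : 0 <= k3 * (zeta g - 1) ^+ 4 by rewrite mulr_ge0// exprn_even_ge0.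
  rewrite ge_max p4 andbT; have [|yb'] := leP (y * zeta g - b) 0; first by move/le_trans; apply.
  set t := zeta g - 1; have zt : zeta g = 1 + t by rewrite /t; ring.
  have yt : s / 2 <= y * t by rewrite zt in yb'; nra.
  have t0 : 0 < t by rewrite ltNge; apply/negP => tn; nra.
  have Kt : s / 2 <= K * t by rewrite (le_trans yt)// ler_pM2r.
  have kt : kap <= t.
    by rewrite /kap ler_pdivrMr ?mulr_gt0//; lra.
  have k3t : kap ^+ 3 <= t ^+ 3 by rewrite lerXn2r// nnegrE ltW.
  have : K * t <= k3 * t ^+ 4.
    rewrite /k3 mulrAC ler_pdivlMr ?exprn_gt0// -mulrA ler_pM2l//.
    by rewrite (exprS t 3) ler_pM2l.
  apply: le_trans; rewrite zt.
  have : y * t <= K * t by rewrite ler_pM2r.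
  lra.
have -> : K * (2800 * e ^+ 2) / kap ^+ 3 = k3 * (2800 * e ^+ 2) by rewrite /k3; ring.
apply: (@le_trans _ _ (\sum_(j < 5) A j * E j)); last first.
  rewrite !big_ord_recr big_ord0/= E0 /A/=.
  have := E4_le; have -> : expR (q * h) = expR (- c) * E 1 by rewrite E1 -expRD; congr expR; ring.
  rewrite -E1 => h4; have := ler_wpM2l k30 h4; lra.
apply: lognormal_poly_le => //; first exact: binner.
move=> g; under eq_Rintegral do rewrite argE.
apply: le_trans (cap _ _) _; first by rewrite mulr_ge0// ltW.
have := tail g; rewrite !big_ord_recr big_ord0/= /A/= -/(zeta g) => ht.
rewrite -subr_ge0; have {}ht : 0 <= k3 * (zeta g - 1) ^+ 4 - Num.max (y * zeta g - b) 0 by lra.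
apply: le_trans ht _; rewrite le_eqVlt; apply/orP; left; apply/eqP; ring.
Qed.

(** The diffusion sees [w] only through a parabola touching it at [y], so only the first two
    centered moments of [zeta] enter, both O(e); jumps are charged at slope 4/s and only upward. The
    coefficient of K/s is 16 + 96/5, rounded up to 40. *)
Lemma mixed_quad_le (w : R -> R) K s p y : bdmeas w -> 0 < K -> 0 < s -> 0 <= y -> y <= K ->
  0 <= p -> p <= 4 / s ->
  (forall x z, 0 <= x -> w (x * expR z) <= w x + 4 / s * x * (Num.max (expR z) 1 - 1)) ->
  (forall x, 0 <= x -> w x <= w y + p * (x - y) + 4 / s ^+ 2 * (x - y) ^+ 2) ->
  mixed w y <= w y + e * (40 * K / s + 40 * K ^+ 2 / s ^+ 2).
Proof.
move=> bw K0 s0 y0 yK p0 ps wz wy; have e1' := e1; have ae' := ae; have a0' := a0.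
have a1 : 0 <= expR a - 1 by rewrite subr_ge0 -expR0 ler_expR.
have e0 : 0 <= e by rewrite (le_trans _ qe).
have s40 : 0 < 4 / s by rewrite divr_gt0.
have s42 : 0 < 4 / s ^+ 2 by rewrite divr_gt0// exprn_gt0.
pose k2 := 4 / s ^+ 2 * y ^+ 2.
have k20 : 0 <= k2 by rewrite mulr_ge0 ?sqr_ge0// ltW.
pose A (j : nat) : R := [:: w y - p * y + k2; p * y - 2 * k2 + 4 / s * y * (expR a - 1); k2]`_j.
apply: (@le_trans _ _ (\sum_(j < 3) A j * E j)).
  apply: lognormal_poly_le => //; first exact: binner.
  move=> g; under eq_Rintegral do rewrite argE.
  set u := y * zeta g; have u0 : 0 <= u by rewrite mulr_ge0// ltW.
  have C0 : 0 <= 4 / s * u by rewrite mulr_ge0// ltW.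
  have := jump_le (A := w u - 4 / s * u) (B := 0) (C := 4 / s * u)
    pi_exp pi_max (bdmeas_dilation u bw) C0.
  move=> /(_ _) h1; apply: le_trans (h1 _) _ => [z|]; first by have := wz u z u0; lra.
  have := wy u u0; rewrite !big_ord_recr big_ord0/= /A/= -/(zeta g) /k2 /u.
  set Z := zeta g; lra.
rewrite !big_ord_recr big_ord0/= E0 /A/=.
have ha : expR a - 1 <= 4 * e.
  have a1' : `|a| <= 1 by rewrite ger0_norm//; lra.
  have := norm_expRB1_le4 a1'; rewrite ger0_norm// (ger0_norm a0); lra.
move: E1_le; rewrite ler_norml => /andP[g1 g2]; have g3 := E2_le.
have yk : k2 <= 4 / s ^+ 2 * K ^+ 2 by rewrite ler_pM2l// lerXn2r// nnegrE// ltW.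
have t1 : k2 * (E 2 - 2 * E 1 + 1) <= 4 / s ^+ 2 * K ^+ 2 * (10 * e).
  by rewrite (le_trans (ler_wpM2l k20 g3))// ler_wpM2r//; lra.
have t2 : p * y * (E 1 - 1) <= 4 / s * K * (4 * e).
  have py : 0 <= p * y by exact: mulr_ge0.
  by rewrite (le_trans (ler_wpM2l py g2))// ler_wpM2r ?ler_pM//; lra.
have t3 : 4 / s * y * ((expR a - 1) * E 1) <= 4 / s * K * (4 * e * (6 / 5)).
  have E10 : 0 <= E 1 by exact: expR_ge0.
  have f1 : 4 / s * y <= 4 / s * K by rewrite ler_pM2l.
  have f2 : (expR a - 1) * E 1 <= 4 * e * (6 / 5) by rewrite ler_pM//; lra.
  by apply: ler_pM => //; apply: mulr_ge0 => //; exact: ltW.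
have Ks : 0 <= K / s * e by rewrite mulr_ge0// divr_ge0// ltW.
have -> : e * (40 * K / s + 40 * K ^+ 2 / s ^+ 2) =
   4 / s * K * (4 * e) + 24 * (K / s * e) + 4 / s ^+ 2 * K ^+ 2 * (10 * e).
  by field; rewrite gt_eqF.
have t4 : 4 / s * K * (4 * e * (6 / 5)) = 4 / s * K * (4 * e) + (16 / 5) * (K / s * e) by field; rewrite gt_eqF.
have t5 : 4 / s * K * (4 * e) = 16 * (K / s * e) by ring.
have -> : 0 + (w y - p * y + k2) * 1 +
    (p * y - 2 * k2 + 4 / s * y * (expR a - 1)) * E 1 + k2 * E 2 =
    w y + p * y * (E 1 - 1) + k2 * (E 2 - 2 * E 1 + 1) + 4 / s * y * ((expR a - 1) * E 1) by ring.
rewrite t4 in t3.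
lra.
Qed.

End OneStep.

(** * The quadratic ramp *)

Section Ramp.
Context {R : realType}.
Variables (a s : R).
Hypotheses (a0 : 0 < a) (s0 : 0 < s).

Let b' := a + s / 2.
Let b'0 : 0 < b'. Proof. by rewrite addr_gt0// divr_gt0. Qed.
Let t x := Num.max (b' - put b' x - a) 0.

(* On [0, +oo) this is min(1, ((x - a)_+ / (s / 2))^2); writing the truncation of x at b'
   as b' - (b' - x)_+ makes its log-Lipschitz bound that of the put. *)
Definition ramp x := (2 / s * t x) ^+ 2.

Let tP x : 0 <= x -> [/\ 0 <= t x, t x <= s / 2, t x <= Num.max (x - a) 0,
  x <= b' -> t x = Num.max (x - a) 0 & b' <= x -> t x = s / 2].
Proof.
have a0' := a0; have s0' := s0.
move=> x0; rewrite /t /put (max_l x0) /b'; split.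
- by rewrite le_max lexx orbT.
- by have [?|?] := leP (a + s / 2 - x) 0; rewrite ge_max; apply/andP; split; lra.
- have [?|?] := leP (a + s / 2 - x) 0.
    by have [?|?] := leP (x - a) 0; rewrite ge_max; apply/andP; split; lra.
  have -> : a + s / 2 - (a + s / 2 - x) - a = x - a by ring.
  exact: lexx.
- move=> xb; rewrite (max_l (_ : 0 <= a + s / 2 - x)) ?subr_ge0//; congr Num.max; ring.
- move=> bx; rewrite (max_r (_ : a + s / 2 - x <= 0)) ?subr_le0//.
  by rewrite max_l; lra.
Qed.

Let pos_lip (u v : R) : u <= v ->
  Num.max u 0 <= Num.max v 0 /\ Num.max v 0 <= Num.max u 0 + (v - u).
Proof. by move=> uv; have [?|?] := leP u 0; have [?|?] := leP v 0; split; lra. Qed.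

Let t_lip x y : 0 <= x -> x <= y -> t x <= t y /\ t y <= t x + (y - x).
Proof.
move=> x0 xy; have y0 := le_trans x0 xy; rewrite /t /put (max_l x0) (max_l y0).
have bxy : b' - y <= b' - x by lra.
have [h1 h2] := pos_lip bxy.
set p := Num.max (b' - x) 0 in h1 h2 *; set p' := Num.max (b' - y) 0 in h1 h2 *.
have pp : b' - p - a <= b' - p' - a by lra.
by have [h3 h4] := pos_lip pp; split=> //; lra.
Qed.

Let ss : 0 < 2 / s. Proof. by rewrite divr_gt0. Qed.

Let sq_lip (u v : R) : 0 <= u -> u <= s / 2 -> 0 <= v -> v <= s / 2 ->
  `|(2 / s * u) ^+ 2 - (2 / s * v) ^+ 2| <= 4 / s * `|u - v|.
Proof.
move=> u0 us v0 vs; have s0' := s0.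
have -> : (2 / s * u) ^+ 2 - (2 / s * v) ^+ 2 = 4 / s * (u - v) * ((u + v) / s).
  by field; rewrite gt_eqF.
have uv : 0 <= (u + v) / s <= 1.
  by apply/andP; split; [apply: divr_ge0; lra|rewrite ler_pdivrMr//; lra].
have /andP[uv0 uv1] := uv.
have s4 : 0 < 4 / s by rewrite divr_gt0.
rewrite (normrM (_ * (u - v))) (ger0_norm uv0) (normrM (4 / s)) (gtr0_norm s4).
by rewrite ler_piMr// mulr_ge0// ltW.
Qed.

Lemma ramp_itv x : 0 <= ramp x <= 1.
Proof.
have s0' := s0; rewrite /ramp sqr_ge0/=.
have p0 : 0 <= put b' x by have /andP[] := put_range x (ltW b'0).
have t0 : 0 <= t x by rewrite /t le_max lexx orbT.
have ts : t x <= s / 2 by rewrite /t ge_max; apply/andP; split; rewrite /b'; lra.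
have h1 : 2 / s * t x <= 1 by rewrite mulrAC ler_pdivrMr//; lra.
by rewrite exprn_ile1// mulr_ge0// ltW.
Qed.

Lemma bdmeas_ramp : bdmeas ramp.
Proof.
have [mp _] := bdmeas_nonincreasing (put_nonincreasing b') (fun y => put_range y (ltW b'0)).
apply: bdmeas_itv ramp_itv; rewrite /ramp /t.
apply: measurable_funX; apply: measurable_funM => //; apply: measurable_maxr => //.
by apply: measurable_funB => //; apply: measurable_funB.
Qed.

Lemma ramp_log_lipschitz : log_lipschitz (4 / s * b') ramp.
Proof.
move=> y u v; rewrite /ramp; set x := y * expR u; set x' := y * expR v.
have s0' := s0; have tb z : 0 <= t z <= s / 2.
  have p0 : 0 <= put b' z by have /andP[] := put_range z (ltW b'0).
  by rewrite /t le_max lexx orbT/= ge_max; apply/andP; split; rewrite /b'; lra.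
have /andP[t1 t2] := tb x; have /andP[t3 t4] := tb x'.
rewrite (le_trans (sq_lip t1 t2 t3 t4))// -[leRHS]mulrA ler_wpM2l//; first by rewrite divr_ge0// ltW.
have h := put_log_lipschitz (ltW b'0) y u v; rewrite -/x -/x' in h.
rewrite (le_trans _ h)// distrC; apply: norm_maxB_le; last by rewrite subrr normr0.
by rewrite le_eqVlt; apply/orP; left; apply/eqP; congr `|_|; ring.
Qed.

Lemma ramp_eq0 x : 0 <= x -> x <= a -> ramp x = 0.
Proof.
move=> x0 xa; have [_ _ _ h _] := tP x0; rewrite /ramp h; last first.
  by have s0' := s0; rewrite /b'; lra.
by rewrite max_r ?subr_le0// mulr0 expr0n.
Qed.

Lemma ramp_eq1 x : a + s / 2 <= x -> ramp x = 1.
Proof.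
move=> bx; have [_ _ _ _ h] := tP (le_trans (ltW b'0) bx); rewrite /ramp h//.
by rewrite -(expr1n _ 2); congr (_ ^+ 2); field; rewrite gt_eqF.
Qed.

Lemma ramp_jump_le x z : 0 <= x ->
  ramp (x * expR z) <= ramp x + 4 / s * x * (Num.max (expR z) 1 - 1).
Proof.
move=> x0; set M := Num.max _ _.
have M1 : 1 <= M by rewrite /M le_max lexx orbT.
have zM : expR z <= M by rewrite /M le_max lexx.
have xM : x <= x * M by rewrite ler_peMr.
have [h1 h2] := t_lip x0 xM.
have xz0 : 0 <= x * expR z by rewrite mulr_ge0// expR_ge0.
have [h3 _] := t_lip xz0 (ler_wpM2l x0 zM).
have [t1 t2 _ _ _] := tP x0; have [t3 t4 _ _ _] := tP (le_trans x0 xM).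
have [t5 _ _ _ _] := tP xz0.
have e1 : ramp (x * expR z) <= ramp (x * M).
  rewrite /ramp lerXn2r// ?nnegrE ?(mulr_ge0 (ltW ss))//.
  by rewrite ler_pM2l.
rewrite (le_trans e1)// -lerBlDl.
have := sq_lip t3 t4 t1 t2 => /(le_trans (ler_norm _)) e2; rewrite (le_trans e2)//.
rewrite -[leRHS]mulrA ler_wpM2l//; first by rewrite divr_ge0// ltW.
by rewrite ger0_norm ?subr_ge0//; lra.
Qed.

(** The majorant is the square of 2/s (t y + x - y), and [p] is its slope at [y]. It dominates
    because t x <= x - a <= t y + (x - y) to the right of [a], while the ramp is zero to the
    left. *)
Lemma ramp_quad_le y : 0 <= y -> y <= a + s / 2 -> exists p,
  [/\ 0 <= p, p <= 4 / s & forall x, 0 <= x ->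
    ramp x <= ramp y + p * (x - y) + 4 / s ^+ 2 * (x - y) ^+ 2].
Proof.
move=> y0 yb; have [t1 t2 _ tE _] := tP y0; have {}tE := tE yb.
exists (8 / s ^+ 2 * t y); split.
- by rewrite mulr_ge0// divr_ge0// sqr_ge0.
- have -> : 4 / s = 8 / s ^+ 2 * (s / 2) by field; rewrite gt_eqF.
  by rewrite ler_pM2l// divr_gt0// exprn_gt0.
move=> x x0; have [t3 _ t4 _ _] := tP x0.
have -> : ramp y + 8 / s ^+ 2 * t y * (x - y) + 4 / s ^+ 2 * (x - y) ^+ 2 =
    (2 / s * (t y + (x - y))) ^+ 2.
  by rewrite /ramp; field; rewrite gt_eqF.
rewrite /ramp 2![(2 / s * _) ^+ 2]exprMn ler_wpM2l ?sqr_ge0//.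
have [xa|xa] := leP (x - a) 0.
  have -> : t x = 0 by apply/eqP; rewrite eq_le t3 andbT (le_trans t4)// max_r.
  by rewrite expr0n/= sqr_ge0.
have h1 : t x <= x - a by rewrite (le_trans t4)// max_l// ltW.
have h2 : x - a <= t y + (x - y).
  by have : y - a <= t y; [rewrite tE le_max lexx|lra].
apply: lerXn2r; rewrite ?nnegrE//; lra.
Qed.

End Ramp.

(** Beyond [b], monotonicity and an approach to [b] from the left give v x <= K - b. The result is a
    majorant on all prices, as integration over one step requires. *)
Lemma intrinsic_cap_le {R : realType} (v : R -> R) (K b : R) :
  nonincreasing_fun v -> 0 < b -> (forall y, 0 <= y -> y < b -> v y <= K - y) ->
  forall x, 0 <= x -> v x <= K - x + Num.max (x - b) 0.
Proof.
move=> nv b0 vK x x0; have [xb|bx] := ltP x b.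
  by rewrite (le_trans (vK x x0 xb))// lerDl le_max lexx orbT.
rewrite max_l ?subr_ge0// (_ : K - x + (x - b) = K - b); last by ring.
apply/ler_addgt0Pr => ep ep0; pose y := Num.max 0 (b - ep).
have yb : y < b by rewrite gt_max b0/= gtrBl.
have y0 : 0 <= y by rewrite le_max lexx.
have ye : b - ep <= y by rewrite le_max lexx orbT.
rewrite (le_trans (nv _ _ (ltW (lt_le_trans yb bx))))// (le_trans (vK y y0 yb))//.
lra.
Qed.

Lemma expR_jump_le {R : realType} (c a e : R) : `|c| <= e -> 0 <= a -> a <= e ->
  20 * e <= 1 -> expR c * (expR a - 1) <= a + 9 * e ^+ 2.
Proof.
move=> ce a0 ae e1; have e0 : 0 <= e by exact: le_trans ae.
have c1 : `|c| <= 1 by lra.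
have /ler_normlP[_ hc] := norm_expRB1_le4 c1.
have a1 : `|a| <= 1 by rewrite ger0_norm//; lra.
have /ler_normlP[_ ha] := norm_expRB_le2 a1.
have a2 : a ^+ 2 <= e ^+ 2 by rewrite lerXn2r.
have h3 : 0 <= expR a - 1 by rewrite subr_ge0 -expR0 ler_expR.
apply: (@le_trans _ _ ((1 + 4 * e) * (a + 4 * e ^+ 2))).
  by rewrite ler_pM ?expR_ge0//; lra.
have h4 : e * a <= e ^+ 2 by rewrite expr2 ler_wpM2l.
have h5 : 20 * (e * e ^+ 2) <= e ^+ 2.
  by rewrite mulrA -[leRHS]mul1r ler_wpM2r// sqr_ge0.
have h6 : 0 <= e ^+ 2 by exact: sqr_ge0.
lra.
Qed.

(** The source of [d_plus]. At first order in h, discounting the strike earns r K, whereas dividends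
    cost delta y and upward jumps I y; since y <= K, the net gain is at least K (r - delta - I). *)
Lemma discount_drift_le {R : realType} (r delta I h K y A B : R) :
  0 <= r -> 0 <= delta -> 0 <= I -> 0 <= h -> 0 <= y -> y <= K -> 0 <= A -> 0 <= B ->
  expR (- (r * h)) * (K - y * expR ((r - delta) * h)
    + y * expR ((r - delta) * h) * (h * I + A) + B) <=
  K - y - h * (K * (r - delta - I)) + (r ^+ 2 * K * h ^+ 2 + K * A + B).
Proof.
move=> r0 delta0 I0 h0 y0 yK A0 B0; have K0 := le_trans y0 yK.
set D := expR (- (r * h)); set E := expR ((r - delta) * h).
have De : D * E = expR (- (delta * h)) by rewrite /D /E -expRD; congr expR; ring.
have rh0 : - (r * h) <= 0 by rewrite oppr_le0 mulr_ge0.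
have D1 : D <= 1 by rewrite /D -expR0 ler_expR.
have /andP[_ hd] := expR_le_quad rh0.
have dh0 : 0 <= delta * h by rewrite mulr_ge0.
have hde := expR_ge1Dx (- (delta * h)); rewrite -De in hde.
have hde1 : D * E <= 1 by rewrite De -expR0 ler_expR oppr_le0.
have i0 : 0 <= h * I + A by rewrite addr_ge0// mulr_ge0.
have t1 : D * K <= (1 - r * h + r ^+ 2 * h ^+ 2) * K.
  by rewrite ler_wpM2r//; move: hd; rewrite -/D sqrrN exprMn; lra.
have t2 : D * B <= B by rewrite ler_piMl.
have t3 : y * (1 - delta * h) <= y * (D * E) by rewrite ler_wpM2l.
have t4 : y * (D * E) * (h * I + A) <= y * (h * I + A) by rewrite ler_wpM2r// ler_piMr.
have t5 : y * (delta * h + (h * I + A)) <= K * (delta * h + (h * I + A)).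
  by rewrite ler_wpM2r// addr_ge0.
lra.
Qed.

(** * Comparison of the Bermudan prices *)

Section Comparison.
Context {R : realType}.
Variables (muX muB : R -> probability R R) (K r delta sigma I M : R).
Hypotheses (K0 : 0 < K) (r0 : 0 < r) (delta0 : 0 <= delta) (I0 : 0 <= I).

Let q := r - delta.
Let disc h := expR (- (r * h)).

Hypothesis muB_step : forall h (w : R -> R) y, 0 < h -> bdmeas w ->
  transition (muB h) w y = diffusion_step q sigma h w y.
Hypothesis muX_approx : forall h, 0 < h ->
  exists (pi_ : nat -> probability R R) (c_ : nat -> R),
  [/\ forall k, (\int[pi_ k]_z (expR z)%:E = (expR (- c_ k))%:E)%E,
      forall k, (\int[pi_ k]_z (Num.max (expR z) 1)%:E <= (expR (h * I))%:E)%E,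
      forall k, `|c_ k| <= 2 * (h * M) &
      forall (w : R -> R) B L, bdmeas w -> (forall y, 0 <= w y <= B) -> log_lipschitz L w ->
        forall y, mixed q sigma h (c_ k) (pi_ k) w y @[k --> \oo] --> transition (muX h) w y].

Local Notation VX h := (bermudan (muX h) (disc h) K).
Local Notation VB h := (bermudan (muB h) (disc h) K).

Let disc01 h : 0 < h -> 0 <= disc h <= 1.
Proof. by move=> h0; rewrite /disc expR_ge0 -expR0 ler_expR oppr_le0 mulr_ge0// ltW. Qed.

Lemma diffusion_le_levy h n y : 0 < h -> 0 <= y -> VB h n y <= VX h n y.
Proof.
move=> h0; have d01 := disc01 h0; have /andP[d0 d1] := d01.
have bX k := bdmeas_bermudan (muX h) d01 (ltW K0) k.
have bB k := bdmeas_bermudan (muB h) d01 (ltW K0) k.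
elim: n y => [//|n IH] y y0 /=.
suff : transition (muB h) (VB h n) y <= transition (muX h) (VX h n) y.
  move=> hT; rewrite ge_max; apply/andP; split; rewrite le_max ?lexx//.
  by apply/orP; right; exact: ler_wpM2l.
apply: le_trans (transition_le_nonneg (muX h) (bB n) (bX n) IH y0).
rewrite muB_step//; have [pi_ [c_ [pe _ _ cv]]] := muX_approx h0.
have rB := bermudan_range (muB h) d01 (ltW K0) n.
have lB := bermudan_log_lipschitz (ltW K0) (muB h) d01 n.
have cB := bermudan_convex (ltW K0) (muB h) d01 n.
apply: cvgr_to_ge (cv _ _ _ (bB n) rB lB y) _; apply: nearW => k.
exact: mixed_convex_ge.
Qed.

Variable Lam : R.
Hypotheses (qLam : `|q| <= Lam) (sLam : sigma ^+ 2 <= Lam) (MLam : 2 * M <= Lam)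
  (ILam : I <= Lam) (Lam0 : 0 < Lam).

Let d := r - delta - I.

Section FixedHorizon.
Variables (b s theta : R).
Hypotheses (bK : b <= K) (s0 : 0 < s) (sb : s < b) (theta0 : 0 < theta).
(** The budget condition: the expense of spreading the ramp, for its largest possible height factor
    8 K Lam theta, must not exceed the drift gained by the payoff per unit of time. *)
Hypothesis small : 8 * K * Lam * theta * (Lam * (40 * K / s + 40 * K ^+ 2 / s ^+ 2)) <= K * d.

Let a := b - s.
Let a0 : 0 < a. Proof. by rewrite subr_gt0. Qed.
Let rmp := ramp a s.
(** The extra cost per unit of time of a Lévy step over a diffusion step, as given by
    [mixed_convex_le]. The constant [C1] below collects the second-order errors of discounting, of
    the jump factor and of the fourth-moment tail. *)
Let C := 8 * K * Lam.
Let C1 := r ^+ 2 * K + 9 * K * Lam ^+ 2 + K * (2800 * Lam ^+ 2) / (s / (2 * K)) ^+ 3.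

Let s3 : 0 < (s / (2 * K)) ^+ 3.
Proof. by rewrite exprn_gt0// divr_gt0// mulr_gt0. Qed.

Let K3_ge0 x : 0 <= K * (2800 * x ^+ 2) / (s / (2 * K)) ^+ 3.
Proof. exact: divr_ge0 (mulr_ge0 (ltW K0) (mulr_ge0 (ler0n _ _) (sqr_ge0 _))) (ltW s3). Qed.

Let C10 : 0 <= C1.
Proof.
apply: addr_ge0 (K3_ge0 _); apply: addr_ge0; first exact: mulr_ge0 (sqr_ge0 _) (ltW K0).
exact: mulr_ge0 (mulr_ge0 (ler0n _ _) (ltW K0)) (sqr_ge0 _).
Qed.

Lemma levy_le_diffusion h N k y : 0 < h -> 20 * (h * Lam) <= 1 -> N%:R * h <= theta ->
  (forall k y, (k <= N)%N -> 0 <= y -> y < b -> VB h k y <= K - y) ->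
  (k <= N)%N -> 0 <= y ->
  VX h k y <= VB h k y + C * (k%:R * h) * rmp y + k%:R * (C1 * h ^+ 2).
Proof.
move=> h0 hLam Nh capB; have d01 := disc01 h0; have /andP[D0 D1] := d01.
have bX j := bdmeas_bermudan (muX h) d01 (ltW K0) j.
have bB j := bdmeas_bermudan (muB h) d01 (ltW K0) j.
have [pi_ [c_ [pe pm cM cv]]] := muX_approx h0.
pose e := h * Lam.
have qe : `|q * h| <= e by rewrite normrM (gtr0_norm h0) mulrC ler_pM2l.
have se : sigma ^+ 2 * h <= e by rewrite mulrC ler_pM2l.
have ce j : `|c_ j| <= e by rewrite (le_trans (cM j))// mulrCA ler_pM2l.
have Ie0 : 0 <= h * I by rewrite mulr_ge0// ltW.
have Ie : h * I <= e by rewrite ler_pM2l.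
have e0 : 0 <= e by exact: le_trans Ie.
have C0 : 0 <= C by rewrite !mulr_ge0// ltW.
have rX := @ramp_itv _ a s a0 s0.
elim: k y => [|k IH] y kN y0.
  by rewrite !mul0r mulr0 mul0r !addr0.
have kN' := ltnW kN; have {}IH := IH _ kN'.
have /andP[q0 q1] := rX y; rewrite -/rmp in q0 q1.
have kh0 : 0 <= k%:R * h by rewrite mulr_ge0// ltW.
have kh1 : k%:R * h <= theta.
  by rewrite (le_trans _ Nh)// ler_wpM2r ?ler_nat// ltW.
have hC1 : 0 <= C1 * h ^+ 2 by rewrite mulr_ge0// sqr_ge0.
have kC1 : 0 <= k%:R * (C1 * h ^+ 2) by rewrite mulr_ge0.
have rB := bermudan_range (muB h) d01 (ltW K0) k.
have lB := bermudan_log_lipschitz (ltW K0) (muB h) d01 k.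
have cB := bermudan_convex (ltW K0) (muB h) d01 k.
have nB := bermudan_nonincreasing (muB h) d01 (ltW K0) k.
have br : bdmeas rmp by exact: bdmeas_ramp.
have lr : log_lipschitz (4 / s * (a + s / 2)) rmp by exact: ramp_log_lipschitz.
have cvB := cv _ _ _ (bB k) rB lB y; have cvr := cv _ _ _ br rX lr y.
have TX : transition (muX h) (VX h k) y <= transition (muX h) (VB h k) y +
    C * (k%:R * h) * transition (muX h) rmp y + k%:R * (C1 * h ^+ 2).
  pose w z := VB h k z + C * (k%:R * h) * rmp z + k%:R * (C1 * h ^+ 2).
  have bZ := bdmeasZ (C * (k%:R * h)) br.
  have bw1 : bdmeas (fun z => VB h k z + C * (k%:R * h) * rmp z) by exact: bdmeasD.
  have bw : bdmeas w by apply: bdmeasD => //; exact: bdmeas_cst.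
  apply: le_trans (transition_le_nonneg (muX h) (bX k) bw IH y0) _.
  rewrite /transition /w expectationD; last 2 first.
  - exact: (bdmeas_dilation y bw1).
  - exact: bdmeas_cst.
  rewrite expectation_cst lerD2r expectationD; last 2 first.
  - exact: (bdmeas_dilation y (bB k)).
  - exact: (bdmeas_dilation y bZ).
  by rewrite expectationZ//; exact: bdmeas_dilation.
have putB : put K y <= VB h k.+1 y by apply: put_le_bermudan => //; exact: ltW.
have rest0 : 0 <= C * (k.+1%:R * h) * rmp y + k.+1%:R * (C1 * h ^+ 2).
  by rewrite addr_ge0// mulr_ge0// mulr_ge0// mulr_ge0// ltW.
rewrite [VX h k.+1 y]/= ge_max; apply/andP; split.
  by rewrite -addrA (le_trans putB)// lerDl.
apply: le_trans (ler_wpM2l D0 TX) _.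
rewrite -natr1; have [by'|/ltW yb'] := leP (a + s / 2) y.
- have -> : rmp y = 1 by exact: ramp_eq1.
  have TB : transition (muX h) (VB h k) y <= transition (muB h) (VB h k) y + 8 * K * e.
    rewrite muB_step//; apply: cvgr_to_le cvB _; apply: nearW => j.
    exact: (mixed_convex_le q sigma h (ce j) Ie0 Ie hLam (pe j) (pm j) (bB k) cB nB rB y0).
  have Tr : transition (muX h) rmp y <= 1.
    by have /andP[] := transition_range (muX h) br rX y.
  have hb : disc h * transition (muB h) (VB h k) y <= VB h k.+1 y.
    by rewrite /= le_max lexx orbT.
  have CT : C * (k%:R * h) * transition (muX h) rmp y <= C * (k%:R * h) * 1.
    by rewrite ler_wpM2l// mulr_ge0.
  (* The cost of this step is exactly the growth of C k h times the ramp, which equals one here. *)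
  have eC : 8 * K * e = C * h by rewrite /C /e; ring.
  have t0 : 0 <= 8 * K * e + C * (k%:R * h) * 1 + k%:R * (C1 * h ^+ 2).
    by rewrite !addr_ge0// !mulr_ge0// ltW.
  apply: (@le_trans _ _ (disc h * (transition (muB h) (VB h k) y +
      (8 * K * e + C * (k%:R * h) * 1 + k%:R * (C1 * h ^+ 2))))).
    by rewrite ler_wpM2l//; lra.
  by rewrite mulrDr; have := ler_piMl t0 D1; lra.
- have yK : y <= K.
    by have s0' := s0; have bK' := bK; move: yb'; rewrite /a; lra.
  have yb : y <= b - s / 2 by move: yb'; rewrite /a; lra.
  have capk x : 0 <= x -> VB h k x <= K - x + Num.max (x - b) 0.
    by apply: intrinsic_cap_le nB (lt_trans s0 sb) _ x => z; exact: capB.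
  pose K3 := K * (2800 * e ^+ 2) / (s / (2 * K)) ^+ 3.
  have TB : transition (muX h) (VB h k) y <=
      K - y * expR (q * h) + y * expR (q * h) * (h * I + 9 * e ^+ 2) + K3.
    apply: cvgr_to_le cvB _; apply: nearW => j.
    apply: le_trans (mixed_cap_le h0 qe se (ce j) Ie0 hLam (pe j) (pm j) (bB k) K0 s0 y0 yK yb capk) _.
    rewrite lerD2r lerD2l expRD (mulrA y) -(mulrA (y * expR (q * h))).
    rewrite ler_wpM2l ?mulr_ge0 ?expR_ge0//.
    exact: expR_jump_le.
  have [p [p0 p4 pq]] : exists p, [/\ 0 <= p, p <= 4 / s & forall x, 0 <= x ->
      rmp x <= rmp y + p * (x - y) + 4 / s ^+ 2 * (x - y) ^+ 2] by exact: ramp_quad_le.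
  have rj x z : 0 <= x -> rmp (x * expR z) <= rmp x + 4 / s * x * (Num.max (expR z) 1 - 1).
    exact: ramp_jump_le.
  pose B := 40 * K / s + 40 * K ^+ 2 / s ^+ 2.
  have Tr : transition (muX h) rmp y <= rmp y + e * B.
    apply: cvgr_to_le cvr _; apply: nearW => j.
    exact: (mixed_quad_le h0 qe se (ce j) Ie0 Ie hLam (pe j) (pm j) br K0 s0 y0 yK p0 p4 rj pq).
  have B0 : 0 <= B by rewrite addr_ge0// divr_ge0 ?mulr_ge0 ?sqr_ge0// ltW.
  (* Smoothing the ramp costs at most h K d by the budget condition; the same amount is gained in
     [DB] below, so the two cancel and only second-order terms accumulate. *)
  have CT : C * (k%:R * h) * transition (muX h) rmp y <=
      C * (k%:R * h) * rmp y + h * (K * d).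
    apply: le_trans (ler_wpM2l (mulr_ge0 C0 kh0) Tr) _; rewrite mulrDr lerD2l.
    apply: (@le_trans _ _ (C * theta * (e * B))).
      by rewrite ler_wpM2r ?ler_wpM2l// mulr_ge0.
    have := ler_wpM2l (ltW h0) small; rewrite -/B -/C /e; apply: le_trans.
    by rewrite le_eqVlt; apply/orP; left; apply/eqP; ring.
  have K30 : 0 <= K3 by exact: K3_ge0.
  have DB : disc h * transition (muX h) (VB h k) y <=
      K - y - h * (K * d) + (r ^+ 2 * K * h ^+ 2 + K * (9 * e ^+ 2) + K3).
    apply: le_trans (ler_wpM2l D0 TB) _.
    exact: discount_drift_le (ltW r0) delta0 I0 (ltW h0) y0 yK (mulr_ge0 _ (sqr_ge0 e)) K30.
  have e2 : r ^+ 2 * K * h ^+ 2 + K * (9 * e ^+ 2) + K3 = C1 * h ^+ 2.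
    by rewrite /K3 /C1 /e; field; rewrite !gt_eqF.
  have pK : K - y <= put K y by rewrite putE// le_max lexx.
  rewrite e2 in DB.
  have T0 : 0 <= C * (k%:R * h) * transition (muX h) rmp y + k%:R * (C1 * h ^+ 2).
    have /andP[tr0 _] := transition_range (muX h) br rX y.
    by rewrite addr_ge0// !mulr_ge0// ltW.
  have Cq : 0 <= C * h * rmp y by exact: mulr_ge0 (mulr_ge0 C0 (ltW h0)) q0.
  rewrite -addrA mulrDr; have := ler_piMl T0 D1; lra.
Qed.

(** Summing n + 1 errors of size C1 h^2 gives theta^2 C1 / (n + 1). When the step exceeds [h1] the
    one-step estimates do not apply, and the trivial bound [K] is absorbed by K theta / h1 / (n +
    1); so one [D] serves every n. *)
Theorem bermudan_levy_le : exists D, forall n x,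
  (forall k y, (k <= n.+1)%N -> 0 <= y -> y < b -> VB (theta / n.+1%:R) k y <= K - y) ->
  0 <= x -> x <= b - s -> VX (theta / n.+1%:R) n.+1 x <= K - x + D / n.+1%:R.
Proof.
have s0' := s0; have sb' := sb; have bK' := bK.
pose h1 := (20 * Lam)^-1.
have h10 : 0 < h1 by rewrite invr_gt0 mulr_gt0.
have D10 : 0 <= theta ^+ 2 * C1 by rewrite mulr_ge0// sqr_ge0.
have D20 : 0 <= K * theta / h1 by rewrite divr_ge0 ?mulr_ge0// ltW.
exists (theta ^+ 2 * C1 + K * theta / h1) => n x capB x0 xa.
set h := theta / n.+1%:R; have h0 : 0 < h by rewrite divr_gt0.
have nh : n.+1%:R * h = theta by rewrite /h mulrC divfK// pnatr_eq0.
have [hh|hh] := leP h h1.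
  have hL : 20 * (h * Lam) <= 1.
    have L20 : 0 < 20 * Lam by rewrite mulr_gt0.
    by move: hh; rewrite /h1 -[_^-1]mul1r ler_pdivlMr//; lra.
  have hn : n.+1%:R * h <= theta by rewrite nh.
  have := levy_le_diffusion h0 hL hn capB (leqnn _) x0.
  have -> : rmp x = 0 by exact: ramp_eq0.
  have xb : x < b by lra.
  have := capB n.+1 x (leqnn _) x0 xb; rewrite -/h.
  have -> : n.+1%:R * (C1 * h ^+ 2) = theta ^+ 2 * C1 / n.+1%:R.
    have e (m : R) : m != 0 -> m * (C1 * (theta / m) ^+ 2) = theta ^+ 2 * C1 / m by move=> ?; field.
    by rewrite /h e// pnatr_eq0.
  rewrite mulr0 addr0 mulrDl => h2 h3.
  have : 0 <= K * theta / h1 / n.+1%:R by rewrite divr_ge0.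
  rewrite addrA => h4; rewrite (le_trans h3)// -[leLHS]addr0 lerD// lerD2r.
  exact: h2.
have /andP[_ vK] := bermudan_range (muX h) (disc01 h0) (ltW K0) n.+1 x.
apply: le_trans vK _.
have hD : K <= K * theta / h1 / n.+1%:R.
  have -> : K * theta / h1 / n.+1%:R = K * (h / h1) by rewrite /h; ring.
  by rewrite ler_peMr ?(ltW K0)// ler_pdivlMr// mul1r ltW.
have : 0 <= theta ^+ 2 * C1 / n.+1%:R by rewrite divr_ge0.
rewrite [_ / n.+1%:R in X in _ -> X]mulrDl; move: hD.
set A1 := K * theta / h1 / _; set A2 := theta ^+ 2 * C1 / _ => ? ?.
have : 0 <= K - x by lra.
lra.
Qed.

End FixedHorizon.
End Comparison.

(** * Critical prices *)

Section Filtrations.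
Context {R : realType} {d : measure_display} {Omega : measurableType d}.
Variables (P : probability Omega R) (X : R -> Omega -> R).

Lemma indep_of_comp (Z : Omega -> R) (G : set (set Omega)) (g : R -> R) :
  measurable_fun setT g -> indep_of P Z G -> indep_of P (fun w => g (Z w)) G.
Proof.
move=> mg ZG A C GA mC; apply: (ZG A (g @^-1` C)) => //.
by rewrite -[X in measurable X]setTI; exact: mg.
Qed.

Lemma aug_natural_sigma_algebra s : sigma_algebra setT (aug_natural P X s).
Proof. exact: smallest_sigma_algebra. Qed.

Lemma aug_natural_mono s t : s <= t -> aug_natural P X s `<=` aug_natural P X t.
Proof.
move=> st; apply: smallest_sub; first exact: smallest_sigma_algebra.
move=> A [[u [C [u0 us mC AE]]]|N0]; apply: sub_sigma_algebra; last by right.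
by left; exists u, C; split=> //; exact: le_trans st.
Qed.

Lemma aug_natural_preimage t C : 0 <= t -> measurable C -> aug_natural P X t (X t @^-1` C).
Proof. by move=> t0 mC; apply: sub_sigma_algebra; left; exists t, C; split. Qed.

Hypothesis mX : forall t, 0 <= t -> measurable_fun setT (X t).

Lemma aug_natural_measurable s A : aug_natural P X s A -> measurable A.
Proof.
apply: smallest_sub; first exact: sigma_algebra_measurable.
move=> B [[u [C [u0 us mC ->]]]|[]//].
by rewrite -[_ @^-1` _]setTI; exact: mX.
Qed.

Lemma usual_filtration_sigma_algebra t : sigma_algebra setT (usual_filtration P X t).
Proof.
split=> [s _|A FA s ts|A FA s ts]; have [a0 aD aU] := aug_natural_sigma_algebra s.
- exact: a0.
- by apply: aD; exact: FA.
- by apply: aU => n; exact: FA.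
Qed.

Lemma usual_filtration_mono s t : s <= t ->
  usual_filtration P X s `<=` usual_filtration P X t.
Proof. by move=> st A FA u tu; apply: FA; exact: le_lt_trans tu. Qed.

Lemma aug_natural_sub_usual t : aug_natural P X t `<=` usual_filtration P X t.
Proof. by move=> A GA s ts; exact: aug_natural_mono (ltW ts) _ GA. Qed.

Lemma usual_filtration_measurable t A : usual_filtration P X t A -> measurable A.
Proof. by move=> FA; apply: (@aug_natural_measurable (t + 1)); apply: FA; rewrite ltrDl. Qed.

(** The event is a countable union of events tau <= v with v < u, each known in the augmented
    filtration at time u by right continuity. Negative v are discarded, since the stopping condition
    concerns nonnegative times. *)
Lemma stopping_time_lt theta tau u : stopping_time (usual_filtration P X) theta tau ->
  0 < u -> aug_natural P X u [set w | tau w < u].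
Proof.
move=> [tau_itv tauF] u0; have [a0 _ aU] := aug_natural_sigma_algebra u.
rewrite (_ : [set w | _] =
    \bigcup_n (if 0 <= u - n.+1%:R^-1 then [set w | tau w <= u - n.+1%:R^-1] else set0)).
  apply: aU => n; case: ifP => // un; apply: (tauF _ un).
  by rewrite ltrBlDr ltrDl.
apply/seteqP; split=> w /=.
  move=> tu; have ut : 0 < u - tau w by rewrite subr_gt0.
  pose n := Num.trunc (u - tau w)^-1.
  have hn : n.+1%:R^-1 < u - tau w by rewrite invf_plt ?posrE//; exact: truncnS_gt.
  have tn : tau w <= u - n.+1%:R^-1 by rewrite lerBrDr -lerBrDl ltW.
  have /andP[t0 _] : 0 <= tau w <= theta by have [-> ->] := tau_itv w.
  by exists n => //; rewrite (le_trans t0 tn).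
by move=> [n _]; case: ifP => // _ /= /le_lt_trans; apply; rewrite ltrBlDr ltrDl.
Qed.

End Filtrations.

(** At the strike immediate exercise pays nothing, but one diffusion step has positive value. This
    places [K] in the continuation region, so that critical prices are infima of nonempty sets. *)
Lemma diffusion_put_gt0 {R : realType} (q sigma h K : R) :
  0 < sigma -> 0 < h -> 0 < K -> 0 < diffusion_step q sigma h (put K) K.
Proof.
move=> s0 h0 K0; pose m := (q - sigma ^+ 2 / 2) * h; pose G := gauss (Num.sqrt h).
pose f g := put K (K * expR (m + sigma * g)).
have bput : bdmeas (put K).
  exact: (bdmeas_nonincreasing (put_nonincreasing K) (fun y => put_range y (ltW K0))).
have bf : bdmeas f.
  apply: (bdmeas_comp (g := fun g => K * expR (m + sigma * g)) bput).
  apply: measurable_funM => //; apply: measurableT_comp => //.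
  by apply: measurable_funD => //; exact: measurable_funM.
have f0 g : 0 <= f g by have /andP[] := put_range (K * expR (m + sigma * g)) (ltW K0).
rewrite lt_neqAle; apply/andP; split; last by apply: Rintegral_ge0 => g _; exact: f0.
apply/eqP => I0.
have iI : (\int[G]_g `|(f g)%:E| = 0)%E.
  under eq_integral do rewrite gee0_abs ?lee_fin//.
  rewrite expectation_EFin; last exact: bdmeas_integrable.
  by rewrite -[X in _ = X%:E]/(0 : R) [in RHS]I0.
(* If the put were almost surely worthless, every negative moment of the lognormal factor
   would be at most 1; high enough ones are larger. *)
have mE : measurable_fun setT (EFin \o f) by apply/measurable_EFinP; case: bf.
have [/(_ iI) fae _] := ae_eq_integral_abs G measurableT mE.
(* Chosen so that a sigma h / 2 = |m| + 1 exceeds m, which is what contradicts the bound on the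
   moment of order - a. *)
pose a := 2 * (`|m| + 1) / (sigma * h).
have sq0 : Num.sqrt h != 0 by rewrite gt_eqF// sqrtr_gt0.
have a0 : 0 <= a by rewrite divr_ge0 ?mulr_ge0 ?addr_ge0// ltW.
have ig := gauss_mgf_integrable (- a) sq0.
have le1 : \int[G]_g expR (- a * g) <= expR (a * m / sigma).
  rewrite -lee_fin -expectation_EFin//.
  apply: (@le_trans _ _ (\int[G]_g (cst (expR (a * m / sigma)) g)%:E)%E).
    apply: ae_ge0_le_integral => //.
    - by case/integrableP: ig.
    - by move=> g _; rewrite lee_fin expR_ge0.
    - by apply/measurable_EFinP; exact: measurable_cst.
    have [N [mN N0 hN]] := fae; exists N; split=> // g ng; apply: hN => fg; apply: ng => _.
    rewrite lee_fin ler_expR.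
    have /= := fg Logic.I => -[]; rewrite /f /put; set x := m + sigma * g.
    have x0 : 0 <= K * expR x by rewrite mulr_ge0 ?expR_ge0// ltW.
    rewrite (max_l x0) => /eqP; rewrite -subr_eq0 subr0 => /eqP fx.
    have : K - K * expR x <= 0 by rewrite -fx le_max lexx.
    rewrite subr_le0 => Kx; have {Kx} : 0 <= x.
      by rewrite -ler_expR expR0 -(ler_pM2l K0) mulr1.
    rewrite /x => xg; rewrite ler_pdivlMr// -subr_ge0.
    rewrite (_ : _ - _ = a * (m + sigma * g)); last by ring.
    exact: mulr_ge0.
  by rewrite expectation_EFin ?expectation_cst//; exact: bdmeas_integrable (bdmeas_cst _).
move: le1; rewrite gauss_mgf// ler_expR (sqr_sqrtr (ltW h0)) leNgt => /negP; apply.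
rewrite ltr_pdivrMr// sqrrN.
have am : a * (sigma * h) = 2 * (`|m| + 1) by rewrite /a divfK// mulf_neq0// gt_eqF.
have a1 : 0 < a by rewrite divr_gt0 ?mulr_gt0// ltr_wpDl.
have -> : a ^+ 2 * h / 2 * sigma = a * (a * (sigma * h) / 2) by ring.
by rewrite am ltr_pM2l// mulrAC divff ?pnatr_eq0// mul1r (le_lt_trans (ler_norm m))// ltrDl.
Qed.

(** A single rate dominating each of the drift, the variance and the two jump rates; the final 1
    makes it positive. *)
Definition comparison_rate {R : realType} (sigma : R) (nu : {measure set R -> \bar R})
    (r delta : R) : R :=
  `|r - delta| + sigma ^+ 2 + 2 * (\int[nu]_x `|expR x - 1|)
    + \int[nu]_x Num.max (expR x - 1) 0 + 1.

(** The second summand is the value that makes the budget condition hold for s = L sqrt theta; the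
    first one ensures L >= 1, which lets 1/L^2 be replaced by 1/L. *)
Definition comparison_constant {R : realType} (sigma : R) (nu : {measure set R -> \bar R})
    (K r delta : R) : R :=
  1 + 8 * comparison_rate sigma nu r delta ^+ 2 * (40 * K + 40 * K ^+ 2) / d_plus nu r delta.

Section Assembly.
Context {R : realType} {d : measure_display} {Omega : measurableType d}.
Variables (P : probability Omega R) (X B : R -> Omega -> R).
Variables (sigma gamma : R) (nu : {measure set R -> \bar R}) (K r delta : R).
Hypotheses (cP : complete_prob P) (K0 : 0 < K) (r0 : 0 < r) (delta0 : 0 <= delta).
Hypothesis XL : Levy_process P X sigma gamma nu.
Hypothesis BM : Brownian_motion P (usual_filtration P X) B.
Hypothesis nu_exp : (\int[nu]_(x in [set x : R | 1 <= `|x|]%R) (expR x)%:E < +oo)%E.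
Hypothesis martingale : ((sigma ^+ 2 / 2 + gamma)%:E
  + \int[nu]_x (expR x - 1 - (if `|x| <= 1 then x else 0)%R)%:E = 0)%E.
Hypothesis sigma0 : 0 < sigma.
Hypothesis nu_fv : (\int[nu]_(x in [set x : R | `|x| <= 1]%R) (`|x|%R)%:E < +oo)%E.

Let q := r - delta.
Let F := usual_filtration P X.
(** The Lévy price is analysed with this filtration, for which independence of the increments has
    been proved; the Black-Scholes price with [F], for which it belongs to the notion of Brownian
    motion. Stopping times of [F] meet [A] through events of the form tau < u. *)
Let A := aug_natural P X.
Let disc h := expR (- (r * h)).

Let mX t : 0 <= t -> measurable_fun setT (X t).
Proof. by have [[h _] _ _ _ _] := XL; exact: h. Qed.

Let mB t : 0 <= t -> measurable_fun setT (B t).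
Proof. by have [h _ _ _ _] := BM; exact: h. Qed.

(** The absolute value makes the law a total function of the step, since [X] is known to be
    measurable only at nonnegative times. *)
Let mZX h : measurable_fun setT (fun w => q * h + X `|h| w).
Proof. by apply: measurable_funD => //; exact: mX. Qed.

Let muX h : probability R R := law P (mZX h).

Let mZB h : measurable_fun setT (fun g => (q - sigma ^+ 2 / 2) * h + sigma * g).
Proof. by apply: measurable_funD => //; exact: measurable_funM. Qed.

Let muB h : probability R R := law (gauss (Num.sqrt h)) (mZB h).

Let ZX t w := q * t + X t w.
Let ZB t w := (q - sigma ^+ 2 / 2) * t + sigma * B t w.

Let preim_meas (g : R -> R) C : measurable_fun setT g -> measurable C -> measurable (g @^-1` C).
Proof. by move=> mg mC; rewrite -[X in measurable X]setTI; exact: mg. Qed.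

Let mshift (c : R) : measurable_fun setT (fun z : R => c + z).
Proof. exact: measurable_funD. Qed.

Let maff (c e : R) : measurable_fun setT (fun z : R => c + e * z).
Proof. by apply: measurable_funD => //; exact: measurable_funM. Qed.

Let ZXG t : 0 <= t -> forall C, measurable C -> A t (ZX t @^-1` C).
Proof.
move=> t0 C mC; exact: (@aug_natural_preimage _ _ _ P X t _ t0 (preim_meas (mshift (q * t)) mC)).
Qed.

Let ZXI h s : 0 < h -> 0 <= s -> indep_of P (fun w => ZX (s + h) w - ZX s w) (A s).
Proof.
move=> h0 s0; have [[_ X0] iX _ _ _] := XL.
have := indep_of_comp (mshift (q * h)) (levy_indep mX X0 iX s0 h0).
by congr indep_of; apply/funext => w; rewrite /ZX; ring.
Qed.

Let ZXmu h s : 0 < h -> 0 <= s -> forall C, measurable C ->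
  P ((fun w => ZX (s + h) w - ZX s w) @^-1` C) = muX h C.
Proof.
move=> h0 s0 C mC; have [_ _ sX _ _] := XL.
have -> : (fun w => ZX (s + h) w - ZX s w) = (fun w => q * h + (X (s + h) w - X s w)).
  by apply/funext => w; rewrite /ZX; ring.
apply: etrans (sX s h s0 (ltW h0) _ (preim_meas (mshift (q * h)) mC)) _.
change (P (X h @^-1` [set z | C (q * h + z)]) = P (X `|h| @^-1` [set z | C (q * h + z)])).
by rewrite gtr0_norm.
Qed.

Let ZX0 : \forall w \ae P, ZX 0 w = 0.
Proof.
have [[_ X0] _ _ _ _] := XL.
by apply: filterS X0 => w Xw; rewrite /ZX mulr0 add0r.
Qed.

Let ZXrc : \forall w \ae P, forall t, 0 <= t -> ZX s w @[s --> t^'+] --> ZX t w.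
Proof.
have [_ _ _ cX _] := XL; apply: filterS cX => w [cw _] t t0.
apply: cvgD; last exact: cw.
by apply: cvg_at_right_filter; apply: cvgM; [exact: cvg_cst|exact: cvg_id].
Qed.

Let ZBG t : 0 <= t -> forall C, measurable C -> F t (ZB t @^-1` C).
Proof.
move=> t0 C mC; have [_ BF _ _ _] := BM.
exact: (BF t t0 _ (preim_meas (maff ((q - sigma ^+ 2 / 2) * t) sigma) mC)).
Qed.

Let ZBI h s : 0 < h -> 0 <= s -> indep_of P (fun w => ZB (s + h) w - ZB s w) (F s).
Proof.
move=> h0 s0; have [_ _ _ _ /(_ s (s + h) s0)[|iB _]] := BM; first by rewrite ltrDl.
have := indep_of_comp (maff ((q - sigma ^+ 2 / 2) * h) sigma) iB.
by congr indep_of; apply/funext => w; rewrite /ZB; ring.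
Qed.

Let ZBmu h s : 0 < h -> 0 <= s -> forall C, measurable C ->
  P ((fun w => ZB (s + h) w - ZB s w) @^-1` C) = muB h C.
Proof.
move=> h0 s0 C mC; have [_ _ _ _ /(_ s (s + h) s0)[|_ lB]] := BM; first by rewrite ltrDl.
have -> : (fun w => ZB (s + h) w - ZB s w) =
    (fun w => (q - sigma ^+ 2 / 2) * h + sigma * (B (s + h) w - B s w)).
  by apply/funext => w; rewrite /ZB; ring.
apply: etrans (lB _ (preim_meas (maff ((q - sigma ^+ 2 / 2) * h) sigma) mC)) _.
by rewrite addrC addKr.
Qed.

Let ZB0 : \forall w \ae P, ZB 0 w = 0.
Proof.
have [_ _ B0 _ _] := BM.
by apply: filterS B0 => w Bw; rewrite /ZB Bw !mulr0 add0r.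
Qed.

Let ZBrc : \forall w \ae P, forall t, 0 <= t -> ZB s w @[s --> t^'+] --> ZB t w.
Proof.
have [_ _ _ cB _] := BM; apply: filterS cB => w cw t t0.
apply: cvg_at_right_filter; apply: cvgD; first by apply: cvgM; [exact: cvg_cst|exact: cvg_id].
by apply: cvgM; [exact: cvg_cst|exact: cw].
Qed.

Let I := \int[nu]_x Num.max (expR x - 1) 0.
Let M := \int[nu]_x `|expR x - 1|.

Let muB_step h (w : R -> R) y : 0 < h -> bdmeas w ->
  transition (muB h) w y = diffusion_step q sigma h w y.
Proof.
move=> h0 bw; have bd := bdmeas_dilation y bw.
by rewrite /transition expectation_law//; [case: bd|exact: bdmeas_integrable (bdmeas_comp bd (mZB h))].
Qed.

Let muX_approx h : 0 < h ->
  exists (pi_ : nat -> probability R R) (c_ : nat -> R),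
  [/\ forall k, (\int[pi_ k]_z (expR z)%:E = (expR (- c_ k))%:E)%E,
      forall k, (\int[pi_ k]_z (Num.max (expR z) 1)%:E <= (expR (h * I))%:E)%E,
      forall k, `|c_ k| <= 2 * (h * M) &
      forall (w : R -> R) B L, bdmeas w -> (forall y, 0 <= w y <= B) -> log_lipschitz L w ->
        forall y, mixed q sigma h (c_ k) (pi_ k) w y @[k --> \oo] --> transition (muX h) w y].
Proof.
move=> h0; have [_ _ _ _ [[_ nu2] psi]] := XL.
have lawX (f : R -> R) : bdmeas f -> \int[law P (mX (ltW h0))]_x f x = \int[P]_w f (X h w).
  move=> bf; have [mf _] := bf; rewrite expectation_law//.
  exact: bdmeas_integrable (bdmeas_comp bf (mX (ltW h0))).
have [e1 e2] : (forall u, \int[law P (mX (ltW h0))]_x cos (u * x) =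
      expR (h * psi_re sigma nu u) * cos (h * psi_im gamma nu u)) /\
    (forall u, \int[law P (mX (ltW h0))]_x sin (u * x) =
      expR (h * psi_re sigma nu u) * sin (h * psi_im gamma nu u)).
  split=> u; have [p1 p2] := psi h u (ltW h0).
    have bc := @bdmeas_cos R u 0; have {}bc : bdmeas (fun x : R => cos (u * x)).
      by move: bc; congr bdmeas; apply/funext => x; rewrite addr0.
    by rewrite lawX// /Rintegral p1.
  have bc := @bdmeas_sin R u 0; have {}bc : bdmeas (fun x : R => sin (u * x)).
    by move: bc; congr bdmeas; apply/funext => x; rewrite addr0.
  by rewrite lawX// /Rintegral p2.
have [pi_ [c_ [a1 a2 a3 a4]]] := levy_approx nu2 nu_exp nu_fv h0 martingale e1 e2.
exists pi_, c_; split=> // w C L bw wC wL y.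
pose f x := w (y * expR (q * h + x)).
have bf : bdmeas f.
  apply: (bdmeas_comp (g := fun x => y * expR (q * h + x)) bw).
  apply: measurable_funM => //; apply: measurableT_comp => //; exact: mshift.
have -> : transition (muX h) w y = \int[law P (mX (ltW h0))]_x f x.
  rewrite lawX//; have bd := bdmeas_dilation y bw; rewrite /transition expectation_law//.
  - by congr Rintegral; apply/funext => z; rewrite /f gtr0_norm.
  - by case: bd.
  - exact: bdmeas_integrable (bdmeas_comp bd (mZX h)).
apply: (a4 f C L) => [|x|x z]; [by case: bf|exact: wC|].
by rewrite (le_trans (wL _ _ _))// (_ : _ - _ = x - z)//; ring.
Qed.

Let aug_measurable t : 0 <= t -> forall C, A t C -> measurable C.
Proof. by move=> _ C; exact: aug_natural_measurable. Qed.

Let usual_measurable t : 0 <= t -> forall C, F t C -> measurable C.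
Proof. by move=> _ C; exact: usual_filtration_measurable. Qed.

Let aug_sigma t : 0 <= t -> sigma_algebra setT (A t).
Proof. by move=> _; exact: aug_natural_sigma_algebra. Qed.

Let usual_sigma t : 0 <= t -> sigma_algebra setT (F t).
Proof. by move=> _; exact: usual_filtration_sigma_algebra. Qed.

Let aug_mono s t : 0 <= s -> s <= t -> A s `<=` A t.
Proof. by move=> _; exact: aug_natural_mono. Qed.

Let usual_mono s t : 0 <= s -> s <= t -> F s `<=` F t.
Proof. by move=> _; exact: usual_filtration_mono. Qed.

Let priceX theta x := amer_put P F (fun t w => x * expR (ZX t w)) r K theta.
Let priceB theta x := amer_put P F (fun t w => x * expR (ZB t w)) r K theta.
Let VX h := bermudan (muX h) (disc h) K.
Let VB h := bermudan (muB h) (disc h) K.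

Let VX_le theta n x : 0 < theta -> 0 <= x ->
  ((VX (theta / n.+1%:R) n.+1 x)%:E <= priceX theta x)%E.
Proof.
move=> theta0 x0; have h0 : 0 < theta / n.+1%:R by rewrite divr_gt0.
have := bermudan_le_amer_put aug_sigma aug_measurable aug_mono ZXG ZXI ZXmu ZX0 x0 r0 (ltW K0)
  n.+1 h0 (fun t _ => @aug_natural_sub_usual _ _ _ P X t).
by rewrite (mulrC n.+1%:R) divfK ?pnatr_eq0.
Qed.

Let VB_le theta n x : 0 < theta -> 0 <= x ->
  ((VB (theta / n.+1%:R) n.+1 x)%:E <= priceB theta x)%E.
Proof.
move=> theta0 x0; have h0 : 0 < theta / n.+1%:R by rewrite divr_gt0.
have := bermudan_le_amer_put usual_sigma usual_measurable usual_mono ZBG ZBI ZBmu ZB0 x0 r0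
  (ltW K0) n.+1 h0 (fun t _ => @subset_refl _ (F t)).
by rewrite (mulrC n.+1%:R) divfK ?pnatr_eq0.
Qed.

Let priceX_le theta x c D : 0 < theta -> 0 <= x ->
  (forall n, VX (theta / n.+1%:R) n.+1 x <= c + D / n.+1%:R) -> (priceX theta x <= c%:E)%E.
Proof.
move=> theta0 x0 Vc; apply: ge_ereal_sup => _ [tau tauF <-].
apply: (amer_payoff_le aug_sigma aug_measurable ZXG ZXI ZXmu ZX0 x0 r0 (ltW K0) cP theta0
  ZXrc _ _ Vc).
  by move=> w; have [/(_ w)[-> ->] _] := tauF.
by move=> u u0; exact: stopping_time_lt tauF u0.
Qed.

Let priceB_le theta x c D : 0 < theta -> 0 <= x ->
  (forall n, VB (theta / n.+1%:R) n.+1 x <= c + D / n.+1%:R) -> (priceB theta x <= c%:E)%E.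
Proof.
move=> theta0 x0 Vc; apply: ge_ereal_sup => _ [tau tauF <-].
apply: (amer_payoff_le usual_sigma usual_measurable ZBG ZBI ZBmu ZB0 x0 r0 (ltW K0) cP theta0
  ZBrc _ _ Vc).
  by move=> w; have [/(_ w)[-> ->] _] := tauF.
by move=> u u0; apply: aug_natural_sub_usual; exact: stopping_time_lt tauF u0.
Qed.

Let disc01 h : 0 < h -> 0 <= disc h <= 1.
Proof. by move=> h0; rewrite /disc expR_ge0 -expR0 ler_expR oppr_le0 mulr_ge0// ltW. Qed.

(** The comparison passes through Bermudan prices. The bounds by 0 and [K] make the Lévy price
    finite, so that it can serve as the real constant in [priceB_le]. *)
Let priceB_le_priceX theta x : 0 < theta -> 0 <= x -> (priceB theta x <= priceX theta x)%E.
Proof.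
move=> theta0 x0; have hn n : 0 < theta / n.+1%:R by rewrite divr_gt0.
have pK : (priceX theta x <= K%:E)%E.
  apply: (priceX_le (D := 0)) => // n; rewrite mul0r addr0.
  by have /andP[] := bermudan_range (muX (theta / n.+1%:R)) (disc01 (hn n)) (ltW K0) n.+1 x.
have p0 : (0%:E <= priceX theta x)%E.
  apply: le_trans (VX_le 0 theta0 x0); rewrite lee_fin.
  by have /andP[] := bermudan_range (muX (theta / 1)) (disc01 (hn 0%N)) (ltW K0) 1 x.
have pf : priceX theta x \is a fin_num.
  by rewrite fin_numE; apply/andP; split; apply/eqP => pE; rewrite pE in pK p0.
rewrite -(fineK pf); apply: (priceB_le (D := 0)) => // n; rewrite mul0r addr0.
rewrite -lee_fin fineK//; apply: le_trans (VX_le n theta0 x0); rewrite lee_fin.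
exact: (diffusion_le_levy K0 r0 muB_step muX_approx).
Qed.

Let priceB_gt theta : 0 < theta -> ((put K K)%:E < priceB theta K)%E.
Proof.
move=> theta0; apply: lt_le_trans (VB_le 0 theta0 (ltW K0)).
have h0 : 0 < theta / 1 by rewrite divr_gt0.
rewrite lte_fin [VB _ _ _]/= lt_max; apply/orP; right.
rewrite {1}/put (max_l (ltW K0)) subrr maxxx mulr_gt0 ?expR_gt0//.
rewrite muB_step//; first exact: diffusion_put_gt0.
(* With zero steps the Bermudan value is the put itself, so law and discount are arbitrary here. *)
exact: (bdmeas_bermudan (muB 1) (disc01 ltr01) (ltW K0) 0).
Qed.

Hypothesis d0 : 0 < d_plus nu r delta.

Let region theta := [set x : R | 0 <= x /\ ((Num.max (K - x) 0)%:E < priceX theta x)%E].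
Let regionB theta := [set x : R | 0 <= x /\ ((Num.max (K - x) 0)%:E < priceB theta x)%E].

Let KB theta : 0 < theta -> regionB theta K.
Proof.
move=> theta0; split; first exact: ltW.
by have := priceB_gt theta0; rewrite putE// ltW.
Qed.

Let regionB_sub theta : 0 < theta -> regionB theta `<=` region theta.
Proof.
move=> theta0 x [x0 xB].
exact: (conj x0 (lt_le_trans xB (priceB_le_priceX theta0 x0))).
Qed.

Let Lam := comparison_rate sigma nu r delta.
Let D0 := d_plus nu r delta.
Let L := comparison_constant sigma nu K r delta.

Let I0 : 0 <= I.
Proof. by apply: Rintegral_ge0 => x _; rewrite le_max lexx orbT. Qed.

Let M0 : 0 <= M. Proof. by apply: Rintegral_ge0 => x _. Qed.

Let Lam0 : 0 < Lam.
Proof. by rewrite /Lam /comparison_rate ltr_wpDl// !addr_ge0// ?sqr_ge0// mulr_ge0. Qed.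

Let L1 : 1 <= L.
Proof.
rewrite /L /comparison_constant lerDl divr_ge0 ?(ltW d0)//.
exact: mulr_ge0 (mulr_ge0 (ler0n _ _) (sqr_ge0 _)) (addr_ge0
  (mulr_ge0 (ler0n _ _) (ltW K0)) (mulr_ge0 (ler0n _ _) (sqr_ge0 _))).
Qed.

Lemma critical_price_comparison theta : 0 < theta -> theta < 1 ->
  0 <= critical_price (priceB theta) K - critical_price (priceX theta) K /\
  critical_price (priceB theta) K - critical_price (priceX theta) K <= L * Num.sqrt theta.
Proof.
move=> theta0 theta1; pose b := inf (regionB theta); pose bX := inf (region theta).
change (0 <= b - bX /\ b - bX <= L * Num.sqrt theta).
have KBt := KB theta0; have KX := regionB_sub theta0 KBt.
have lB : has_lbound (regionB theta) by exists 0 => x [].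
have lX : has_lbound (region theta) by exists 0 => x [].
have bX0 : 0 <= bX by apply: lb_le_inf => [|x []//]; exists K.
have bK : b <= K by exact: ge_inf.
have bXb : bX <= b.
  apply: lb_le_inf => [|x xB]; first by exists K.
  exact: (ge_inf lX (regionB_sub theta0 xB)).
have hB y : y < b -> 0 <= y -> (priceB theta y <= (K - y)%:E)%E.
  move=> yb y0; rewrite leNgt; apply/negP => yB.
  have yK : 0 <= K - y by rewrite subr_ge0 (le_trans (ltW yb)).
  have yR : regionB theta y by split; [exact: y0|rewrite (max_l yK)].
  by have := ge_inf lB yR; rewrite leNgt yb.
have hX l : (forall x, 0 <= x -> x < l -> (priceX theta x <= (Num.max (K - x) 0)%:E)%E) -> l <= bX.
  move=> lle; apply: lb_le_inf; first by exists K.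
  move=> x [x0 xX]; rewrite leNgt; apply/negP => xl.
  by have := lle x x0 xl; rewrite leNgt xX.
clearbody b bX; clear lB lX KBt KX.
split; first by rewrite subr_ge0.
set s := L * Num.sqrt theta.
have st0 : 0 < Num.sqrt theta by rewrite sqrtr_gt0.
have L0 : 0 < L by exact: lt_le_trans L1.
have s0 : 0 < s by rewrite mulr_gt0.
(* If b <= s the bound holds because critical prices are nonnegative; otherwise the ramp starts at
   the positive price b - s. *)
have [bs|sb] := leP b s; first by rewrite lerBlDr (le_trans bs)// lerDl.
rewrite lerBlDr -lerBlDl; apply: hX => x x0 xb.
have small : 8 * K * Lam * theta * (Lam * (40 * K / s + 40 * K ^+ 2 / s ^+ 2)) <=
    K * (r - delta - I).
  have sq1 : Num.sqrt theta <= 1 by rewrite -sqrtr1 ler_wsqrtr// ltW.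
  have tE : theta = Num.sqrt theta ^+ 2 by rewrite sqr_sqrtr// ltW.
  (* Here theta / s = sqrt theta / L and theta / s^2 = 1 / L^2; both are at most 1 / L because theta
     < 1 and L >= 1. *)
  have t1 : theta / s <= L^-1.
    rewrite {1}tE /s invfM mulrCA expr2 -mulrA divff ?gt_eqF// mulr1.
    by rewrite ler_piMr// invr_ge0 ltW.
  have t2 : theta / s ^+ 2 <= L^-1.
    rewrite {1}tE /s exprMn invfM mulrCA divff ?expf_neq0 ?gt_eqF// mulr1 expr2 invfM.
    by rewrite ler_piMr ?invr_ge0 ?(ltW L0)// invf_le1.
  have P0 : 0 <= 8 * K * Lam ^+ 2.
    by apply: mulr_ge0; rewrite ?sqr_ge0// mulr_ge0// ltW.
  apply: (@le_trans _ _ (8 * K * Lam ^+ 2 * ((40 * K + 40 * K ^+ 2) * L^-1))).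
    have -> : 8 * K * Lam * theta * (Lam * (40 * K / s + 40 * K ^+ 2 / s ^+ 2)) =
        8 * K * Lam ^+ 2 * (40 * K * (theta / s) + 40 * K ^+ 2 * (theta / s ^+ 2)) by ring.
    apply: (ler_wpM2l P0); rewrite [leRHS]mulrDl; apply: lerD; apply: ler_wpM2l => //.
      exact: mulr_ge0 (ler0n _ _) (ltW K0).
    exact: mulr_ge0 (ler0n _ _) (sqr_ge0 _).
  have dE : r - delta - I = D0 by [].
  rewrite dE mulrA ler_pdivrMr// /L /comparison_constant -/Lam -/D0.
  have -> : K * D0 * (1 + 8 * Lam ^+ 2 * (40 * K + 40 * K ^+ 2) / D0) =
      K * D0 + 8 * K * Lam ^+ 2 * (40 * K + 40 * K ^+ 2) by field; rewrite gt_eqF.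
  by rewrite lerDr mulr_ge0// ltW.
have qL : `|q| <= Lam.
  by rewrite /Lam /comparison_rate -!addrA lerDl !addr_ge0// ?sqr_ge0// mulr_ge0.
have sL : sigma ^+ 2 <= Lam.
  by rewrite /Lam /comparison_rate -3!addrA addrCA lerDl !addr_ge0// mulr_ge0.
have ML : 2 * M <= Lam.
  by rewrite /Lam /comparison_rate -2!addrA addrCA lerDl !addr_ge0// sqr_ge0.
have IL : I <= Lam.
  by rewrite /Lam /comparison_rate -addrA addrCA lerDl !addr_ge0// ?sqr_ge0// mulr_ge0.
have [D VXD] := bermudan_levy_le K0 r0 delta0 I0 muB_step muX_approx qL sL ML IL Lam0 bK s0
  sb theta0 small.
have xK : x <= K by rewrite (le_trans (ltW xb))// (le_trans _ bK)// gerBl ltW.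
rewrite max_l ?subr_ge0//; apply: (priceX_le (D := D)) => // n.
apply: VXD => //; last exact: ltW.
(* A Bermudan value with fewer steps left is at most the one on the full grid, hence at most the
   American Black-Scholes price, which does not exceed K - y below [b]. *)
move=> k y kn y0 yb; have hn : 0 < theta / n.+1%:R by rewrite divr_gt0.
rewrite (le_trans (bermudan_nondecreasing (ltW K0) (muB _) (disc01 hn) y kn))//.
by rewrite -lee_fin; exact: le_trans (VB_le n theta0 y0) (hB y yb y0).
Qed.

Lemma comparison_constant_gt0 : 0 < L.
Proof. exact: lt_le_trans L1. Qed.

End Assembly.

Theorem theorem4p1 (R : realType) (d : measure_display) (Omega : measurableType d)
  (P : probability Omega R) (X B : R -> Omega -> R)
  (sigma gamma : R) (nu : {measure set R -> \bar R}) (T K r delta : R) :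
  complete_prob P ->
  0 < T -> 0 < K -> 0 < r -> 0 <= delta ->
  Levy_process P X sigma gamma nu ->
  Brownian_motion P (usual_filtration P X) B ->
  (\int[nu]_(x in [set x : R | 1 <= `|x|]%R) (expR x)%:E < +oo)%E ->
  ((sigma ^+ 2 / 2 + gamma)%:E
     + \int[nu]_x (expR x - 1 - (if `|x| <= 1 then x else 0)%R)%:E = 0)%E ->
  0 < sigma ->
  (\int[nu]_(x in [set x : R | `|x| <= 1]%R) (`|x|%R)%:E < +oo)%E ->
  0 < d_plus nu r delta ->
  let F := usual_filtration P X in
  let S x := fun t w => x * expR ((r - delta) * t + X t w) in
  let SBS x := fun t w => x * expR ((r - delta - sigma ^+ 2 / 2) * t + sigma * B t w) in
  let b t := critical_price (fun x => amer_put P F (S x) r K (T - t)) K in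
  let bBS t := critical_price (fun x => amer_put P F (SBS x) r K (T - t)) K in
  exists C : R, 0 < C /\ exists eps : R, 0 < eps /\
    forall t, 0 <= t -> T - eps < t -> t < T ->
      0 <= bBS t - b t /\ bBS t - b t <= C * Num.sqrt (T - t).
Proof.
move=> cP T0 K0 r0 delta0 XL BM nu_exp mart sigma0 nu_fv d0 F S SBS b bBS.
pose C := comparison_constant sigma nu K r delta.
exists C; split; first exact: comparison_constant_gt0.
(* The only smallness asked of the horizon is T - t < 1, and the constant does not depend on it. *)
exists 1; split=> // t t0 tT1 tT.
have theta0 : 0 < T - t by rewrite subr_gt0.
have theta1 : T - t < 1 by lra.
exact: (critical_price_comparison cP K0 r0 delta0 XL BM nu_exp mart sigma0 nu_fv d0
  theta0 theta1).
Qed.
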